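(* Let $T$ be an edge-to-edge unit-area dihedral tiling of a flat torus by tiles each congruent either to one fixed efficient pentagon or to one fixed Type 2 non-convex pentagon, and suppose that the perimeter per tile of $T$ is less than or equal to half the perimeter of a unit-area Prismatic pentagon, i.e. at most $\sqrt{2+\sqrt3}$. Then the ratio of the number of efficient pentagons to the number of non-convex pentagons in $T$ is greater than $34.77$.
   Context: Edge-to-edge means adjacent tiles meet only along entire edges or at vertices. A dihedral tiling is one with two prototiles. The perimeter per tile of a tiling of a flat torus is the total length of all edges of the tiling (each edge counted once) divided by the number of tiles. A Cairo (respectively Prismatic) pentagon is a pentagon with three angles of $2\pi/3$ and two right angles which are nonadjacent (respectively adjacent), circumscribed about a circle; at unit area both have perimeter $2\sqrt{2+\sqrt3}\approx 3.86$. A unit-area pentagon is efficient if its perimeter is less than or equal to that of a unit-area Cairo pentagon. A Type 2 non-convex pentagon is a pentagon with two interior angles (adjacent or non-adjacent) larger than $\pi$. *)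

(* Defs.v *)
From HB Require Import structures.
From mathcomp Require Import all_boot all_order all_algebra.
From mathcomp Require Import all_classical all_reals all_analysis.
Set Implicit Arguments.
Unset Strict Implicit.
Unset Printing Implicit Defensive.
Import Order.TTheory GRing.Theory Num.Theory.
Import numFieldNormedType.Exports.
Local Open Scope classical_set_scope.
Local Open Scope ring_scope.

(* The library norm on R * R is the sup norm, so Euclidean lengths are
   introduced separately; the topology and boundedness are the same for both. *)
Notation plane R := (R * R)%type.

Definition dot (R : realType) (u v : plane R) : R := u.1 * v.1 + u.2 * v.2.

Definition elength (R : realType) (u : plane R) : R := Num.sqrt (dot u u).

Definition edist (R : realType) (x y : plane R) : R := elength (y - x).

Definition direction (R : realType) (x y : plane R) : plane R :=
  ((y - x).1 / edist x y, (y - x).2 / edist x y).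

Definition segment (R : realType) (x y : plane R) : set (plane R) :=
  [set z | exists2 t : R, 0 <= t <= 1 &
           z = (x.1 + t * (y - x).1, x.2 + t * (y - x).2)].

Definition translate (R : realType) (d : plane R) (A : set (plane R)) :
  set (plane R) := [set x + d | x in A].

(* Vertex indices are taken modulo 5: + and - on 'I_5 are those of Z/5Z. *)
Definition side (R : realType) (v : 'I_5 -> plane R) (k : 'I_5) :
  set (plane R) := segment (v k) (v (k + 1)).

Definition simple_closed (R : realType) (v : 'I_5 -> plane R) : Prop :=
  injective v /\
  forall (k l : 'I_5) (x : plane R), k != l -> side v k x -> side v l x ->
    (l = k + 1 /\ x = v l) \/ (k = l + 1 /\ x = v k).

Record pentagon (R : realType) := Pentagon {
  vertex :> 'I_5 -> plane R;
  vertex_simple : simple_closed vertex }.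

Definition outline (R : realType) (p : pentagon R) : set (plane R) :=
  \bigcup_(k in [set: 'I_5]) side p k.

(* Jordan interior: the points lying in a bounded component of the complement
   of the outline. *)
Definition inside (R : realType) (p : pentagon R) : set (plane R) :=
  [set x | (~` outline p) x /\
           bounded_set (connected_component (~` outline p) x)].

Definition region (R : realType) (p : pentagon R) : set (plane R) :=
  outline p `|` inside p.

Definition area (R : realType) (p : pentagon R) : \bar R :=
  ((@lebesgue_measure R) \x (@lebesgue_measure R))%E (region p).

Definition side_length (R : realType) (p : pentagon R) (k : 'I_5) : R :=
  edist (p k) (p (k + 1)).

Definition perimeter (R : realType) (p : pentagon R) : R :=
  \sum_(k < 5) side_length p k.

(* The two sides at a vertex bound two sectors, of angles theta <= pi and
   2 pi - theta; the pentagon fills the first one exactly when it contains, near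
   the vertex, the bisector of the sides.  For theta = pi the bisector
   degenerates to the vertex itself and the value is 2 pi - pi = pi. *)
Definition interior_angle (R : realType) (p : pentagon R) (k : 'I_5) : R :=
  let u := direction (p k) (p (k + 1)) in
  let w := direction (p k) (p (k - 1)) in
  let theta := acos (dot u w) in
  if `[< \forall t \near 0^'+,
         inside p ((p k).1 + t * (u + w).1, (p k).2 + t * (u + w).2) >]
  then theta else 2 * pi - theta.

(* A plane isometry (possibly orientation reversing) carries p to q, matching
   the vertices up to a rotation or a reversal of the cyclic labelling. *)
Definition congruent (R : realType) (p q : pentagon R) : Prop :=
  exists2 f : plane R -> plane R,
    (forall x y, edist (f x) (f y) = edist x y) &
    exists k : 'I_5, (forall i, q (k + i) = f (p i)) \/
                     (forall i, q (k - i) = f (p i)).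

(* Some closed disc is contained in p and touches all its sides. *)
Definition circumscribed (R : realType) (p : pentagon R) : Prop :=
  exists (o : plane R) (r : R),
    [/\ 0 < r, [set x | edist o x <= r] `<=` region p &
        forall k, exists2 x, side p k x & edist o x = r].

Definition cairo (R : realType) (p : pentagon R) : Prop :=
  circumscribed p /\
  exists k : 'I_5, forall i,
    interior_angle p i =
      if (i == k) || (i == k + 2) then pi / 2 else 2 * pi / 3.

Definition prismatic (R : realType) (p : pentagon R) : Prop :=
  circumscribed p /\
  exists k : 'I_5, forall i,
    interior_angle p i =
      if (i == k) || (i == k + 1) then pi / 2 else 2 * pi / 3.

Definition efficient (R : realType) (p : pentagon R) : Prop :=
  area p = 1%E /\
  exists c : pentagon R,
    [/\ cairo c, area c = 1%E & perimeter p <= perimeter c].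

Definition type2 (R : realType) (p : pentagon R) : Prop :=
  #|[pred k | pi < interior_angle p k]| = 2%N.

Definition independent (R : realType) (a b : plane R) : Prop :=
  a.1 * b.2 - a.2 * b.1 != 0.

Definition lattice (R : realType) (a b : plane R) : set (plane R) :=
  [set d | exists m n : int, d = a *~ m + b *~ n].

(* A tiling of the flat torus R^2 / (Za + Zb) by N pentagons is given by one
   lift to the plane of each tile.  Taking i = j in the second clause, the
   interior of a tile embeds in the torus; its boundary may touch itself. *)
Definition torus_tiling (R : realType) (a b : plane R) (N : nat)
    (T : 'I_N -> pentagon R) : Prop :=
  [/\ independent a b,
      forall x, exists i d, lattice a b d /\ translate d (region (T i)) x &
      forall i j d x, lattice a b d ->
        inside (T i) x -> translate d (inside (T j)) x -> i = j /\ d = 0].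

Definition edge_to_edge (R : realType) (a b : plane R) (N : nat)
    (T : 'I_N -> pentagon R) : Prop :=
  forall i j d x, lattice a b d -> ~ (i = j /\ d = 0) ->
    region (T i) x -> translate d (region (T j)) x ->
    (exists k l, x = T i k /\ x = T j l + d) \/
    (exists k l, side (T i) k x /\ side (T i) k = translate d (side (T j) l)).

(* Side e.2 of tile e.1 and side f.2 of tile f.1 have the same image in the
   torus. *)
Definition same_edge (R : realType) (a b : plane R) (N : nat)
    (T : 'I_N -> pentagon R) : rel ('I_N * 'I_5) :=
  fun e f => `[< exists2 d, lattice a b d &
                 side (T e.1) e.2 = translate d (side (T f.1) f.2) >].

(* One tile side for each edge of the tiling. *)
Definition edges (R : realType) (a b : plane R) (N : nat)
    (T : 'I_N -> pentagon R) : {set 'I_N * 'I_5} :=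
  transversal (equivalence_partition (same_edge a b T) finset.setT)
              finset.setT.

Definition perimeter_per_tile (R : realType) (a b : plane R) (N : nat)
    (T : 'I_N -> pentagon R) : R :=
  (\sum_(e in edges a b T) side_length (T e.1) e.2) / N%:R.

Definition count_congruent (R : realType) (N : nat) (T : 'I_N -> pentagon R)
    (p : pentagon R) : nat :=
  #|[pred i | `[< congruent p (T i) >]]|.

Definition dihedral (R : realType) (N : nat) (T : 'I_N -> pentagon R)
    (p q : pentagon R) : Prop :=
  [/\ ~ congruent p q,
      forall i, congruent p (T i) \/ congruent q (T i),
      exists i, congruent p (T i) & exists i, congruent q (T i)].

(* Main.v *)
Require Import Defs.
From HB Require Import structures.
From mathcomp Require Import all_boot all_order all_algebra.
From mathcomp Require Import all_classical all_reals all_analysis.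
From mathcomp Require Import measurable_realfun.
From mathcomp Require Import ring lra zify.
Import Order.TTheory GRing.Theory Num.Theory.
Import numFieldNormedType.Exports.
(* Again, since the analysis library has an [edist] of its own. *)
Require Import Defs.
Local Open Scope classical_set_scope.
Local Open Scope ring_scope.
Set Implicit Arguments.
Unset Strict Implicit.
Unset Printing Implicit Defensive.

(** The hypotheses exclude each other: every such tiling has a larger perimeter
    per tile.  Write [P0 = 2 sqrt (2 + sqrt 3)], approximately 3.864.

    A reflex vertex lies in the convex hull of the other four, so the hull of a
    Type 2 pentagon is a triangle; a unit-area Type 2 pentagon therefore has at
    least the perimeter [pQ > 4.55] of the equilateral triangle of area 1.  An
    efficient pentagon has perimeter at most [P0 < 4] and is convex, since the
    hull of four points joined by a closed path of length [L] has area at most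
    [L^2 / 16].  Lhuilier's inequality then bounds its squared perimeter [pE^2]
    below by 4 times the sum of [cot (a / 2)] over its angles [a].

    At a vertex of the tiling the angles of the efficient pentagons add up to at
    most [2 pi], and to exactly [2 pi] if no non-convex pentagon has a corner
    there.  Comparing [cot (a / 2)] with its tangents at [pi / 2] and
    [2 pi / 3] and summing over all vertices, [pE^2] falls below [P0^2] by at most
    [60 delta NQ / NE], where [NE] and [NQ] count the two kinds of tiles and
    [delta = (1 - 1 / sqrt 3) (5 - 2 sqrt 6) < 0.044].  Each edge lies on at most
    two tiles, so the hypothesis on the perimeter per tile gives
    [NE pE + NQ pQ <= (NE + NQ) P0].  Together these force
    [P0 (pQ - P0) <= 60 delta], which is false numerically. *)

(** * Plane vectors, a theorem of the alternative, and Heron's formula *)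

Section PlaneVectors.
Variable R : realType.
Implicit Types (u v w x y z A B C D : plane R) (t : R).

(** Interior, area and angle are defined topologically, so most of the work is a bridge to signed
    areas. Two one-sided criteria take the place of the full Jordan curve theorem: a point that a
    line strictly cuts off from all vertices is outside the region, and a point off the outline from
    which a ray meets an odd number of sides is inside. Regions are not shown to be measurable;
    their areas are compared with measurable covers and with open triangles inside them. The values
    of [interior_angle] do not reveal in which direction a pentagon turns at a vertex, so the
    convexity of Cairo and Prismatic pentagons is extracted from sign patterns of turns. The factor
    60 is [4 * 5 * 3]: the factor 4 of Lhuilier's inequality, the five corners of a non-convex tile,
    and at most three efficient corners that can lose [delta] each at the vertex where such a corner
    sits, since four or more corners have nonnegative total excess. Of the non-convex tiles only
    their number, perimeter and number of corners enter. The last comparison is narrow, about 2.66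
    against 2.62 after rounding, which dictates the rational bounds. *)

Definition crs u v : R := u.1 * v.2 - u.2 * v.1.

Definition orient A B C : R := crs (B - A) (C - A).

Definition ray x u t : plane R := (x.1 + t * u.1, x.2 + t * u.2).

Lemma pairE x y : x.1 = y.1 -> x.2 = y.2 -> x = y.
Proof. by case: x y => x1 x2 [y1 y2] /= -> ->. Qed.

Lemma dotC u v : dot u v = dot v u.
Proof. by rewrite /dot mulrC [X in _ + X]mulrC. Qed.

Lemma crsC u v : crs u v = - crs v u.
Proof. rewrite /crs; ring. Qed.

Lemma crsvv u : crs u u = 0.
Proof. rewrite /crs; ring. Qed.

Lemma dot_ge0 u : 0 <= dot u u.
Proof. by rewrite /dot -!expr2 addr_ge0 ?sqr_ge0. Qed.

Lemma dot_eq0 u : (dot u u == 0) = (u == 0).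
Proof.
rewrite /dot -!expr2 paddr_eq0 ?sqr_ge0 // !sqrf_eq0.
by case: u => a b; rewrite xpair_eqE.
Qed.

Lemma dot_gt0 u : u != 0 -> 0 < dot u u.
Proof. by move=> u0; rewrite lt_def dot_eq0 u0 dot_ge0. Qed.

Lemma elength_ge0 u : 0 <= elength u. Proof. exact: sqrtr_ge0. Qed.

Lemma elength_sqr u : elength u ^+ 2 = dot u u.
Proof. by rewrite sqr_sqrtr // dot_ge0. Qed.

Lemma elength_eq0 u : (elength u == 0) = (u == 0).
Proof. by rewrite -sqrf_eq0 elength_sqr dot_eq0. Qed.

Lemma elength_gt0 u : u != 0 -> 0 < elength u.
Proof. by move=> u0; rewrite lt_def elength_eq0 u0 elength_ge0. Qed.

Lemma elengthN u : elength (- u) = elength u.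
Proof. by rewrite /elength /dot /= !mulrNN. Qed.

Lemma lagrange u v : dot u v ^+ 2 + crs u v ^+ 2 = dot u u * dot v v.
Proof. rewrite /dot /crs; ring. Qed.

Lemma dot_le_elength u v : dot u v <= elength u * elength v.
Proof.
apply: (@le_trans _ _ `|dot u v|); first exact: ler_norm.
rewrite -(@ler_pXn2r _ 2) ?nnegrE ?mulr_ge0 ?elength_ge0 //.
by rewrite real_normK ?num_real // exprMn !elength_sqr -lagrange lerDl sqr_ge0.
Qed.

Lemma crs_le_elength u v : `|crs u v| <= elength u * elength v.
Proof.
rewrite -(@ler_pXn2r _ 2) ?nnegrE ?mulr_ge0 ?elength_ge0 //.
by rewrite real_normK ?num_real // exprMn !elength_sqr -lagrange lerDr sqr_ge0.
Qed.

Lemma elengthD u v : elength (u + v) <= elength u + elength v.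
Proof.
rewrite -(@ler_pXn2r _ 2) ?nnegrE ?addr_ge0 ?elength_ge0 //.
have := dot_le_elength u v.
have -> : elength (u + v) ^+ 2 = dot u u + dot v v + 2 * dot u v.
  rewrite elength_sqr /dot /=; ring.
rewrite -!elength_sqr; move: (elength u) (elength v) (dot u v) => a b c; nra.
Qed.

Lemma edistC x y : edist x y = edist y x.
Proof. by rewrite /edist -elengthN opprB. Qed.

Lemma edist_ge0 x y : 0 <= edist x y. Proof. exact: elength_ge0. Qed.

Lemma edist_tri x y z : edist x z <= edist x y + edist y z.
Proof.
have := elengthD (y - x) (z - y); rewrite /edist.
by rewrite addrC subrKA.
Qed.

Lemma edist_gt0 x y : x != y -> 0 < edist x y.
Proof. by move=> xy; rewrite elength_gt0 // subr_eq0 eq_sym. Qed.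

Lemma orient_rot A B C : orient A B C = orient B C A.
Proof. rewrite /orient /crs /=; ring. Qed.

Lemma orient_swap A B C : orient A B C = - orient B A C.
Proof. rewrite /orient /crs /=; ring. Qed.

Definition in_tri A B C x := exists a b c : R,
  [/\ 0 <= a, 0 <= b, 0 <= c, a + b + c = 1 &
      x = (a * A.1 + b * B.1 + c * C.1, a * A.2 + b * B.2 + c * C.2)].

Lemma in_tri_swap12 A B C x : in_tri A B C x -> in_tri B A C x.
Proof.
move=> [a [b [c [a0 b0 c0 s ->]]]]; exists b, a, c; split => //; first lra.
by congr pair; ring.
Qed.

Lemma in_tri_swap23 A B C x : in_tri A B C x -> in_tri A C B x.
Proof.
move=> [a [b [c [a0 b0 c0 s ->]]]]; exists a, c, b; split => //; first lra.
by congr pair; ring.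
Qed.

(** Gordan's theorem in the plane, with Carathéodory's bound of three vectors built in. When the
    half-plane found for the tail fails for the new vector [u], either a half-plane bounded almost
    along [u] works, or [u] and two vectors on opposite sides of its line surround 0. *)
Lemma gordan (s : seq (plane R)) :
  (exists n, forall u, u \in s -> 0 < dot n u) \/
  (exists u v w, [/\ u \in s, v \in s, w \in s & in_tri u v w 0]).
Proof.
elim: s => [|u s [[n Hn]|[a [b [c [ha hb hc habc]]]]]].
- by left; exists 0 => u; rewrite in_nil.
- have [nu|nu] := ltP 0 (dot n u).
    by left; exists n => v; rewrite inE => /orP[/eqP->|/Hn].
  have [/eqP u0|u0] := boolP (u == 0).
    right; exists u, u, u; split; rewrite ?mem_head //.
    exists 1, 0, 0; split => //; first lra.
    by rewrite u0 /=; apply/pairE => /=; ring.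
  (* All of [s] lies strictly on one side of the line of [u], the sign [f] telling which. The normal
     of that line is tilted by a small [e] towards [u]. *)
  have key (f : R) : f ^+ 2 = 1 -> (forall v, v \in s -> 0 < f * crs u v) ->
      exists n, forall v, v \in u :: s -> 0 < dot n v.
    move=> ff Hf.
    have [e e0 He] : exists2 e : R, 0 < e & forall v, v \in s ->
        0 < f * crs u v + e * dot u v.
      elim: s Hf {Hn} => [|v s IH] Hf; first by exists 1.
      have [|e e0 He] := IH; first by move=> w ws; apply: Hf; rewrite inE ws orbT.
      have Hv := Hf v (mem_head _ _).
      have [e1 e10 He1] : exists2 e1 : R, 0 < e1 & forall e2 : R, 0 < e2 -> e2 <= e1 ->
          0 < f * crs u v + e2 * dot u v.
        exists (f * crs u v / (1 + `|dot u v|)).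
          by rewrite divr_gt0 // ltr_wpDr.
        move=> e2 e20; rewrite ler_pdivlMr; last by rewrite ltr_wpDr.
        move=> h.
        have h1 : - dot u v <= `|dot u v| by rewrite -normrN ler_norm.
        have h2 : e2 * (- dot u v) <= e2 * `|dot u v| by rewrite ler_pM2l.
        by move: h h2 Hv; lra.
      exists (Num.min e e1); first by rewrite lt_min e0 e10.
      move=> w; rewrite inE => /orP[/eqP->|ws].
        by apply: He1; rewrite ?lt_min ?e0 ?e10 // ge_min lexx orbT.
      have fw := Hf w; rewrite inE ws orbT in fw; have {}fw := fw isT.
      have := He w ws; have : Num.min e e1 <= e by rewrite ge_min lexx.
      have : 0 < Num.min e e1 by rewrite lt_min e0 e10.
      by move: (Num.min _ _) => m; move: (f * _) fw (dot u w) => a ha b; nra.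
    exists (- f * u.2 + e * u.1, f * u.1 + e * u.2) => v.
    have -> : dot (- f * u.2 + e * u.1, f * u.1 + e * u.2) v =
        f * crs u v + e * dot u v by rewrite /dot /crs /=; ring.
    rewrite inE => /orP[/eqP->|/He //].
    by rewrite crsvv mulr0 add0r mulr_gt0 // dot_gt0.
  have [/allP Hp|/allPn[v1 v1s]] := boolP (all (fun v => 0 < crs u v) s).
    by left; apply: (key 1); [rewrite expr1n|move=> v /Hp; rewrite mul1r].
  rewrite -leNgt => c1.
  have [/allP Hp|/allPn[v2 v2s]] := boolP (all (fun v => crs u v < 0) s).
    left; apply: (key (-1)) => [|v /Hp]; first by rewrite sqrrN expr1n.
    by rewrite mulN1r oppr_gt0.
  rewrite -leNgt => c2; right.
  have n1 := Hn _ v1s; have n2 := Hn _ v2s.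
  (* Cramer's linear relation between three plane vectors, paired with [n]; [idv] is the same
     relation in coordinates. *)
  have id : crs v2 v1 * dot n u + (- crs u v1) * dot n v2 + crs u v2 * dot n v1 = 0.
    rewrite /crs /dot; ring.
  have idv : forall i : bool, let q := fun v : plane R => if i then v.1 else v.2 in
      crs v2 v1 * q u + (- crs u v1) * q v2 + crs u v2 * q v1 = 0.
    by case; rewrite /crs /=; ring.
  (* Were it negative, all three terms of [id] would be nonnegative and hence zero, which forces
     [u = 0]. *)
  have c21 : 0 <= crs v2 v1.
    rewrite leNgt; apply/negP => neg.
    have nu' : dot n u < 0.
      rewrite lt_neqAle nu andbT; apply/eqP => nu0.
      have e1 : crs u v1 = 0.
        by move: id; rewrite nu0; move: (crs u v1) (crs u v2) c1 c2 => p q; nra.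
      have e2 : crs u v2 = 0.
        by move: id; rewrite nu0 e1; move: (crs u v2) c2 => q; nra.
      move: (idv true) (idv false); rewrite /= e1 e2 oppr0 !mul0r !addr0.
      move=> /eqP + /eqP; rewrite !mulf_eq0 !(lt_eqF neg) /= => /eqP a1 /eqP a2.
      by move/eqP: u0; apply; apply: pairE.
    by move: id; move: (crs u v1) (crs u v2) (crs v2 v1) neg c1 c2 => p q r; nra.
  have [sm|sm] := ltP 0 (crs v2 v1 + (- crs u v1) + crs u v2).
    exists u, v2, v1; split; rewrite ?mem_head ?inE ?v1s ?v2s ?orbT //.
    set S := (X in 0 < X) in sm.
    exists (crs v2 v1 / S), (- crs u v1 / S), (crs u v2 / S).
    have S0 : S != 0 by rewrite gt_eqF.
    split; rewrite ?divr_ge0 ?(ltW sm) ?oppr_ge0 //.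
      by rewrite -!mulrDl divff.
    have := idv true; have := idv false; rewrite /= => i2 i1.
    by apply: pairE; rewrite /= -?[_ / S * _]mulrAC -!mulrDl ?i1 ?i2 mul0r.
  (* All coefficients of the relation vanish: [u] and [v1] point in opposite directions, and 0 lies
     on the segment between them. *)
  have e1 : crs u v1 = 0.
    by move: (crs u v1) (crs u v2) (crs v2 v1) c1 c2 c21 sm => p q r; lra.
  have un : dot n u != 0.
    apply/negP => /eqP nu0.
    have : dot u u * dot n v1 = 0.
      have : dot u u * dot n v1 = dot u v1 * dot n u + crs u v1 * crs u n.
        rewrite /dot /crs; ring.
      by rewrite nu0 e1 mulr0 mul0r addr0.
    move/eqP; rewrite mulf_eq0 dot_eq0 (negPf u0) /= => /eqP h.
    by rewrite h ltxx in n1.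
  have nu' : dot n u < 0 by rewrite lt_neqAle un nu.
  set S := dot n v1 - dot n u.
  have S0 : 0 < S by rewrite /S; lra.
  exists u, v1, v1; split; rewrite ?mem_head ?inE ?v1s ?orbT //.
  exists (dot n v1 / S), (- dot n u / S), 0.
  have Sn : S != 0 by rewrite gt_eqF.
  split; rewrite ?divr_ge0 ?oppr_ge0 ?(ltW S0) ?(ltW n1) //.
    by rewrite addr0 -mulrDl divff.
  have i1 : dot n v1 * u.1 - dot n u * v1.1 = 0.
    have -> : dot n v1 * u.1 - dot n u * v1.1 = n.2 * crs u v1.
      rewrite /dot /crs; ring.
    by rewrite e1 mulr0.
  have i2 : dot n v1 * u.2 - dot n u * v1.2 = 0.
    have -> : dot n v1 * u.2 - dot n u * v1.2 = - n.1 * crs u v1.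
      rewrite /dot /crs; ring.
    by rewrite e1 mulr0.
  apply: pairE => /=; rewrite mul0r addr0 -![_ / S * _]mulrAC -mulrDl.
    by rewrite mulNr i1 mul0r.
  by rewrite mulNr i2 mul0r.
- by right; exists a, b, c; split; rewrite // inE ?ha ?hb ?hc orbT.
Qed.

Lemma in_tri_sub A B C x :
  in_tri (A - x) (B - x) (C - x) 0 -> in_tri A B C x.
Proof.
move=> [a [b [c [a0 b0 c0 s /= e]]]]; exists a, b, c; split => //.
move: e => [e1 e2]; apply: pairE => /=; nra.
Qed.

Lemma separation (s : seq (plane R)) x :
  (exists n, forall y, y \in s -> 0 < dot n (y - x)) \/
  (exists u v w, [/\ u \in s, v \in s, w \in s & in_tri u v w x]).
Proof.
have [[n Hn]|[a [b [c [ha hb hc habc]]]]] := gordan [seq y - x | y <- s].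
  by left; exists n => y ys; apply: Hn; apply/mapP; exists y.
right; move: ha hb hc habc => /mapP[u us ->] /mapP[v vs ->] /mapP[w ws ->] h.
by exists u, v, w; split => //; apply: in_tri_sub.
Qed.

(** The isoperimetric inequality for triangles: in Heron's formula, AM-GM is applied to the three
    factors other than the perimeter, whose sum is the perimeter again. *)
Lemma heron A B C (p := edist A B + edist B C + edist C A) :
  (orient A B C) ^+ 2 * 108 <= p ^+ 4.
Proof.
set a := edist B C; set b := edist C A; set c := edist A B.
have a0 : 0 <= a by exact: edist_ge0.
have b0 : 0 <= b by exact: edist_ge0.
have c0 : 0 <= c by exact: edist_ge0.
have ta : a <= b + c.
  by have := edist_tri B A C; rewrite (edistC B A) (edistC A C) -/a -/b -/c; lra.
have tb : b <= a + c.
  by have := edist_tri C B A; rewrite (edistC C B) (edistC B A) -/a -/b -/c; lra.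
have tc : c <= a + b.
  by have := edist_tri A C B; rewrite (edistC A C) (edistC C B) -/a -/b -/c; lra.
have -> : p = a + b + c by rewrite /p -/a -/b -/c; ring.
have he : 4 * (orient A B C) ^+ 2 =
    (a + b + c) * (b + c - a) * (a + c - b) * (a + b - c).
  have -> : (a + b + c) * (b + c - a) * (a + c - b) * (a + b - c) =
     4 * b ^+ 2 * c ^+ 2 - (b ^+ 2 + c ^+ 2 - a ^+ 2) ^+ 2 by ring.
  rewrite /a /b /c /edist !elength_sqr /orient /crs /dot /=; ring.
have am (X Y Z : R) : 0 <= X -> 0 <= Y -> 0 <= Z ->
    27 * (X * Y * Z) <= (X + Y + Z) ^+ 3.
  move=> X0 Y0 Z0; rewrite -subr_ge0.
  have -> : (X + Y + Z) ^+ 3 - 27 * (X * Y * Z) =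
      (X + Y + Z) * ((X - Y) ^+ 2 + (Y - Z) ^+ 2 + (Z - X) ^+ 2) / 2
      + 3 * (X * (Y - Z) ^+ 2 + Y * (Z - X) ^+ 2 + Z * (X - Y) ^+ 2) by field.
  have S0 : 0 <= X + Y + Z by rewrite !addr_ge0.
  have q0 (x y z : R) : 0 <= x ^+ 2 + y ^+ 2 + z ^+ 2.
    by rewrite !addr_ge0 ?sqr_ge0.
  apply: addr_ge0; first by rewrite divr_ge0 // mulr_ge0.
  by rewrite mulr_ge0 // !addr_ge0 // mulr_ge0 ?sqr_ge0.
have := am (b + c - a) (a + c - b) (a + b - c).
have -> : b + c - a + (a + c - b) + (a + b - c) = a + b + c by ring.
rewrite !subr_ge0 => /(_ ta tb tc) h.
have -> : orient A B C ^+ 2 * 108 = 27 * (4 * orient A B C ^+ 2) by ring.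
rewrite he exprS.
have -> : 27 * ((a + b + c) * (b + c - a) * (a + c - b) * (a + b - c)) =
  (a + b + c) * (27 * ((b + c - a) * (a + c - b) * (a + b - c))) by ring.
by apply: ler_wpM2l h; rewrite !addr_ge0.
Qed.

End PlaneVectors.

(** * Area between two lines over an interval *)

Section AreaOfTriangles.
Variable R : realType.
Implicit Types (A B C z : plane R) (X Y : set (plane R)).

Notation lambda := (@lebesgue_measure R).
Notation mu2 := (lambda \x lambda)%E.

Lemma lebesgue_le (X Y : set R) : X `<=` Y -> (lambda X <= lambda Y)%E.
Proof. by move=> XY; apply: le_mu_ext. Qed.

(** Holds for arbitrary sets, as is required for [region]: the Lebesgue measure here is an outer
    measure, and the integral of a nonnegative function is a supremum over the simple functions
    below it. *)
Lemma mu2_le X Y : X `<=` Y -> (mu2 X <= mu2 Y)%E.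
Proof.
move=> XY; rewrite /product_measure1 !ge0_integralTE //.
apply: ereal_sup_le => _ [h hX <-]; exists h => // x.
apply: le_trans (hX x) _; apply: lebesgue_le => y.
by rewrite !xsectionE /=; exact: XY.
Qed.

Lemma integral_affine (a b c d : R) : a < b ->
  (\int[lambda]_(x in `[a, b]) (c + d * x)%:E =
    (c * (b - a) + d * (b ^+ 2 - a ^+ 2) / 2)%:E)%E.
Proof.
move=> ab; pose F (x : R) := c * x + d / 2 * x ^+ 2.
have dF (x : R) : is_derive x (1 : R) F (c + d * x).
  rewrite /F; apply: is_derive_eq; rewrite !scaler1 /GRing.scale /=.
  by rewrite -mulr_natl; field.
have cF : continuous F.
  by move=> x; apply: differentiable_continuous; apply/derivable1_diffP.
rewrite (@continuous_FTC2 R (fun x => c + d * x) F) //.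
- by rewrite -EFinB /F; congr (_%:E); field.
- apply: continuous_subspaceT => x.
  by apply: cvgD; [exact: cvg_cst|apply: cvgMr; exact: cvg_id].
- split; [by move=> x _; case: (dF x) | |].
  + by apply: cvg_at_right_filter; exact: cF.
  + by apply: cvg_at_left_filter; exact: cF.
- by move=> x _; rewrite derive1E; case: (dF x).
Qed.

Lemma lebesgue_between (p q : R) :
  lambda [set y | 0 <= (y - p) * (q - y)] = `|q - p|%:E.
Proof.
wlog pq : p q / p <= q.
  move=> H; have [/H//|/ltW /H e] := leP p q; rewrite distrC -e.
  by congr (lambda _); apply/seteqP; split => y /=; congr (_ <= _); ring.
have -> : [set y | 0 <= (y - p) * (q - y)] = `[p, q]%classic.
  apply/seteqP; split => y /=; rewrite in_itv /=; last first.
    by move=> /andP[py yq]; rewrite mulr_ge0 // subr_ge0.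
  move=> h; apply/andP; split; rewrite leNgt; apply/negP => c; move: h c pq; nra.
rewrite lebesgue_measure_itv /= lte_fin ger0_norm ?subr_ge0 //.
case: ltP => // qp; have -> : p = q by apply/le_anti; rewrite pq qp.
by rewrite subrr.
Qed.

Lemma lebesgue_between_open (p q : R) :
  lambda [set y | 0 < (y - p) * (q - y)] = `|q - p|%:E.
Proof.
wlog pq : p q / p <= q.
  move=> H; have [/H//|/ltW /H e] := leP p q; rewrite distrC -e.
  by congr (lambda _); apply/seteqP; split => y /=; congr (_ < _); ring.
have -> : [set y | 0 < (y - p) * (q - y)] = `]p, q[%classic.
  apply/seteqP; split => y /=; rewrite in_itv /=; last first.
    by move=> /andP[py yq]; rewrite mulr_gt0 // subr_gt0.
  move=> h; apply/andP; split; rewrite ltNge; apply/negP => c; move: h c pq; nra.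
rewrite lebesgue_measure_itv /= lte_fin ger0_norm ?subr_ge0 //.
case: ltP => // qp; have -> : p = q by apply/le_anti; rewrite pq qp.
by rewrite subrr.
Qed.

(** The product is nonnegative exactly between the two lines, whichever of them is on top. *)
Definition cstrip (a b p0 p1 q0 q1 : R) : set (plane R) :=
  [set z | a <= z.1 <= b /\
           0 <= (z.2 - (p0 + p1 * z.1)) * ((q0 + q1 * z.1) - z.2)].

Definition ostrip (a b p0 p1 q0 q1 : R) : set (plane R) :=
  [set z | a < z.1 < b /\
           0 < (z.2 - (p0 + p1 * z.1)) * ((q0 + q1 * z.1) - z.2)].

Section Strip.
Variables (a b p0 p1 q0 q1 : R).
Let D x := (q0 + q1 * x) - (p0 + p1 * x).
Hypothesis ab : a < b.
Hypothesis Dab : 0 <= D a * D b.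

Let integral_gap :
  (\int[lambda]_(x in `[a, b]) `|D x|%:E = (`|D a + D b| / 2 * (b - a))%:E)%E.
Proof.
(* The lines do not cross strictly between [a] and [b], so with one sign [s] the gap is [s * D x]
   throughout, an affine function. *)
have [s [ss sa sb]] : exists s : R, [/\ s ^+ 2 = 1, 0 <= s * D a & 0 <= s * D b].
  have [a0|a0] := leP 0 (D a); have [b0|b0] := leP 0 (D b).
  - by exists 1; rewrite !mul1r expr1n.
  - have -> : D a = 0 by apply/le_anti; rewrite a0 andbT; move: Dab; nra.
    by exists (-1); rewrite sqrrN expr1n mulr0 mulN1r oppr_ge0; split => //; lra.
  - have -> : D b = 0 by apply/le_anti; rewrite b0 andbT; move: Dab; nra.
    by exists (-1); rewrite sqrrN expr1n mulr0 mulN1r oppr_ge0; split => //; lra.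
  - by exists (-1); rewrite sqrrN expr1n !mulN1r !oppr_ge0; split => //; lra.
have sN (x : R) : 0 <= s * x -> `|x| = s * x.
  move=> sx; rewrite -(ger0_norm sx) normrM.
  have : `|s| ^+ 2 = 1 by rewrite real_normK ?num_real.
  by move/eqP; rewrite sqrp_eq1 // => /eqP ->; rewrite mul1r.
transitivity (\int[lambda]_(x in `[a, b]) (s * (q0 - p0) + s * (q1 - p1) * x)%:E)%E; last first.
  rewrite integral_affine //; congr (_%:E); rewrite sN.
    by rewrite /D; field.
  by rewrite mulrDr addr_ge0.
apply: eq_integral => x; rewrite inE /= in_itv /= => /andP[ax xb]; congr (_%:E); rewrite sN.
  by rewrite /D; ring.
have ba : 0 < b - a by rewrite subr_gt0.
rewrite -(pmulr_lge0 _ ba).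
have -> : s * D x * (b - a) = (b - x) * (s * D a) + (x - a) * (s * D b).
  by rewrite /D; ring.
by rewrite addr_ge0 // mulr_ge0 // subr_ge0.
Qed.

Lemma mu2_cstrip : mu2 (cstrip a b p0 p1 q0 q1) = (`|D a + D b| / 2 * (b - a))%:E.
Proof.
rewrite -integral_gap /product_measure1 [RHS]integral_mkcond.
apply: eq_integral => x _; rewrite patchE /= xsectionE.
case: ifPn => [|/negP]; rewrite inE /= in_itv /= => xab.
  rewrite -lebesgue_between; congr (lambda _).
  by apply/seteqP; split => y /=; [case|move=> ?; split].
rewrite [X in lambda X](_ : _ = set0) ?measure0 //.
by apply/seteqP; split => // y [] /=.
Qed.

Lemma mu2_ostrip : mu2 (ostrip a b p0 p1 q0 q1) = (`|D a + D b| / 2 * (b - a))%:E.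
Proof.
rewrite -integral_gap (@integral_itv_bndoo R a b _ true false); last first.
  apply/measurable_EFinP; apply: measurableT_comp => //.
  apply: measurable_funB; apply: measurable_funD => //; exact: measurable_funM.
rewrite /product_measure1 [RHS]integral_mkcond.
apply: eq_integral => x _; rewrite patchE /= xsectionE.
case: ifPn => [|/negP]; rewrite inE /= in_itv /= => xab.
  rewrite -lebesgue_between_open; congr (lambda _).
  by apply/seteqP; split => y /=; [case|move=> ?; split].
rewrite [X in lambda X](_ : _ = set0) ?measure0 //.
by apply/seteqP; split => // y [] /=.
Qed.

End Strip.

Lemma mu2_vertical (a : R) : mu2 [set z | z.1 = a] = 0%E.
Proof.
have -> : [set z : plane R | z.1 = a] = [set a] `*` setT.
  by apply/seteqP; split => z /=; [move=> ->; split|case].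
rewrite product_measure1E //; set w := (X in (X * _)%E).
by have -> : w = 0%E by [exact: lebesgue_measure_set1]; rewrite mul0e.
Qed.

Lemma measurable_gt0 (f : plane R -> R) :
  measurable_fun setT f -> measurable [set z | 0 < f z].
Proof.
move=> mf; have -> : [set z | 0 < f z] = setT `&` f @^-1` `]0, +oo[%classic.
  by apply/seteqP; split => z /=; rewrite in_itv /= andbT //; case.
exact: mf.
Qed.

Lemma measurable_ge0 (f : plane R -> R) :
  measurable_fun setT f -> measurable [set z | 0 <= f z].
Proof.
move=> mf; have -> : [set z | 0 <= f z] = setT `&` f @^-1` `[0, +oo[%classic.
  by apply/seteqP; split => z /=; rewrite in_itv /= andbT //; case.
exact: mf.
Qed.

Lemma measurable_affine (a b c : R) :
  measurable_fun setT (fun z : plane R => a + b * z.1 + c * z.2).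
Proof.
apply: measurable_funD; first apply: measurable_funD => //.
  by apply: measurable_funM => //; exact: measurable_fst.
by apply: measurable_funM => //; exact: measurable_snd.
Qed.

Lemma measurable_orient A B : measurable_fun setT (orient A B).
Proof.
have -> : orient A B = (fun z : plane R =>
    (- (B - A).1 * A.2 + (B - A).2 * A.1) + (- (B - A).2) * z.1 + (B - A).1 * z.2).
  by apply/funext => z; rewrite /orient /crs /=; ring.
exact: measurable_affine.
Qed.

Lemma measurable_cstrip a b p0 p1 q0 q1 : measurable (cstrip a b p0 p1 q0 q1).
Proof.
have -> : cstrip a b p0 p1 q0 q1 =
  ([set z | 0 <= (- a) + 1 * z.1 + 0 * z.2] `&` [set z | 0 <= b + (-1) * z.1 + 0 * z.2])
  `&` [set z | 0 <= (- p0 + (- p1) * z.1 + 1 * z.2) * (q0 + q1 * z.1 + (-1) * z.2)].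
  apply/seteqP; split => z /=.
    move=> [/andP[h1 h2] h3]; split; first by split; lra.
    by move: h3; congr (_ <= _); ring.
  move=> [[h1 h2] h3]; split; first by apply/andP; split; lra.
  by move: h3; congr (_ <= _); ring.
apply: measurableI; first apply: measurableI; apply: measurable_ge0;
  try exact: measurable_affine.
by apply: measurable_funM; exact: measurable_affine.
Qed.

Lemma measurable_ostrip a b p0 p1 q0 q1 : measurable (ostrip a b p0 p1 q0 q1).
Proof.
have -> : ostrip a b p0 p1 q0 q1 =
  ([set z | 0 < (- a) + 1 * z.1 + 0 * z.2] `&` [set z | 0 < b + (-1) * z.1 + 0 * z.2])
  `&` [set z | 0 < (- p0 + (- p1) * z.1 + 1 * z.2) * (q0 + q1 * z.1 + (-1) * z.2)].
  apply/seteqP; split => z /=.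
    move=> [/andP[h1 h2] h3]; split; first by split; lra.
    by move: h3; congr (_ < _); ring.
  move=> [[h1 h2] h3]; split; first by apply/andP; split; lra.
  by move: h3; congr (_ < _); ring.
apply: measurableI; first apply: measurableI; apply: measurable_gt0;
  try exact: measurable_affine.
by apply: measurable_funM; exact: measurable_affine.
Qed.

End AreaOfTriangles.

(** * Area of a triangle from above and from below *)

Section TriangleArea.
Variable R : realType.
Implicit Types (A B C z : plane R).

Notation lambda := (@lebesgue_measure R).
Notation mu2 := (lambda \x lambda)%E.

(** The factor [orient A B C] makes the set independent of the order of the vertices, and empty for
    a degenerate triangle. *)
Definition open_tri A B C : set (plane R) :=
  [set z | [/\ 0 < orient A B C * orient A B z, 0 < orient A B C * orient B C z &
               0 < orient A B C * orient C A z]].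

Lemma orient_in_tri A B C P Q (a b c : R) : a + b + c = 1 ->
  orient P Q (a * A.1 + b * B.1 + c * C.1, a * A.2 + b * B.2 + c * C.2) =
  a * orient P Q A + b * orient P Q B + c * orient P Q C.
Proof.
move=> s; have -> : a = 1 - b - c by lra.
rewrite /orient /crs /=; ring.
Qed.

Lemma orient_swap23 A B C : orient A B C = - orient A C B.
Proof. rewrite /orient /crs /=; ring. Qed.

Lemma orient1 A B : orient A B A = 0. Proof. rewrite /orient /crs /=; ring. Qed.
Lemma orient2 A B : orient A B B = 0. Proof. rewrite /orient /crs /=; ring. Qed.

Let slope A B : R := (B.2 - A.2) / (B.1 - A.1).
Let base A B : R := A.2 - slope A B * A.1.

Let line_orient A B z : A.1 != B.1 ->
  z.2 - (base A B + slope A B * z.1) = orient A B z / (B.1 - A.1).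
Proof. by move=> AB; rewrite /base /slope /orient /crs /=; field; rewrite subr_eq0 eq_sym. Qed.

Let line_orientN A B z : A.1 != B.1 ->
  (base A B + slope A B * z.1) - z.2 = - orient A B z / (B.1 - A.1).
Proof. by move=> AB; rewrite -opprB line_orient // mulNr. Qed.

Let line1 A B : base A B + slope A B * A.1 = A.2.
Proof. by rewrite /base subrK. Qed.

Let line2 A B : A.1 != B.1 -> base A B + slope A B * B.1 = B.2.
Proof.
move=> AB; have := line_orient B AB.
by rewrite orient2 mul0r => /eqP; rewrite subr_eq0 => /eqP <-.
Qed.

Let tri_covered A B C := exists S, [/\ measurable S, in_tri A B C `<=` S &
  (mu2 S <= (`|orient A B C| / 2)%:E)%E].

(** The vertical line through the middle vertex [B] cuts the triangle into two strips, each between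
    [A C] and one of the other sides. *)
Let sorted_tri_covered A B C : A.1 <= B.1 -> B.1 <= C.1 -> tri_covered A B C.
Proof.
move=> AB BC; have [AC|AC] := ltP A.1 C.1; last first.
  exists [set z | z.1 = A.1]; split.
  - have -> : [set z : plane R | z.1 = A.1] = [set A.1] `*` setT.
      by apply/seteqP; split => z /=; [move=> ->; split|case].
    exact: measurableX.
  - move=> z [a [b [c [a0 b0 c0 s ->]]]] /=.
    have -> : B.1 = A.1 by lra.
    have -> : C.1 = A.1 by lra.
    by rewrite -!mulrDl s mul1r.
  - by rewrite mu2_vertical lee_fin divr_ge0.
set O := orient A B C.
have ACn : A.1 != C.1 by rewrite lt_eqF.
have key : forall z, in_tri A B C z ->
   (A.1 < B.1 /\ cstrip A.1 B.1 (base A B) (slope A B) (base A C) (slope A C) z) \/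
   (B.1 < C.1 /\ cstrip B.1 C.1 (base B C) (slope B C) (base A C) (slope A C) z).
  move=> z [a [b [c [a0 b0 c0 s ez]]]].
  have z1 : z.1 = a * A.1 + b * B.1 + c * C.1 by rewrite ez.
  have oAB : orient A B z = c * O.
    by rewrite ez orient_in_tri // orient1 orient2 !mulr0 !add0r.
  have oBC : orient B C z = a * O.
    by rewrite ez orient_in_tri // orient1 orient2 !mulr0 !addr0 -orient_rot.
  have oAC : orient A C z = - (b * O).
    rewrite ez orient_in_tri // orient1 orient2 !mulr0 add0r addr0.
    by rewrite orient_swap23 mulrN.
  have Az : A.1 <= z.1 by rewrite z1; move: s a0 b0 c0 AB BC; nra.
  have zC : z.1 <= C.1 by rewrite z1; move: s a0 b0 c0 AB BC; nra.
  have [/andP[AB' zB]|nAB] := boolP ((A.1 < B.1) && (z.1 <= B.1)).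
    left; split => //; split => /=; first by rewrite Az zB.
    rewrite line_orient ?lt_eqF // oAB line_orientN // oAC opprK.
    have -> : c * O / (B.1 - A.1) * (b * O / (C.1 - A.1)) =
      c * b * O ^+ 2 * ((B.1 - A.1)^-1 * (C.1 - A.1)^-1) by ring.
    have i0 (x : R) : 0 < x -> 0 <= x^-1 by move=> x0; rewrite invr_ge0 ltW.
    apply: mulr_ge0; last by apply: mulr_ge0; rewrite i0 ?subr_gt0.
    by apply: mulr_ge0; [exact: mulr_ge0|exact: sqr_ge0].
  right; have [BC'|BC'] := ltP B.1 C.1; last first.
    exfalso; move: nAB; have -> : B.1 = C.1 by apply/le_anti; rewrite BC BC'.
    by rewrite AC zC.
  have Bz : B.1 <= z.1.
    move: nAB; rewrite negb_and -leNgt -ltNge => /orP[BA|/ltW //].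
    exact: le_trans BA Az.
  split => //; split => /=; first by rewrite Bz zC.
  rewrite line_orient ?lt_eqF // oBC line_orientN // oAC opprK.
  have i0 (x : R) : 0 < x -> 0 <= x^-1 by move=> x0; rewrite invr_ge0 ltW.
  have -> : a * O / (C.1 - B.1) * (b * O / (C.1 - A.1)) =
    a * b * O ^+ 2 * ((C.1 - B.1)^-1 * (C.1 - A.1)^-1) by ring.
  apply: mulr_ge0; last by apply: mulr_ge0; rewrite i0 ?subr_gt0.
    by apply: mulr_ge0; [exact: mulr_ge0|exact: sqr_ge0].
set S1 := cstrip A.1 B.1 _ _ _ _ in key.
set S2 := cstrip B.1 C.1 _ _ _ _ in key.
(* Signed length of the vertical cut, the common base of both pieces; their widths add up to
   [C.1 - A.1]. *)
pose H := base A C + slope A C * B.1 - B.2.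
have HO : H * (C.1 - A.1) = O.
  have := line_orient B ACn; move/(congr1 (fun t => t * (C.1 - A.1))).
  rewrite mulfVK ?subr_eq0 1?eq_sym // /H => e.
  by rewrite -opprB mulNr e /O orient_swap23 opprK.
have m1 : A.1 < B.1 -> mu2 S1 = (`|H| / 2 * (B.1 - A.1))%:E.
  move=> AB'; rewrite /S1 mu2_cstrip // !line1 subrr ?mul0r // add0r.
  by rewrite line2 // lt_eqF.
have m2 : B.1 < C.1 -> mu2 S2 = (`|H| / 2 * (C.1 - B.1))%:E.
  move=> BC'; rewrite /S2 mu2_cstrip // !line1 !line2 ?lt_eqF // subrr ?mulr0 //.
  by rewrite addr0.
have tot : `|O| / 2 = `|H| / 2 * (B.1 - A.1) + `|H| / 2 * (C.1 - B.1).
  have CA0 : 0 <= C.1 - A.1 by rewrite subr_ge0 ltW.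
  by rewrite -HO normrM (ger0_norm CA0); field.
have [AB'|AB'] := ltP A.1 B.1; have [BC'|BC'] := ltP B.1 C.1.
- exists (S1 `|` S2); split.
  + by apply: measurableU; exact: measurable_cstrip.
  + by move=> z /key[[_ h]|[_ h]]; [left|right].
  + rewrite tot EFinD -m1 // -m2 //.
    by apply: measureU2; exact: measurable_cstrip.
- have CB : C.1 - B.1 = 0 by lra.
  exists S1; split; first exact: measurable_cstrip.
    by move=> z /key[[_ h]|[]] //; rewrite ltNge BC'.
  by rewrite tot CB mulr0 addr0 -m1.
- have BA : B.1 - A.1 = 0 by lra.
  exists S2; split; first exact: measurable_cstrip.
    by move=> z /key[[]|[_ h]] //; rewrite ltNge AB'.
  by rewrite tot BA mulr0 add0r -m2.
- by move: AC; rewrite ltNge (le_trans BC' AB').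
Qed.

(** The area is bounded on a measurable superset because subadditivity of the measure is applied to
    such sets in [mu2_cover]. *)
Lemma tri_cover A B C : exists S, [/\ measurable S, in_tri A B C `<=` S &
  (mu2 S <= (`|orient A B C| / 2)%:E)%E].
Proof.
rewrite -/(tri_covered A B C).
have H12 (P Q S : plane R) : tri_covered P Q S -> tri_covered Q P S.
  move=> [X [mX XS h]]; exists X; split => // [z /in_tri_swap12/XS //|].
  by rewrite orient_swap normrN.
have H23 (P Q S : plane R) : tri_covered P Q S -> tri_covered P S Q.
  move=> [X [mX XS h]]; exists X; split => // [z /in_tri_swap23/XS //|].
  by rewrite orient_swap23 normrN.
have [AB|/ltW AB] := leP A.1 B.1; have [BC|/ltW BC] := leP B.1 C.1;
  have [AC|/ltW AC] := leP A.1 C.1.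
- exact: sorted_tri_covered.
- exact: sorted_tri_covered.
- by apply: H23; exact: sorted_tri_covered.
- by apply/H23/H12/sorted_tri_covered.
- by apply: H12; exact: sorted_tri_covered.
- by apply/H12/H23/sorted_tri_covered.
- by apply/H12/H23/H12/sorted_tri_covered => //; exact: le_trans AC.
- by apply/H12/H23/H12/sorted_tri_covered.
Qed.

Lemma mu2_cover (s : seq (plane R * plane R * plane R)) (X : set (plane R)) :
  (forall x, X x -> exists2 t, t \in s & in_tri t.1.1 t.1.2 t.2 x) ->
  (mu2 X <= (\sum_(t <- s) `|orient t.1.1 t.1.2 t.2| / 2)%:E)%E.
Proof.
have [S [mS sS muS]] : exists S, [/\ measurable S,
    forall t, t \in s -> in_tri t.1.1 t.1.2 t.2 `<=` S &
    (mu2 S <= (\sum_(t <- s) `|orient t.1.1 t.1.2 t.2| / 2)%:E)%E].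
  elim: s => [|t s [S [mS sS muS]]].
    by exists set0; split => //; rewrite big_nil measure0.
  have [S' [mS' sS' muS']] := tri_cover t.1.1 t.1.2 t.2.
  exists (S' `|` S); split; first exact: measurableU.
    by move=> u; rewrite inE => /orP[/eqP->|/sS h] x hx; [left; exact: sS'|right; exact: h].
  rewrite big_cons EFinD; apply: (@le_trans _ _ (mu2 S' + mu2 S)%E).
    exact: measureU2.
  exact: leeD.
move=> XS; apply: le_trans muS; apply: mu2_le => x /XS[t ts]; exact: sS.
Qed.

(** The two open strips are disjoint and lie in the triangle. In each, the strip condition gives two
    orientations the same sign, one bound on the abscissa identifies this sign, and the other bound
    yields the third inequality through the barycentric identities [osum] and [ofst]. *)
Let sorted_open_tri A B C : A.1 <= B.1 -> B.1 <= C.1 -> orient A B C != 0 ->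
  ((`|orient A B C| / 2)%:E <= mu2 (open_tri A B C))%E.
Proof.
move=> AB BC; set O := orient A B C => O0.
have AC : A.1 < C.1.
  rewrite lt_neqAle (le_trans AB BC) andbT; apply/eqP => e.
  have eB : B.1 = A.1 by apply/le_anti; rewrite AB e BC.
  by move/eqP: O0; apply; rewrite /O /orient /crs /= eB e !subrr; ring.
have ACn : A.1 != C.1 by rewrite lt_eqF.
have OO : 0 < O ^+ 2 by rewrite lt_def sqrf_eq0 O0 sqr_ge0.
have osum z : orient A B z + orient B C z + orient C A z = O.
  by rewrite /O /orient /crs /=; ring.
have ofst z : orient B C z * A.1 + orient C A z * B.1 + orient A B z * C.1 = O * z.1.
  by rewrite /O /orient /crs /=; ring.
set S1 := ostrip A.1 B.1 (base A B) (slope A B) (base A C) (slope A C).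
set S2 := ostrip B.1 C.1 (base B C) (slope B C) (base A C) (slope A C).
have pos (u v : R) : 0 < u * v -> 0 < O * (u + v) -> 0 < O * u /\ 0 < O * v.
  move=> uv Ouv; have : 0 < (O * u) * (O * v).
    by rewrite mulrACA mulr_gt0 // -expr2.
  by move: Ouv; rewrite mulrDr; move: (O * u) (O * v) => p q; nra.
have s1 : S1 `<=` open_tri A B C.
  move=> z [/= /andP[Az zB]]; have AB' := lt_trans Az zB.
  rewrite line_orient ?lt_eqF // line_orientN //.
  rewrite (orient_swap A C).
  set u := orient A B z; set v := orient C A z; set w := orient B C z.
  move=> h.
  have uv : 0 < u * v.
    have : u * v = (u / (B.1 - A.1) * (- - v / (C.1 - A.1))) *
       ((B.1 - A.1) * (C.1 - A.1)).
      by field; rewrite !subr_eq0 !gt_eqF.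
    by move=> ->; rewrite mulr_gt0 // mulr_gt0 // subr_gt0.
  have e1 := osum z; have e2 := ofst z; rewrite -/u -/v -/w in e1 e2.
  have zC : 0 < O ^+ 2 * (B.1 - z.1) by rewrite mulr_gt0 // subr_gt0.
  have e3 : O ^+ 2 * (B.1 - z.1) = (O * w) * (B.1 - A.1) - (O * u) * (C.1 - B.1).
    have -> : O ^+ 2 * (B.1 - z.1) = O * (O * B.1 - O * z.1) by ring.
    by rewrite -e2 -e1; ring.
  have e4 : 0 < O ^+ 2 * (z.1 - A.1) by rewrite mulr_gt0 // subr_gt0.
  have e5 : O ^+ 2 * (z.1 - A.1) = (O * v) * (B.1 - A.1) + (O * u) * (C.1 - A.1).
    have -> : O ^+ 2 * (z.1 - A.1) = O * (O * z.1 - O * A.1) by ring.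
    by rewrite -e2 -e1; ring.
  have [Ou Ov] : 0 < O * u /\ 0 < O * v.
    have OuOv : 0 < (O * u) * (O * v) by rewrite mulrACA mulr_gt0 // -expr2.
    move: e4; rewrite e5; move: (O * u) (O * v) OuOv => p q pq h'.
    by split; rewrite ltNge; apply/negP => n; move: pq h' n AB' AC; nra.
  split => //; rewrite -/O -/w.
  move: zC; rewrite e3; move: (O * w) (O * u) Ou => p q q0 h'.
  by rewrite ltNge; apply/negP => n; move: h' n q0 AB' BC; nra.
have s2 : S2 `<=` open_tri A B C.
  move=> z [/= /andP[Bz zC]]; have BC' := lt_trans Bz zC.
  rewrite line_orient ?lt_eqF // line_orientN //.
  rewrite (orient_swap A C).
  set u := orient A B z; set v := orient C A z; set w := orient B C z.
  move=> h.
  have wv : 0 < w * v.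
    have : w * v = (w / (C.1 - B.1) * (- - v / (C.1 - A.1))) *
       ((C.1 - B.1) * (C.1 - A.1)).
      by field; rewrite !subr_eq0 !gt_eqF.
    by move=> ->; rewrite mulr_gt0 // mulr_gt0 // subr_gt0.
  have e1 := osum z; have e2 := ofst z; rewrite -/u -/v -/w in e1 e2.
  have zB : 0 < O ^+ 2 * (z.1 - B.1) by rewrite mulr_gt0 // subr_gt0.
  have e3 : O ^+ 2 * (z.1 - B.1) = (O * u) * (C.1 - B.1) - (O * w) * (B.1 - A.1).
    have -> : O ^+ 2 * (z.1 - B.1) = O * (O * z.1 - O * B.1) by ring.
    by rewrite -e2 -e1; ring.
  have e4 : 0 < O ^+ 2 * (C.1 - z.1) by rewrite mulr_gt0 // subr_gt0.
  have e5 : O ^+ 2 * (C.1 - z.1) = (O * v) * (C.1 - B.1) + (O * w) * (C.1 - A.1).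
    have -> : O ^+ 2 * (C.1 - z.1) = O * (O * C.1 - O * z.1) by ring.
    by rewrite -e2 -e1; ring.
  have [Ow Ov] : 0 < O * w /\ 0 < O * v.
    have OwOv : 0 < (O * w) * (O * v) by rewrite mulrACA mulr_gt0 // -expr2.
    move: e4; rewrite e5; move: (O * w) (O * v) OwOv => p q pq h'.
    by split; rewrite ltNge; apply/negP => n; move: pq h' n BC' AC; nra.
  split => //; rewrite -/O -/u.
  move: zB; rewrite e3; move: (O * u) (O * w) Ow => p q q0 h'.
  by rewrite ltNge; apply/negP => n; move: h' n q0 AB BC'; nra.
pose H := base A C + slope A C * B.1 - B.2.
have HO : H * (C.1 - A.1) = O.
  have := line_orient B ACn; move/(congr1 (fun t => t * (C.1 - A.1))).
  rewrite mulfVK ?subr_eq0 1?eq_sym // /H => e.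
  by rewrite -opprB mulNr e /O orient_swap23 opprK.
have m1 : A.1 < B.1 -> mu2 S1 = (`|H| / 2 * (B.1 - A.1))%:E.
  move=> AB'; rewrite /S1 mu2_ostrip // !line1 subrr ?mul0r // add0r.
  by rewrite line2 // lt_eqF.
have m2 : B.1 < C.1 -> mu2 S2 = (`|H| / 2 * (C.1 - B.1))%:E.
  move=> BC'; rewrite /S2 mu2_ostrip // !line1 !line2 ?lt_eqF // subrr ?mulr0 //.
  by rewrite addr0.
have tot : `|O| / 2 = `|H| / 2 * (B.1 - A.1) + `|H| / 2 * (C.1 - B.1).
  have CA0 : 0 <= C.1 - A.1 by rewrite subr_ge0 ltW.
  by rewrite -HO normrM (ger0_norm CA0); field.
have [AB'|AB'] := ltP A.1 B.1; have [BC'|BC'] := ltP B.1 C.1.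
- rewrite tot EFinD -m1 // -m2 // -measureU.
  + by apply: mu2_le => z [/s1|/s2].
  + exact: measurable_ostrip.
  + exact: measurable_ostrip.
  + apply/seteqP; split => // z [[/= /andP[_ zB] _] [/= /andP[Bz _] _]].
    by have := lt_trans zB Bz; rewrite ltxx.
- have CB : C.1 - B.1 = 0 by lra.
  by rewrite tot CB mulr0 addr0 -m1 //; exact: mu2_le.
- have BA : B.1 - A.1 = 0 by lra.
  by rewrite tot BA mulr0 add0r -m2 //; exact: mu2_le.
- by move: AC; rewrite ltNge (le_trans BC' AB').
Qed.

Lemma mu2_open_tri_ge A B C : orient A B C != 0 ->
  ((`|orient A B C| / 2)%:E <= mu2 (open_tri A B C))%E.
Proof.
move: A B C.
pose P A B C := orient A B C != 0 ->
  ((`|orient A B C| / 2)%:E <= mu2 (open_tri A B C))%E.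
have H12 A B C : P A B C -> P B A C.
  rewrite /P orient_swap oppr_eq0 normrN => h /h; congr (_ <= mu2 _)%E.
  by apply/seteqP; split => z [h1 h2 h3]; split;
    move: h1 h2 h3; rewrite /orient /crs /=; nra.
have H23 A B C : P A B C -> P A C B.
  have e : orient A C B = - orient A B C := orient_swap23 A C B.
  rewrite /P e oppr_eq0 normrN => h /h; congr (_ <= mu2 _)%E.
  by apply/seteqP; split => z [h1 h2 h3]; split;
    move: h1 h2 h3; rewrite /orient /crs /=; nra.
move=> A B C; rewrite -/(P A B C).
have [AB|/ltW AB] := leP A.1 B.1; have [BC|/ltW BC] := leP B.1 C.1;
  have [AC|/ltW AC] := leP A.1 C.1.
- exact: sorted_open_tri.
- exact: sorted_open_tri.
- by apply: H23; exact: sorted_open_tri.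
- by apply/H23/H12/sorted_open_tri.
- by apply: H12; exact: sorted_open_tri.
- by apply/H12/H23/sorted_open_tri.
- by apply/H12/H23/H12/sorted_open_tri => //; exact: le_trans AC.
- by apply/H12/H23/H12/sorted_open_tri.
Qed.

Lemma measurable_open_tri A B C : measurable (open_tri A B C).
Proof.
have m (c : R) P Q : measurable [set z : plane R | 0 < c * orient P Q z].
  apply: measurable_gt0; apply: measurable_funM => //; exact: measurable_orient.
have -> : open_tri A B C = ([set z | 0 < orient A B C * orient A B z] `&`
  [set z | 0 < orient A B C * orient B C z]) `&` [set z | 0 < orient A B C * orient C A z].
  by apply/seteqP; split => z /= [] // [].
by apply: measurableI => //; exact: measurableI.
Qed.

End TriangleArea.

(** * Special angles and the half-angle cotangent *)

Section Trigonometry.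
Variable R : realType.
Implicit Types (a b x : R).

Lemma cos_pi3 : cos (pi / 3) = 1 / 2 :> R.
Proof.
set h : R := pi / 3.
have pi3 : pi = h + (h + h) by rewrite /h; field.
have pi0 := pi_gt0 R.
have ch : 0 < cos h.
  by apply: cos_gt0_pihalf; rewrite /h; apply/andP; split; lra.
have := cospi R; rewrite pi3 !cosD !sinD => e.
have s2 := sin2cos2 h.
(* Factorisation of [4 c^3 - 3 c + 1], which vanishes since the cosine of [3 h = pi] is -1. *)
have : (cos h + 1) * (2 * cos h - 1) ^+ 2 = 0.
  have -> : (cos h + 1) * (2 * cos h - 1) ^+ 2 =
     cos h * (cos h * cos h - sin h * sin h) -
     sin h * (sin h * cos h + cos h * sin h) + 1 -
     3 * cos h * (1 - cos h ^+ 2 - sin h ^+ 2) by ring.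
  by rewrite e s2 subrr mulr0; ring.
move/eqP; rewrite mulf_eq0 sqrf_eq0 gt_eqF ?ltr_wpDr //=.
by move=> /eqP h2; lra.
Qed.

Lemma sin_pi3 : sin (pi / 3) = Num.sqrt 3 / 2 :> R.
Proof.
have s0 : 0 <= sin (pi / 3) :> R.
  by apply: sin_ge0_pi; have := pi_gt0 R; lra.
apply/eqP; rewrite -(@eqrXn2 _ 2) ?divr_ge0 ?sqrtr_ge0 //.
by rewrite sin2cos2 cos_pi3 !expr_div_n sqr_sqrtr //; apply/eqP; field.
Qed.

Lemma cos_2pi3 : cos (2 * pi / 3) = - (1 / 2) :> R.
Proof.
have -> : 2 * pi / 3 = pi / 3 + pi / 3 :> R by field.
by rewrite cosD -!expr2 sin2cos2 cos_pi3; field.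
Qed.

Lemma sin_2pi3 : sin (2 * pi / 3) = Num.sqrt 3 / 2 :> R.
Proof.
have -> : 2 * pi / 3 = pi / 3 + pi / 3 :> R by field.
by rewrite sinD cos_pi3 sin_pi3; field.
Qed.

(* cot (a / 2) *)
Definition hcot a : R := (1 + cos a) / sin a.

(** Convexity of [cot (a / 2)]: its derivative [- 1 / (1 - cos a)] increases, and the mean value
    theorem compares chord and tangent. *)
Lemma hcot_tangent a b : 0 < a < pi -> 0 < b < pi ->
  hcot b - (a - b) / (1 - cos b) <= hcot a.
Proof.
have cos_lt1 x : 0 < x < pi -> 0 < 1 - cos x.
  move=> /andP[x0 xp]; rewrite subr_gt0 -[ltRHS]cos0.
  by rewrite ltr_cos ?in_itv /= ?lexx ?pi_ge0 ?ltW.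
have dh x : 0 < x < pi -> is_derive x (1 : R) hcot (- (1 - cos x)^-1).
  move=> xp; have s0 : sin x != 0 by rewrite gt_eqF // sin_gt0_pi.
  have c0 : 1 - cos x != 0 by rewrite gt_eqF // cos_lt1.
  have dV : is_derive x (1 : R) (fun y => (sin y)^-1) (- (sin x) ^- 2 *: cos x).
    exact: is_deriveV.
  apply: (is_derive_eq (is_deriveM (is_deriveD (is_derive_cst _ _ _) (is_derive_cos x)) dV)).
  have -> : (cst 1 + cos) x = 1 + cos x by [].
  rewrite /GRing.scale /= add0r.
  have e : sin x ^+ 2 = (1 - cos x) * (1 + cos x) by rewrite sin2cos2; ring.
  have c1 : 1 + cos x != 0.
    by apply/eqP => h; move/eqP: s0; apply; apply/eqP; rewrite -sqrf_eq0 e h mulr0.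
  transitivity (- (cos x * (1 + cos x) + sin x ^+ 2) / sin x ^+ 2); first by field.
  by rewrite e; field; rewrite c0 c1.
have mvt x y : 0 < x -> x < y -> y < pi ->
    exists2 c, x < c < y & hcot y - hcot x = - (1 - cos c)^-1 * (y - x).
  move=> x0 xy yp.
  have [||c + ->] := @MVT R hcot (fun c => - (1 - cos c)^-1) x y xy.
  - by move=> c; rewrite in_itv /= => /andP[xc cy]; apply: dh; rewrite (lt_trans x0) //= (lt_trans cy).
  - apply: derivable_within_continuous => c; rewrite in_itv /= => /andP[xc cy].
    by have := dh c; rewrite (lt_le_trans x0 xc) (le_lt_trans cy yp) => /(_ isT) [].
  - by rewrite in_itv /= => xcy; exists c.
have cos_mono x y : 0 < x -> x < y -> y < pi -> cos y < cos x.
  move=> x0 xy yp; rewrite ltr_cos ?in_itv /= ?xy ?(ltW x0) ?(ltW (lt_trans xy yp)) //.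
  by rewrite (ltW (lt_trans x0 xy)) ltW.
move=> /andP[a0 ap] /andP[b0 bp].
have [ab|ba|->] := ltgtP a b.
- have [c /andP[ac cb] e] := mvt _ _ a0 ab bp.
  have h : (1 - cos b)^-1 <= (1 - cos c)^-1.
    rewrite lef_pV2 ?posrE ?cos_lt1 ?b0 ?(lt_trans a0 ac) ?(lt_trans cb bp) //.
    by rewrite lerD2l lerN2 ltW // cos_mono // (lt_trans a0 ac).
  have := ler_wpM2l (ltW (_ : 0 < b - a)) h; rewrite subr_gt0 => /(_ ab).
  by move: e; move: (hcot b) (hcot a) (1 - cos b)^-1 (1 - cos c)^-1 => p q r s; lra.
- have [c /andP[ac cb] e] := mvt _ _ b0 ba ap.
  have h : (1 - cos c)^-1 <= (1 - cos b)^-1.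
    rewrite lef_pV2 ?posrE ?cos_lt1 ?b0 ?(lt_trans b0 ac) ?(lt_trans cb ap) //.
    by rewrite lerD2l lerN2 ltW // cos_mono // (lt_trans cb ap).
  have := ler_wpM2l (ltW (_ : 0 < a - b)) h; rewrite subr_gt0 => /(_ ba).
  by move: e; move: (hcot b) (hcot a) (1 - cos b)^-1 (1 - cos c)^-1 => p q r s; lra.
- by rewrite subrr mul0r subr0.
Qed.

Lemma acos_eq a x : 0 <= a <= pi -> cos a = x -> acos x = a.
Proof. by move=> ap <-; rewrite cosK // in_itv. Qed.

End Trigonometry.

(** * Angles between vectors and angle sums *)

Section VectorAngles.
Variable R : realType.
Implicit Types (u v w A B C : plane R).

Definition vcos u w : R := dot u w / (elength u * elength w).
Definition vsin u w : R := crs u w / (elength u * elength w).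
Definition vang u w : R := acos (vcos u w).

Lemma crs_neq0 u w : crs u w != 0 -> u != 0 /\ w != 0.
Proof.
move=> c; split; apply/eqP => e; move/eqP: c; apply; rewrite e /crs /=; ring.
Qed.

Lemma vcos2Dsin2 u w : crs u w != 0 -> vcos u w ^+ 2 + vsin u w ^+ 2 = 1.
Proof.
move=> /crs_neq0[u0 w0]; rewrite !expr_div_n -mulrDl lagrange exprMn !elength_sqr.
by rewrite divff // mulf_neq0 // dot_eq0.
Qed.

Lemma vsin_gt0 u w : 0 < crs u w -> 0 < vsin u w.
Proof.
move=> c; have [u0 w0] := crs_neq0 (lt0r_neq0 c).
by rewrite divr_gt0 // mulr_gt0 // elength_gt0.
Qed.

Lemma vcos_itv u w : 0 < crs u w -> -1 < vcos u w < 1.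
Proof.
move=> c; have := vcos2Dsin2 (lt0r_neq0 c); have := vsin_gt0 c.
move: (vcos u w) (vsin u w) => x y y0 xy.
by apply/andP; split; rewrite ltNge; apply/negP => h; move: xy y0 h; nra.
Qed.

Lemma cos_vang u w : 0 < crs u w -> cos (vang u w) = vcos u w.
Proof.
by move=> /vcos_itv/andP[c1 c2]; rewrite acosK // in_itv /= !ltW.
Qed.

Lemma vang_gt0 u w : 0 < crs u w -> 0 < vang u w.
Proof. by move=> /vcos_itv/andP[c1 c2]; rewrite acos_gt0 // ltW. Qed.

Lemma vang_ltpi u w : 0 < crs u w -> vang u w < pi.
Proof. by move=> /vcos_itv/andP[c1 c2]; rewrite acos_ltpi // c1 ltW. Qed.

Lemma sin_vang u w : 0 < crs u w -> sin (vang u w) = vsin u w.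
Proof.
move=> c; have s0 := ltW (vsin_gt0 c).
have a0 := vang_gt0 c; have ap := vang_ltpi c.
apply/eqP; rewrite -(@eqrXn2 _ 2) //; last by apply: sin_ge0_pi; rewrite !ltW.
rewrite sin2cos2 cos_vang // -(vcos2Dsin2 (lt0r_neq0 c)).
by apply/eqP; ring.
Qed.

Lemma sin_gt0_lt_pi (x : R) : 0 < x < 2 * pi -> 0 < sin x -> x < pi.
Proof.
move=> /andP[x0 x2] s; rewrite ltNge; apply/negP => xp.
have : 0 <= sin (x - pi) by apply: sin_ge0_pi; apply/andP; split; lra.
rewrite sinB cospi sinpi mulr0 subr0 mulrN1; lra.
Qed.

(** [acos] inverts the cosine only up to [pi], so besides the addition formulas the sum has to be
    kept below [pi]; its sine is positive by the hypothesis on [u] and [w], which settles this. *)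
Lemma vang_add u v w : 0 < crs u v -> 0 < crs v w -> 0 < crs u w ->
  vang u w = vang u v + vang v w.
Proof.
move=> uv vw uw; have [u0 w0] := crs_neq0 (lt0r_neq0 uw).
have [_ v0] := crs_neq0 (lt0r_neq0 uv).
have pi0 := pi_gt0 R.
have a0 := vang_gt0 uv; have b0 := vang_gt0 vw.
have ap := vang_ltpi uv; have bp := vang_ltpi vw.
have lu : elength u != 0 by rewrite elength_eq0.
have lv : elength v != 0 by rewrite elength_eq0.
have lw : elength w != 0 by rewrite elength_eq0.
have ec : cos (vang u v + vang v w) = vcos u w.
  rewrite cosD !cos_vang // !sin_vang // /vcos /vsin.
  have e : dot u v * dot v w - crs u v * crs v w = dot u w * elength v ^+ 2.
    rewrite elength_sqr /dot /crs; ring.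
  apply: (mulIf (expf_neq0 2 lv)); apply: (mulIf lu); apply: (mulIf lw).
  transitivity (dot u w * elength v ^+ 2); last by field; rewrite ?lu ?lv ?lw.
  by rewrite -e; field; rewrite ?lu ?lv ?lw.
have es : sin (vang u v + vang v w) = vsin u w.
  rewrite sinD !cos_vang // !sin_vang // /vcos /vsin.
  have e : crs u v * dot v w + dot u v * crs v w = crs u w * elength v ^+ 2.
    rewrite elength_sqr /dot /crs; ring.
  apply: (mulIf (expf_neq0 2 lv)); apply: (mulIf lu); apply: (mulIf lw).
  transitivity (crs u w * elength v ^+ 2); last by field; rewrite ?lu ?lv ?lw.
  by rewrite -e; field; rewrite ?lu ?lv ?lw.
rewrite {1}/vang; apply: acos_eq => //; apply/andP; split; first by lra.
by apply/ltW/sin_gt0_lt_pi; [apply/andP; split; lra|rewrite es vsin_gt0].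
Qed.

Lemma triangle_angle_sum A B C : 0 < orient A B C ->
  vang (B - A) (C - A) + vang (C - B) (A - B) + vang (A - C) (B - C) = pi.
Proof.
move=> O0.
have uv : 0 < crs (B - A) (C - A) by [].
have vw : 0 < crs (C - B) (A - B) by have := O0; rewrite orient_rot.
have uw : 0 < crs (A - C) (B - C) by have := O0; rewrite -orient_rot.
have [] := crs_neq0 (lt0r_neq0 uv); have [] := crs_neq0 (lt0r_neq0 vw).
rewrite -!elength_eq0 => la _ lc lb.
have pi0 := pi_gt0 R.
have a0 := vang_gt0 uv; have b0 := vang_gt0 vw.
have ap := vang_ltpi uv; have bp := vang_ltpi vw.
set x := vang (B - A) (C - A); set y := vang (C - B) (A - B).
have eBA : elength (A - B) = elength (B - A) by rewrite -elengthN opprB.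
have eBC : elength (B - C) = elength (C - B) by rewrite -elengthN opprB.
have eAC : elength (A - C) = elength (C - A) by rewrite -elengthN opprB.
have ec : cos (pi - (x + y)) = vcos (A - C) (B - C).
  rewrite cosB cospi sinpi mul0r addr0 mulN1r cosD !cos_vang // !sin_vang //.
  rewrite /vcos /vsin eBA eAC eBC.
  set p := elength _; set q := elength _; set r := elength _.
  have lp : p != 0 by [].
  have lq : q != 0 by [].
  have lr : r != 0 by [].
  have e : dot (B - A) (C - A) * dot (C - B) (A - B) - crs (B - A) (C - A) * crs (C - B) (A - B)
     = - dot (A - C) (B - C) * p ^+ 2.
    rewrite elength_sqr /dot /crs /=; ring.
  apply: (mulIf (expf_neq0 2 lp)); apply: (mulIf lq); apply: (mulIf lr).
  transitivity (- (- dot (A - C) (B - C) * p ^+ 2)); last by field; rewrite ?lp ?lq ?lr.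
  rewrite -e.
  by field; rewrite ?lp ?lq ?lr.
have es : sin (x + y) = vsin (A - C) (B - C).
  rewrite sinD !cos_vang // !sin_vang //.
  rewrite /vcos /vsin eBA eAC eBC.
  set p := elength _; set q := elength _; set r := elength _.
  have lp : p != 0 by [].
  have lq : q != 0 by [].
  have lr : r != 0 by [].
  have e : crs (B - A) (C - A) * dot (C - B) (A - B) + dot (B - A) (C - A) * crs (C - B) (A - B)
     = crs (A - C) (B - C) * p ^+ 2.
    rewrite elength_sqr /dot /crs /=; ring.
  apply: (mulIf (expf_neq0 2 lp)); apply: (mulIf lq); apply: (mulIf lr).
  transitivity (crs (A - C) (B - C) * p ^+ 2); last by field; rewrite ?lp ?lq ?lr.
  by rewrite -e; field; rewrite ?lp ?lq ?lr.
have xy : x + y < pi.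
  by apply: sin_gt0_lt_pi; [apply/andP; split; rewrite /x /y; lra|rewrite es vsin_gt0].
have -> : vang (A - C) (B - C) = pi - (x + y).
  by rewrite {1}/vang; apply: acos_eq => //; apply/andP; split; rewrite /x /y in xy *; lra.
by rewrite addrC subrK.
Qed.

(** The diagonals from [v0] split the angles at [v0], [v2] and [v3], leaving three triangles. *)
Lemma pentagon_angle_sum (v0 v1 v2 v3 v4 : plane R) :
  0 < orient v0 v1 v2 -> 0 < orient v0 v2 v3 -> 0 < orient v0 v3 v4 ->
  0 < orient v0 v1 v3 -> 0 < orient v0 v1 v4 -> 0 < orient v1 v2 v3 ->
  0 < orient v2 v3 v4 ->
  vang (v1 - v0) (v4 - v0) + vang (v2 - v1) (v0 - v1) + vang (v3 - v2) (v1 - v2) +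
  vang (v4 - v3) (v2 - v3) + vang (v0 - v4) (v3 - v4) = 3 * pi.
Proof.
move=> o012 o023 o034 o013 o014 o123 o234.
rewrite (@vang_add (v1 - v0) (v3 - v0) (v4 - v0)) //.
rewrite (@vang_add (v1 - v0) (v2 - v0) (v3 - v0)) //.
rewrite (@vang_add (v3 - v2) (v0 - v2) (v1 - v2)); first last.
- by have := o123; rewrite orient_rot.
- by have := o012; rewrite -orient_rot.
- by have := o023; rewrite orient_rot orient_rot -2!orient_rot orient_rot.
rewrite (@vang_add (v4 - v3) (v0 - v3) (v2 - v3)); first last.
- by have := o234; rewrite orient_rot.
- by have := o023; rewrite -orient_rot.
- by have := o034; rewrite orient_rot.
have t1 := triangle_angle_sum o012; have t2 := triangle_angle_sum o023.
have t3 := triangle_angle_sum o034.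
move: t1 t2 t3; lra.
Qed.

End VectorAngles.

(** * Lhuilier's inequality in terms of side directions *)

Section Isoperimetry.
Variable R : realType.
Implicit Types (d x o : plane R).

(** For a unit direction [d], [crs x d] is the signed distance from the origin to the line through
    [x] along [d]. The position of a vertex along a side is thus determined by the distances to the
    two sides meeting there. *)
Lemma support_foot x d' d : dot d' d' = 1 -> crs d' d != 0 ->
  dot x d' = (crs x d - dot d' d * crs x d') / crs d' d.
Proof.
move=> d1 S0; apply: (mulIf S0); rewrite mulfVK //.
have -> : crs x d = dot d' d' * crs x d by rewrite d1 mul1r.
rewrite /dot /crs; ring.
Qed.

Lemma support_foot' x d' d : dot d d = 1 -> crs d' d != 0 ->
  - dot x d = (crs x d' - dot d' d * crs x d) / crs d' d.
Proof.
move=> d1 S0; apply: (mulIf S0); rewrite mulfVK //.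
have -> : crs x d' = dot d d * crs x d' by rewrite d1 mul1r.
rewrite /dot /crs; ring.
Qed.

Lemma crs_solve (a b : plane R) (s t : R) : crs b a != 0 ->
  exists o, crs o a = s /\ crs o b = t.
Proof.
move=> D0; exists ((s * b.1 - t * a.1) / crs b a, (s * b.2 - t * a.2) / crs b a).
by split; apply: (mulIf D0); rewrite /crs /=; rewrite /crs in D0; field.
Qed.

(* Write h_k for the signed distance from a point o to side k and take the o
   with h_0 = h_2 = h_4 = r.  Up to a factor 2, p r - A - r^2 C is then the
   positive quadratic form
   (h_1 - r)^2 (cot t_1 + cot t_2) + (h_3 - r)^2 (cot t_3 + cot t_4)
   in the exterior angles t_k, and p r >= A + r^2 C gives p^2 >= 4 A C. *)
Lemma lhuilier_directions (v0 v1 v2 v3 v4 d0 d1 d2 d3 d4 : plane R)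
    (l0 l1 l2 l3 l4 : R) :
  0 < l0 -> 0 < l1 -> 0 < l2 -> 0 < l3 -> 0 < l4 ->
  dot d0 d0 = 1 -> dot d1 d1 = 1 -> dot d2 d2 = 1 -> dot d3 d3 = 1 ->
  dot d4 d4 = 1 ->
  v1 = ray v0 d0 l0 -> v2 = ray v1 d1 l1 -> v3 = ray v2 d2 l2 ->
  v4 = ray v3 d3 l3 -> v0 = ray v4 d4 l4 ->
  0 < crs d4 d0 -> 0 < crs d0 d1 -> 0 < crs d1 d2 -> 0 < crs d2 d3 ->
  0 < crs d3 d4 -> 0 < crs d0 d2 -> 0 < crs d2 d4 ->
  2 * (crs v0 v1 + crs v1 v2 + crs v2 v3 + crs v3 v4 + crs v4 v0) *
    ((1 - dot d4 d0) / crs d4 d0 + (1 - dot d0 d1) / crs d0 d1 +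
     (1 - dot d1 d2) / crs d1 d2 + (1 - dot d2 d3) / crs d2 d3 +
     (1 - dot d3 d4) / crs d3 d4) <= (l0 + l1 + l2 + l3 + l4) ^+ 2.
Proof.
move=> l00 l10 l20 l30 l40 n0 n1 n2 n3 n4 e1 e2 e3 e4 e0 S0 S1 S2 S3 S4 g1 g3.
have dle a b : dot a a = 1 -> dot b b = 1 -> 0 <= 1 - dot a b.
  move=> a1 b1; rewrite subr_ge0; apply: le_trans (dot_le_elength a b) _.
  by rewrite /elength a1 b1 sqrtr1 mulr1.
set A2 := crs v0 v1 + _ + _ + _ + _.
set Cc := (X in 2 * A2 * X).
have C0 : 0 <= Cc by rewrite !addr_ge0 // divr_ge0 ?dle // ltW.
pose a := (d0.1 - d2.1, d0.2 - d2.2) : plane R.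
pose b := (d0.1 - d4.1, d0.2 - d4.2) : plane R.
(* The directions [d0], [d2], [d4] turn around positively, so the lines of sides 0, 2 and 4 bound a
   triangle; [cen] is its incentre. *)
have D0 : crs b a != 0.
  have -> : crs b a = - (crs d4 d0 + crs d0 d2 + crs d2 d4).
    rewrite /crs /=; ring.
  by rewrite oppr_eq0; apply: lt0r_neq0; apply: addr_gt0 => //; exact: addr_gt0.
have [cen [oa ob]] := crs_solve (crs v0 d0 - crs v2 d2) (crs v0 d0 - crs v4 d4) D0.
pose x0 := v0 - cen; pose x1 := v1 - cen; pose x2 := v2 - cen.
pose x3 := v3 - cen; pose x4 := v4 - cen.
have crsBl u w z : crs (u - w) z = crs u z - crs w z by rewrite /crs /=; ring.
have crs_ray u w t z : crs (ray u w t) z = crs u z + t * crs w z.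
  rewrite /crs /ray /=; ring.
pose r := crs x0 d0.
have h2 : crs x2 d2 = r.
  rewrite /r !crsBl; apply/eqP; rewrite -subr_eq0.
  have -> : crs v2 d2 - crs cen d2 - (crs v0 d0 - crs cen d0) =
     crs cen a - (crs v0 d0 - crs v2 d2) by rewrite /crs /a /=; ring.
  by rewrite oa subrr.
have h4 : crs x4 d4 = r.
  rewrite /r !crsBl; apply/eqP; rewrite -subr_eq0.
  have -> : crs v4 d4 - crs cen d4 - (crs v0 d0 - crs cen d0) =
     crs cen b - (crs v0 d0 - crs v4 d4) by rewrite /crs /b /=; ring.
  by rewrite ob subrr.
(* The weights [crs d2 d4], [crs d4 d0], [crs d0 d2] annihilate [d0], [d2], [d4], so the weighted
   sum of the distances to the three sides is the same from every point. It is evaluated at [v0],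
   where only the distance to side 2 survives. *)
have r0 : 0 < r.
  have L0 : 0 < crs d2 d4 + crs d4 d0 + crs d0 d2.
    by apply: addr_gt0 => //; exact: addr_gt0.
  rewrite -(pmulr_rgt0 _ L0).
  have -> : (crs d2 d4 + crs d4 d0 + crs d0 d2) * r =
      crs d4 d0 * (l0 * crs d0 d2 + l1 * crs d1 d2).
    have e2' : crs x2 d2 = crs x0 d2 + l0 * crs d0 d2 + l1 * crs d1 d2.
      by rewrite /x2 /x0 !crsBl e2 e1 !crs_ray; ring.
    have e4' : crs x4 d4 = crs x0 d4.
      by rewrite /x4 /x0 !crsBl e0 crs_ray crsvv mulr0 addr0.
    have -> : (crs d2 d4 + crs d4 d0 + crs d0 d2) * r =
       crs d2 d4 * crs x0 d0 + crs d4 d0 * crs x2 d2 + crs d0 d2 * crs x4 d4.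
      by rewrite h2 h4 /r; ring.
    rewrite e2' e4' /crs; ring.
  by apply: mulr_gt0 => //; apply: addr_gt0; exact: mulr_gt0.
have next v w l d x y : w = ray v d l -> x = v - cen -> y = w - cen ->
    crs y d = crs x d /\ crs x y = crs x d * l.
  move=> -> -> ->; split; rewrite /crs /=; ring.
have len v w l d x y : w = ray v d l -> x = v - cen -> y = w - cen ->
    dot d d = 1 -> l = dot y d + - dot x d.
  move=> -> -> -> dd; rewrite -[LHS]mulr1 -dd /dot /=; ring.
have [h1' a0] := next v0 v1 l0 d0 x0 x1 e1 erefl erefl.
have [h2' a1] := next v1 v2 l1 d1 x1 x2 e2 erefl erefl.
have [h3' a2] := next v2 v3 l2 d2 x2 x3 e3 erefl erefl.
have [h4' a3] := next v3 v4 l3 d3 x3 x4 e4 erefl erefl.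
have [h0' a4] := next v4 v0 l4 d4 x4 x0 e0 erefl erefl.
have A2E : A2 = crs x0 d0 * l0 + crs x1 d1 * l1 + crs x2 d2 * l2 + crs x3 d3 * l3
    + crs x4 d4 * l4.
  by rewrite -a0 -a1 -a2 -a3 -a4 /A2 /x0 /x1 /x2 /x3 /x4 /crs /=; ring.
have k0 := len v0 v1 l0 d0 x0 x1 e1 erefl erefl n0.
have k1 := len v1 v2 l1 d1 x1 x2 e2 erefl erefl n1.
have k2 := len v2 v3 l2 d2 x2 x3 e3 erefl erefl n2.
have k3 := len v3 v4 l3 d3 x3 x4 e4 erefl erefl n3.
have k4 := len v4 v0 l4 d4 x4 x0 e0 erefl erefl n4.
rewrite (@support_foot x1 d0 d1) ?(@support_foot' x0 d4 d0) ?gt_eqF // h1' h0' in k0.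
rewrite (@support_foot x2 d1 d2) ?(@support_foot' x1 d0 d1) ?gt_eqF // h2' h1' in k1.
rewrite (@support_foot x3 d2 d3) ?(@support_foot' x2 d1 d2) ?gt_eqF // h3' h2' in k2.
rewrite (@support_foot x4 d3 d4) ?(@support_foot' x3 d2 d3) ?gt_eqF // h4' h3' in k3.
rewrite (@support_foot x0 d4 d0) ?(@support_foot' x4 d3 d4) ?gt_eqF // h0' h4' in k4.
rewrite h2 h4 -/r in k0 k1 k2 k3 k4 A2E.
set p := l0 + l1 + l2 + l3 + l4.
have p0 : 0 < p by rewrite !addr_gt0.
have add (c c' s s' : R) : s != 0 -> s' != 0 -> c / s + c' / s' = (c * s' + s * c') / (s * s').
  by move=> *; field; apply/andP.
have g1' : 0 <= dot d0 d1 / crs d0 d1 + dot d1 d2 / crs d1 d2.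
  rewrite add ?gt_eqF // divr_ge0 //; last by rewrite mulr_ge0 ?ltW.
  have -> : dot d0 d1 * crs d1 d2 + crs d0 d1 * dot d1 d2 = dot d1 d1 * crs d0 d2.
    rewrite /dot /crs; ring.
  by rewrite n1 mul1r ltW.
have g3' : 0 <= dot d2 d3 / crs d2 d3 + dot d3 d4 / crs d3 d4.
  rewrite add ?gt_eqF // divr_ge0 //; last by rewrite mulr_ge0 ?ltW.
  have -> : dot d2 d3 * crs d3 d4 + crs d2 d3 * dot d3 d4 = dot d3 d3 * crs d2 d4.
    rewrite /dot /crs; ring.
  by rewrite n3 mul1r ltW.
have key : A2 + 2 * r ^+ 2 * Cc <= 2 * p * r.
  rewrite -subr_ge0.
  have -> : 2 * p * r - (A2 + 2 * r ^+ 2 * Cc) =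
     (crs x1 d1 - r) ^+ 2 * (dot d0 d1 / crs d0 d1 + dot d1 d2 / crs d1 d2) +
     (crs x3 d3 - r) ^+ 2 * (dot d2 d3 / crs d2 d3 + dot d3 d4 / crs d3 d4).
    rewrite A2E /p k0 k1 k2 k3 k4 /Cc.
    set H1 := crs x1 d1; set H3 := crs x3 d3.
    move: (dot d4 d0) (dot d0 d1) (dot d1 d2) (dot d2 d3) (dot d3 d4) => c0 c1 c2 c3 c4.
    move: (crs d4 d0)^-1 (crs d0 d1)^-1 (crs d1 d2)^-1 (crs d2 d3)^-1 (crs d3 d4)^-1.
    by move=> j0 j1 j2 j3 j4; ring.
  by rewrite addr_ge0 // mulr_ge0 // sqr_ge0.
have [A0|A0] := leP A2 0.
  apply: (@le_trans _ _ 0); last by rewrite sqr_ge0.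
  by rewrite -oppr_ge0 -mulNr mulr_ge0 // -mulrN mulr_ge0 // oppr_ge0.
have h : (A2 + 2 * r ^+ 2 * Cc) ^+ 2 <= (2 * p * r) ^+ 2.
  rewrite ler_pXn2r ?nnegrE //; last by rewrite !mulr_ge0 // ltW.
  by rewrite addr_ge0 ?(ltW A0) // mulr_ge0 // mulr_ge0 // sqr_ge0.
have h' : 4 * r ^+ 2 * (2 * A2 * Cc) <= 4 * r ^+ 2 * p ^+ 2.
  have -> : 4 * r ^+ 2 * p ^+ 2 = (2 * p * r) ^+ 2 by ring.
  apply: le_trans h; rewrite -subr_ge0.
  have -> : (A2 + 2 * r ^+ 2 * Cc) ^+ 2 - 4 * r ^+ 2 * (2 * A2 * Cc) =
    (A2 - 2 * r ^+ 2 * Cc) ^+ 2 by ring.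
  exact: sqr_ge0.
by move: h'; rewrite ler_pM2l // mulr_gt0 // exprn_gt0.
Qed.

(** Strict convexity and counterclockwise order in a single condition. *)
Definition ccw (v : 'I_5 -> plane R) := forall k j : 'I_5, j != k -> j != k + 1 ->
  0 < orient (v k) (v (k + 1)) (v j).

Lemma ccw_shift (v : 'I_5 -> plane R) m : ccw v -> ccw (fun i => v (m + i)).
Proof.
move=> cv k j jk jk1; rewrite addrA; apply: cv.
  by rewrite (inj_eq (addrI m)).
by rewrite -addrA (inj_eq (addrI m)).
Qed.

Definition corner_angle (v : 'I_5 -> plane R) (k : 'I_5) : R :=
  vang (v (k + 1) - v k) (v (k - 1) - v k).

Definition plength (v : 'I_5 -> plane R) : R := \sum_k edist (v k) (v (k + 1)).

(* twice the signed area *)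
Definition shoelace (v : 'I_5 -> plane R) : R := \sum_k crs (v k) (v (k + 1)).

Lemma plength_shift v m : plength (fun i => v (m + i)) = plength v.
Proof.
rewrite /plength [RHS](reindex_inj (addrI m)) /=.
by apply: eq_bigr => i _; rewrite addrA.
Qed.

Lemma shoelace_shift v m : shoelace (fun i => v (m + i)) = shoelace v.
Proof.
rewrite /shoelace [RHS](reindex_inj (addrI m)) /=.
by apply: eq_bigr => i _; rewrite addrA.
Qed.

Lemma corner_shift v m k : corner_angle (fun i => v (m + i)) k = corner_angle v (m + k).
Proof. by rewrite /corner_angle -!addrA. Qed.

Definition i0 : 'I_5 := inord 0.
Definition i1 : 'I_5 := inord 1.
Definition i2 : 'I_5 := inord 2.
Definition i3 : 'I_5 := inord 3.
Definition i4 : 'I_5 := inord 4.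

Lemma sum5 (f : 'I_5 -> R) : \sum_k f k = f i0 + f i1 + f i2 + f i3 + f i4.
Proof.
rewrite !big_ord_recl big_ord0 addr0 !addrA.
by congr (f _ + f _ + f _ + f _ + f _); apply: val_inj; rewrite /= inordK.
Qed.

Lemma succ5 : [/\ i0 + 1 = i1, i1 + 1 = i2, i2 + 1 = i3, i3 + 1 = i4 & i4 + 1 = i0].
Proof. by split; apply: val_inj; rewrite /= !inordK. Qed.

Lemma pred5 : [/\ i0 - 1 = i4, i1 - 1 = i0, i2 - 1 = i1, i3 - 1 = i2 & i4 - 1 = i3].
Proof. by split; apply: val_inj; rewrite /= !inordK. Qed.

Lemma I5P (k : 'I_5) : k = i0 \/ k = i1 \/ k = i2 \/ k = i3 \/ k = i4.
Proof.
case: k => [[|[|[|[|[|//]]]]] h].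
- by left; apply: val_inj; rewrite /= inordK.
- by right; left; apply: val_inj; rewrite /= inordK.
- by right; right; left; apply: val_inj; rewrite /= inordK.
- by right; right; right; left; apply: val_inj; rewrite /= inordK.
- by right; right; right; right; apply: val_inj; rewrite /= inordK.
Qed.

Lemma neq5 : [/\ i0 != i1, i0 != i2, i0 != i3, i0 != i4 & i1 != i2] /\
  [/\ i1 != i3, i1 != i4, i2 != i3, i2 != i4 & i3 != i4].
Proof. by split; split; rewrite -val_eqE /= !inordK. Qed.

End Isoperimetry.

(** * Lhuilier's inequality for convex pentagons *)

Section ConvexPentagon.
Variable R : realType.
Implicit Types (v : 'I_5 -> plane R) (x : plane R).

Definition dir v k : plane R := direction (v k) (v (k + 1)).

Lemma neqS5 (k : 'I_5) : [/\ k != k + 1, k != k - 1, k + 1 != k, k - 1 != k & k - 1 != k + 1].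
Proof.
have [s0 s1 s2 s3 s4] := succ5; have [p0 p1 p2 p3 p4] := pred5.
have [[n01 n02 n03 n04 n12] [n13 n14 n23 n24 n34]] := neq5.
by have [->|[->|[->|[->|->]]]] := I5P k;
  rewrite ?s0 ?s1 ?s2 ?s3 ?s4 ?p0 ?p1 ?p2 ?p3 ?p4; split => //; rewrite eq_sym.
Qed.

Section Ccw.
Variable v : 'I_5 -> plane R.
Hypothesis cv : ccw v.

Let len k := edist (v k) (v (k + 1)).

Lemma ccw_corner k : 0 < crs (v (k + 1) - v k) (v (k - 1) - v k).
Proof. by have [_ _ _ h1 h2] := neqS5 k; exact: (cv h1 h2). Qed.

Lemma ccw_neq k : v (k + 1) - v k != 0.
Proof. by have [] := crs_neq0 (lt0r_neq0 (ccw_corner k)). Qed.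

Lemma ccw_len k : 0 < len k.
Proof. by rewrite elength_gt0 // ccw_neq. Qed.

Lemma dir_norm k : dot (dir v k) (dir v k) = 1.
Proof.
have l0 := lt0r_neq0 (ccw_len k).
have -> : dot (dir v k) (dir v k) = dot (v (k + 1) - v k) (v (k + 1) - v k) / len k ^+ 2.
  by rewrite /dot /dir /direction /=; rewrite -/(len k); field.
by rewrite -elength_sqr divff // expf_neq0.
Qed.

Lemma dir_ray k : v (k + 1) = ray (v k) (dir v k) (len k).
Proof.
have l0 := lt0r_neq0 (ccw_len k).
by apply: pairE; rewrite /ray /dir /direction /= -/(len k); field.
Qed.

Let prev_dir k : v (k - 1) - v k = (- (len (k - 1) * (dir v (k - 1)).1),
                                    - (len (k - 1) * (dir v (k - 1)).2)).
Proof.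
have e := dir_ray (k - 1); rewrite subrK in e.
by rewrite [in LHS]e; apply: pairE; rewrite /ray /=; ring.
Qed.

Let next_dir k : v (k + 1) - v k = (len k * (dir v k).1, len k * (dir v k).2).
Proof. by rewrite [in LHS]dir_ray; apply: pairE; rewrite /ray /=; ring. Qed.

Let elen k : elength (v (k + 1) - v k) = len k. Proof. by []. Qed.
Let elen' k : elength (v (k - 1) - v k) = len (k - 1).
Proof. by rewrite /len subrK /edist -elengthN opprB. Qed.

Lemma dir_dot k : dot (dir v (k - 1)) (dir v k) = - cos (corner_angle v k).
Proof.
have l0 := lt0r_neq0 (ccw_len k); have l1 := lt0r_neq0 (ccw_len (k - 1)).
rewrite cos_vang ?ccw_corner // /vcos elen elen' prev_dir next_dir /dot /=.
by field; rewrite l0 l1.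
Qed.

Lemma dir_crs k : crs (dir v (k - 1)) (dir v k) = sin (corner_angle v k).
Proof.
have l0 := lt0r_neq0 (ccw_len k); have l1 := lt0r_neq0 (ccw_len (k - 1)).
rewrite sin_vang ?ccw_corner // /vsin elen elen' prev_dir next_dir /crs /=.
by field; rewrite l0 l1.
Qed.

Lemma corner_itv k : 0 < corner_angle v k < pi.
Proof. by rewrite vang_gt0 ?vang_ltpi // ccw_corner. Qed.

Lemma dir_crs_gt0 k : 0 < crs (dir v (k - 1)) (dir v k).
Proof. by rewrite dir_crs sin_gt0_pi // corner_itv. Qed.

Lemma dir_hcot k : (1 - dot (dir v (k - 1)) (dir v k)) / crs (dir v (k - 1)) (dir v k)
  = hcot (corner_angle v k).
Proof. by rewrite dir_dot dir_crs opprK. Qed.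

(** The two successive turns add up to [2 pi] minus the two angles, which is less than [pi]. *)
Lemma dir_skip k : pi < corner_angle v k + corner_angle v (k + 1) ->
  0 < crs (dir v (k - 1)) (dir v (k + 1)).
Proof.
move=> big.
have [/andP[a0 ap] /andP[b0 bp]] := (corner_itv k, corner_itv (k + 1)).
have -> : crs (dir v (k - 1)) (dir v (k + 1)) =
    sin (corner_angle v k + corner_angle v (k + 1) - pi).
  have dk : dot (dir v (k + 1 - 1)) (dir v (k + 1)) = - cos (corner_angle v (k + 1)).
    exact: dir_dot.
  have ck : crs (dir v (k + 1 - 1)) (dir v (k + 1)) = sin (corner_angle v (k + 1)).
    exact: dir_crs.
  rewrite addrK in dk ck.
  rewrite sinB cospi sinpi mulr0 subr0 mulrN1 sinD -dir_crs -ck.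
  have -> : cos (corner_angle v k) = - dot (dir v (k - 1)) (dir v k).
    by rewrite dir_dot opprK.
  have -> : cos (corner_angle v (k + 1)) = - dot (dir v k) (dir v (k + 1)).
    by rewrite dk opprK.
  rewrite -[LHS]mul1r -(dir_norm k) /dot /crs; ring.
by apply: sin_gt0_pi; apply/andP; split; lra.
Qed.

(** Any three of five cyclic indices contain two consecutive ones, so [ccw] covers every triple. *)
Lemma ccw_triples :
  [/\ 0 < orient (v i0) (v i1) (v i2), 0 < orient (v i0) (v i2) (v i3),
      0 < orient (v i0) (v i3) (v i4), 0 < orient (v i0) (v i1) (v i3) &
      0 < orient (v i0) (v i1) (v i4)] /\
  [/\ 0 < orient (v i1) (v i2) (v i3), 0 < orient (v i2) (v i3) (v i4),
      0 < orient (v i0) (v i2) (v i4), 0 < orient (v i1) (v i2) (v i4) &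
      0 < orient (v i1) (v i3) (v i4)].
Proof.
have [s0 s1 s2 s3 s4] := succ5.
have [[n01 n02 n03 n04 n12] [n13 n14 n23 n24 n34]] := neq5.
have h k j : j != k -> j != k + 1 -> 0 < orient (v k) (v (k + 1)) (v j) by exact: cv.
split; split.
- by have := h i0 i2; rewrite s0 ![i2 == _]eq_sym; apply.
- by rewrite orient_rot; have := h i2 i0; rewrite s2; apply.
- by rewrite orient_rot; have := h i3 i0; rewrite s3; apply.
- by have := h i0 i3; rewrite s0 ![i3 == _]eq_sym; apply.
- by have := h i0 i4; rewrite s0 ![i4 == _]eq_sym; apply.
- by have := h i1 i3; rewrite s1 ![i3 == _]eq_sym; apply.
- by have := h i2 i4; rewrite s2 ![i4 == _]eq_sym; apply.
- by rewrite -orient_rot; have := h i4 i2; rewrite s4 ![i2 == i0]eq_sym; apply.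
- by have := h i1 i4; rewrite s1 ![i4 == _]eq_sym; apply.
- by rewrite orient_rot; have := h i3 i1; rewrite s3; apply.
Qed.

Lemma corner_angle_sum : \sum_k corner_angle v k = 3 * pi.
Proof.
have [s0 s1 s2 s3 s4] := succ5; have [p0 p1 p2 p3 p4] := pred5.
have [[h1 h2 h3 h4 h5] [h6 h7 _ _ _]] := ccw_triples.
rewrite sum5 /corner_angle s0 s1 s2 s3 s4 p0 p1 p2 p3 p4.
exact: pentagon_angle_sum.
Qed.

Lemma shoelace_fan : shoelace v = orient (v i0) (v i1) (v i2) +
  orient (v i0) (v i2) (v i3) + orient (v i0) (v i3) (v i4).
Proof.
have [s0 s1 s2 s3 s4] := succ5.
by rewrite /shoelace sum5 s0 s1 s2 s3 s4 /orient /crs /=; ring.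
Qed.

End Ccw.

Lemma lhuilier_skip v : ccw v ->
  pi < corner_angle v i1 + corner_angle v i2 ->
  pi < corner_angle v i3 + corner_angle v i4 ->
  2 * shoelace v * (\sum_k hcot (corner_angle v k)) <= plength v ^+ 2.
Proof.
move=> cv g1 g3.
have [s0 s1 s2 s3 s4] := succ5; have [p0 p1 p2 p3 p4] := pred5.
have := @lhuilier_directions R (v i0) (v i1) (v i2) (v i3) (v i4)
  (dir v i0) (dir v i1) (dir v i2) (dir v i3) (dir v i4)
  (edist (v i0) (v (i0 + 1))) (edist (v i1) (v (i1 + 1))) (edist (v i2) (v (i2 + 1)))
  (edist (v i3) (v (i3 + 1))) (edist (v i4) (v (i4 + 1))).
rewrite !ccw_len // !dir_norm //.
move=> /(_ isT isT isT isT isT erefl erefl erefl erefl erefl).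
have r k := dir_ray cv k.
have := (r i0, r i1, r i2, r i3, r i4).
rewrite {1}s0 {1}s1 {1}s2 {1}s3 {1}s4.
case=> [[[[r0 r1] r2] r3] r4] /(_ r0 r1 r2 r3 r4).
have c k := dir_crs_gt0 cv k.
have := (c i0, c i1, c i2, c i3, c i4); rewrite p0 p1 p2 p3 p4.
case=> [[[[c0 c1] c2] c3] c4] /(_ c0 c1 c2 c3 c4).
have e k := dir_hcot cv k.
have := (e i0, e i1, e i2, e i3, e i4); rewrite p0 p1 p2 p3 p4.
case=> [[[[e0 e1] e2] e3] e4].
rewrite e0 e1 e2 e3 e4.
have := @dir_skip v cv i1; rewrite p1 s1 => /(_ g1) k1.
have := @dir_skip v cv i3; rewrite p3 s3 => /(_ g3) k3.
move=> /(_ k1 k3).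
by rewrite /shoelace /plength !sum5 s0 s1 s2 s3 s4.
Qed.

(** Two disjoint pairs of neighbouring angles cannot both have sum at most [pi], for the fifth angle
    would be at least [pi]. So the bad pairs, seen as edges of the 5-cycle, meet pairwise and are at
    most two; the good ones contain a path of three edges, whose ends are the disjoint pairs that
    [lhuilier_skip] requires after a shift. *)
Theorem lhuilier v : ccw v ->
  2 * shoelace v * (\sum_k hcot (corner_angle v k)) <= plength v ^+ 2.
Proof.
move=> cv.
pose good k := pi < corner_angle v k + corner_angle v (k + 1).
have H m : good (m + i1) -> good (m + i3) ->
    2 * shoelace v * (\sum_k hcot (corner_angle v k)) <= plength v ^+ 2.
  have [s0 s1 s2 s3 s4] := succ5.
  rewrite /good -!addrA s1 s3 => g1 g3.
  have := lhuilier_skip (ccw_shift m cv); rewrite !corner_shift => /(_ g1 g3).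
  rewrite shoelace_shift plength_shift; congr (_ * _ <= _).
  rewrite [RHS](reindex_inj (addrI m)) /=.
  by apply: eq_bigr => k _; rewrite corner_shift.
have s := corner_angle_sum cv; rewrite sum5 in s.
have a k := corner_itv cv k.
move: (a i0) (a i1) (a i2) (a i3) (a i4).
move=> /andP[_ b0] /andP[_ b1] /andP[_ b2] /andP[_ b3] /andP[_ b4].
have [s0 s1 s2 s3 s4] := succ5.
have e (k l m : 'I_5) : val m = ((val k + val l) %% 5)%N -> k + l = m.
  by move=> h; apply: val_inj.
have H0 := H i0; have H1 := H i1; have H2 := H i2; have H3 := H i3; have H4 := H i4.
rewrite (e i0 i1 i1) ?(e i0 i3 i3) /= ?inordK // in H0.
rewrite (e i1 i1 i2) ?(e i1 i3 i4) /= ?inordK // in H1.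
rewrite (e i2 i1 i3) ?(e i2 i3 i0) /= ?inordK // in H2.
rewrite (e i3 i1 i4) ?(e i3 i3 i1) /= ?inordK // in H3.
rewrite (e i4 i1 i0) ?(e i4 i3 i2) /= ?inordK // in H4.
have gd k : good k \/ corner_angle v k + corner_angle v (k + 1) <= pi.
  by rewrite /good; case: ltP; [left|right].
have := (gd i0, gd i1, gd i2, gd i3, gd i4).
rewrite /good s0 s1 s2 s3 s4 in H0 H1 H2 H3 H4 *.
case=> [[[[G0 G1] G2] G3] G4].
case: G1 => [g1|g1].
  case: G3 => [g3|g3]; first exact: H0.
  case: G4 => [g4|g4]; first exact: H3.
  case: G2 => [g2|g2]; last by exfalso; move: g4 g2 b0 b1 b2 b3 b4 s; clear; lra.
  case: G0 => [g0|g0]; last by exfalso; move: g3 g0 b0 b1 b2 b3 b4 s; clear; lra.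
  exact: H4.
case: G3 => [g3|g3]; last by exfalso; move: g1 g3 b0 b1 b2 b3 b4 s; clear; lra.
case: G4 => [g4|g4]; last by exfalso; move: g1 g4 b0 b1 b2 b3 b4 s; clear; lra.
case: G0 => [g0|g0]; first exact: H2.
case: G2 => [g2|g2]; last by exfalso; move: g0 g2 b0 b1 b2 b3 b4 s; clear; lra.
exact: H1.
Qed.

(** Each side is made of two tangent lengths [r * cot (a / 2)], one for each of its ends, and the
    triangles over the sides with apex [x] all have height [r]. *)
Lemma circumscribed_measure v x (r : R) : ccw v ->
  (forall k, crs (v k - x) (dir v k) = r) ->
  plength v = 2 * r * (\sum_k hcot (corner_angle v k)) /\
  shoelace v = r * plength v.
Proof.
move=> cv hr.
(* The distance from [x] to side [k - 1], measured at the other end of that side. *)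
have hr' k : crs (v k - x) (dir v (k - 1)) = r.
  rewrite -(hr (k - 1)) {1}(_ : v k = ray (v (k - 1)) (dir v (k - 1)) (edist (v (k - 1)) (v k))).
    by rewrite /ray /crs /=; ring.
  by have := dir_ray cv (k - 1); rewrite subrK.
have c0 k : crs (dir v (k - 1)) (dir v k) != 0 by rewrite gt_eqF // dir_crs_gt0.
have f1 k : dot (v k - x) (dir v (k - 1)) = r * hcot (corner_angle v k).
  rewrite (support_foot _ (dir_norm cv (k - 1)) (c0 k)) hr hr' -dir_hcot //.
  by field.
have f2 k : - dot (v k - x) (dir v k) = r * hcot (corner_angle v k).
  rewrite (support_foot' _ (dir_norm cv k) (c0 k)) hr hr' -dir_hcot //.
  by field.
have len k : edist (v k) (v (k + 1)) =
    r * hcot (corner_angle v (k + 1)) + r * hcot (corner_angle v k).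
  rewrite -f1 -f2 addrK {2}dir_ray //.
  by rewrite -[LHS]mulr1 -(dir_norm cv k) /ray /dot /=; ring.
have shift : \sum_k hcot (corner_angle v (k + 1)) = \sum_k hcot (corner_angle v k).
  by rewrite [RHS](reindex_inj (addIr 1)).
split.
  rewrite /plength (eq_bigr _ (fun k _ => len k)) big_split /= -!mulr_sumr shift.
  by ring.
have e k : crs (v k) (v (k + 1)) = r * edist (v k) (v (k + 1)) +
    (crs x (v (k + 1)) - crs x (v k)).
  rewrite -(hr k) {1 3}(dir_ray cv k) /ray /crs /=; ring.
rewrite /shoelace (eq_bigr _ (fun k _ => e k)) big_split /= -mulr_sumr -/(plength v).
rewrite sumrB [X in _ + (_ - X)](reindex_inj (addIr 1)) /= subrr addr0.
by [].
Qed.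

End ConvexPentagon.

(** Confines a component of the complement of an outline: a boolean invariant that is locally
    constant there keeps its value on the whole component. *)
Lemma connected_locally_constant (T : topologicalType) (A C : set T) (f : T -> bool) :
  (forall x, A x -> \forall y \near x, A y /\ f y = f x) ->
  C `<=` A -> connected C -> forall x y, C x -> C y -> f x = f y.
Proof.
move=> loc CA cC x y Cx Cy.
pose U b := [set z | A z /\ f z = b].
have oU b : open (U b).
  rewrite openE => z [Az fz] /=; rewrite /interior.
  by apply: filterS (loc z Az) => w [Aw fw]; split => //; rewrite fw.
have CU : C `&` U (f x) = C.
  apply: cC; first by exists x; split => //; split => //; exact: CA.
    by exists (U (f x)).
  exists (~` U (~~ f x)); first exact: open_closedC.
  apply/seteqP; split => z [Cz h]; split => //.
    by move=> [_ e]; move: h => [_]; rewrite e; case: (f x).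
  split; first exact: CA.
  have [//|ne] := eqVneq (f z) (f x).
  exfalso; apply: h; split; first exact: CA.
  by move: ne; case: (f z); case: (f x).
by have : C y by []; rewrite -CU => -[_ []].
Qed.

(** * Continuity along affine functions and rays *)

Section PlaneTopology.
Variable R : realType.
Implicit Types (u n x y z A B : plane R).

Lemma continuous_affine (a b c : R) :
  continuous (fun z : plane R => a + b * z.1 + c * z.2).
Proof.
move=> x; apply: cvgD; first apply: cvgD; first exact: cvg_cst.
  by apply: cvgMr; exact: cvg_fst.
by apply: cvgMr; exact: cvg_snd.
Qed.

Lemma continuous_orient A B : continuous (orient A B).
Proof.
have -> : orient A B = (fun z : plane R =>
    (- (B - A).1 * A.2 + (B - A).2 * A.1) + (- (B - A).2) * z.1 + (B - A).1 * z.2).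
  by apply/funext => z; rewrite /orient /crs /=; ring.
exact: continuous_affine.
Qed.

Lemma continuous_crsl n : continuous (fun z : plane R => crs z n).
Proof.
have -> : (fun z => crs z n) = (fun z : plane R => 0 + n.2 * z.1 + (- n.1) * z.2).
  by apply/funext => z; rewrite /crs /=; ring.
exact: continuous_affine.
Qed.

Lemma continuous_dotr n : continuous (dot n).
Proof.
have -> : dot n = (fun z : plane R => 0 + n.1 * z.1 + n.2 * z.2).
  by apply/funext => z; rewrite /dot /=; ring.
exact: continuous_affine.
Qed.

Lemma near_gt (f : plane R -> R) x c : continuous f -> c < f x ->
  \forall y \near x, c < f y.
Proof. move=> fc h; exact: (cvgr_gt (f x) (fc x) c h). Qed.

Lemma near_lt (f : plane R -> R) x c : continuous f -> f x < c ->
  \forall y \near x, f y < c.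
Proof. move=> fc h; exact: (cvgr_lt (f x) (fc x) c h). Qed.

Lemma near_sign (f : plane R -> R) x : continuous f -> f x != 0 ->
  \forall y \near x, (f y < 0) = (f x < 0).
Proof.
move=> fc; case: (ltgtP (f x) 0) => // h _; near=> y.
  by near: y; exact: near_lt.
by apply/negbTE; rewrite -leNgt ltW //; near: y; exact: near_gt.
Unshelve. all: by end_near. Qed.

Lemma continuous_ray x n : continuous (ray x n).
Proof.
move=> t; apply: (@cvg_pair _ _ _ (nbhs t) (nbhs (x.1 + t * n.1)) (nbhs (x.2 + t * n.2))).
  by apply: cvgD; [exact: cvg_cst|apply: cvgMl; exact: cvg_id].
by apply: cvgD; [exact: cvg_cst|apply: cvgMl; exact: cvg_id].
Qed.

Lemma ray0 x n : ray x n 0 = x.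
Proof. by apply: pairE; rewrite /ray /= mul0r addr0. Qed.

Lemma near_ray x n (P : plane R -> Prop) : (\forall y \near x, P y) ->
  \forall t \near (0 : R), P (ray x n t).
Proof.
move=> Px; have := @near_fun _ _ (ray x n) 0 P (@continuous_ray x n 0).
by rewrite ray0; apply.
Qed.

Lemma near_right (P : R -> Prop) : (\forall t \near (0 : R), P t) ->
  \forall t \near (0 : R)^'+, P t.
Proof. by move=> h; apply: filter_app h; near=> t.
Unshelve. all: by end_near. Qed.

Lemma near_rightN (P : R -> Prop) : (\forall t \near (0 : R), P t) ->
  \forall t \near (0 : R)^'+, P (- t).
Proof.
move=> h; apply: near_right.
by apply: (@near_fun _ _ (fun t : R => - t)); [apply: cvgN; exact: cvg_id|rewrite oppr0].
Qed.

Lemma connected_ray x n (I : set R) : is_interval I -> connected (ray x n @` I).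
Proof.
move=> /connected_intervalP cI; apply: connected_continuous_connected => //.
by apply: continuous_subspaceT => t; exact: continuous_ray.
Qed.

End PlaneTopology.

(** * Outlines are closed; points cut off by a line are outside *)

Section Outline.
Variable R : realType.
Implicit Types (u n x y z A B : plane R) (p : pentagon R).

Lemma segment_orient A B z : segment A B z -> orient A B z = 0.
Proof. by move=> [t _ ->]; rewrite /orient /crs /=; ring. Qed.

Lemma segment_endl A B : segment A B A.
Proof. by exists 0; [rewrite lexx ler01|apply: pairE => /=; ring]. Qed.

Lemma segment_endr A B : segment A B B.
Proof. by exists 1; [rewrite lexx ler01|apply: pairE => /=; ring]. Qed.

Lemma segment_dot A B n (c : R) z : segment A B z -> c < dot n A -> c < dot n B ->
  c < dot n z.
Proof.
move=> [t /andP[t0 t1] ->] a b.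
have -> : dot n (A.1 + t * (B - A).1, A.2 + t * (B - A).2) =
   (1 - t) * dot n A + t * dot n B by rewrite /dot /=; ring.
have [->|t0'] := eqVneq t 0; first by rewrite subr0 mul1r mul0r addr0.
have h1 : 0 < t * (dot n B - c) by rewrite mulr_gt0 ?subr_gt0 // lt_def t0'.
have h2 : 0 <= (1 - t) * (dot n A - c) by rewrite mulr_ge0 ?subr_ge0 // ltW.
by move: h1 h2; lra.
Qed.

Lemma segment_dot_le A B n (c : R) z : segment A B z -> c <= dot n A -> c <= dot n B ->
  c <= dot n z.
Proof.
move=> [t /andP[t0 t1] ->] a b.
have -> : dot n (A.1 + t * (B - A).1, A.2 + t * (B - A).2) =
   (1 - t) * dot n A + t * dot n B by rewrite /dot /=; ring.
by move: (dot n A) (dot n B) a b => p q a b; nra.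
Qed.

Lemma closed_segment A B : closed (segment A B).
Proof.
have -> : segment A B = ray A (B - A) @` `[0, 1]%classic.
  apply/seteqP; split => z.
    by move=> [t t01 ->]; exists t; rewrite //= in_itv.
  by move=> [t]; rewrite /= in_itv /= => t01 <-; exists t.
apply: compact_closed; first exact: norm_hausdorff.
apply: continuous_compact; last exact: segment_compact.
by apply: continuous_subspaceT => t; exact: continuous_ray.
Qed.

Lemma closed_outline p : closed (outline p).
Proof.
by apply: closed_bigcup => [|k _]; [exact: finite_finset|exact: closed_segment].
Qed.

Lemma near_not_side p k x : ~ side p k x -> \forall y \near x, ~ side p k y.
Proof.
move=> h; have : open (~` side p k) by apply: closed_openC; exact: closed_segment.
by rewrite openE => /(_ x h).
Qed.

Lemma near_not_outline p x : ~ outline p x -> \forall y \near x, ~ outline p y.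
Proof.
move=> h; have : open (~` outline p) by apply: closed_openC; exact: closed_outline.
by rewrite openE => /(_ x h).
Qed.

Lemma outline_dot p n (c : R) z : outline p z -> (forall k, c < dot n (p k)) -> c < dot n z.
Proof. by move=> [k _ kz] H; apply: segment_dot kz (H _) (H _). Qed.

(** The ray from [x] away from the vertices stays in the open half-plane beyond the separating line
    or on it, so it misses the outline and makes the component of [x] unbounded. *)
Lemma region_separated p x n : (forall k, 0 < dot n (p k - x)) -> ~ region p x.
Proof.
move=> H; have dB u w : dot n (u - w) = dot n u - dot n w by rewrite /dot /=; ring.
have H' k : dot n x < dot n (p k) by rewrite -subr_gt0 -dB.
have n0 : n != 0.
  apply/eqP => e; have := H 0; rewrite e /dot /= !mul0r addr0; by rewrite ltxx.
case=> [/outline_dot/(_ H')|[_]]; first by rewrite ltxx.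
set K := connected_component _ _.
pose I : set R := [set t | t <= 0].
have KI : ray x n @` I `<=` K.
  apply: connected_component_max.
  - by exists 0; rewrite ?ray0 /I /=.
  - move=> _ [t t0 <-] /outline_dot/(_ H').
    have -> : dot n (ray x n t) = dot n x + t * dot n n by rewrite /dot /ray /=; ring.
    by apply/negP; rewrite -leNgt gerDl mulr_le0_ge0 // dot_ge0.
  - by apply: connected_ray => s t _ /= t0 r /andP[_ rt]; exact: le_trans rt t0.
move=> [M [Mr]] /(_ (Num.max M 0 + 1)).
have -> : M < Num.max M 0 + 1 by rewrite ltr_pwDr // le_max lexx.
move=> /(_ isT) bd.
have M0 : 0 < Num.max M 0 + 1 by rewrite ltr_wpDl // le_max lexx orbT.
set M' := Num.max M 0 + 1 in bd M0.
have bd' t : t <= 0 -> `|x.1 + t * n.1| <= M' /\ `|x.2 + t * n.2| <= M'.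
  move=> t0; have /bd : K (ray x n t) by apply: KI; exists t.
  by rewrite /= prod_normE ge_max => /andP[].
have [x1 x2] : `|x.1| <= M' /\ `|x.2| <= M'.
  by have := bd' 0 (lexx _); rewrite !mul0r !addr0.
have big (a b : R) : a != 0 -> `|b| <= M' -> (forall t, t <= 0 -> `|b + t * a| <= M') -> False.
  move=> a0 bM h; have a0' : 0 < `|a| by rewrite normr_gt0.
  (* At parameter [- s] the coordinate has absolute value at least [3 * M' - M'], beyond the
     supposed bound. *)
  pose s := (3 * M') / `|a|.
  have s0 : 0 <= s by rewrite divr_ge0 ?mulr_ge0 ?ltW.
  have := h (- s); rewrite oppr_le0 => /(_ s0).
  have e : `|s * a| = 3 * M'.
    by rewrite normrM ger0_norm // /s mulfVK // gt_eqF.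
  have := ler_normD (- (b - s * a)) b; rewrite opprB subrK e mulNr distrC.
  by move: bM M0; lra.
have [n1|n1] := eqVneq n.1 0; last by apply: (big _ x.1 n1) => // t /bd'[].
have [n2|n2] := eqVneq n.2 0; last by apply: (big _ x.2 n2) => // t /bd'[].
by move/eqP: n0; apply; apply: pairE.
Qed.

End Outline.

(** * Parity of the number of sides met by a ray *)

Section Parity.
Variable R : realType.
Variables (p : pentagon R) (n : plane R).
Implicit Types (x y z : plane R) (k : 'I_5).

(* Vertex k does not lie to the left of the ray from y in direction n. *)
Definition vleft k y := crs (p k) n <= crs y n.

(** For a side whose ends are separated by the line through [y] along [n], this tells whether the
    line is met at a positive parameter, as [crossing] shows. *)
Definition ahead k y := orient (p k) (p (k + 1)) y * (crs (p (k + 1)) n - crs (p k) n) < 0.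

Definition crosses k y := (vleft k y (+) vleft (k + 1) y) && ahead k y.

(* Parity of the number of sides met by the ray from y in direction n; the weak
   inequality in [vleft] resolves the ambiguity at vertices. *)
Definition parity y := \big[addb/false]_(k < 5) crosses k y.

(** Matters for vertices on the line through [x] along [n]: it tells those on the ray from those
    behind [x]. *)
Definition vup k x := 0 < dot (p k - x) n.

Lemma dot_crs_decomp (u w : plane R) :
  crs u n = 0 -> dot n n * crs w u = dot u n * crs w n.
Proof.
move=> un; have -> : dot n n * crs w u = dot u n * crs w n - dot w n * crs u n.
  rewrite /dot /crs; ring.
by rewrite un mulr0 subr0.
Qed.

Lemma orient_on_line A B z : crs (B - A) n != 0 -> orient A B z = 0 ->
  exists t, z = ray A (B - A) t /\ crs z n = crs A n + t * crs (B - A) n.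
Proof.
move=> d0 oz; exists (crs (z - A) n / crs (B - A) n); split; last first.
  by rewrite mulfVK // /crs /=; ring.
have e1 : (z - A).1 * crs (B - A) n = crs (z - A) n * (B - A).1.
  apply/eqP; rewrite -subr_eq0; apply/eqP.
  have -> : (z - A).1 * crs (B - A) n - crs (z - A) n * (B - A).1 =
    n.1 * orient A B z by rewrite /orient /crs; ring.
  by rewrite oz mulr0.
have e2 : (z - A).2 * crs (B - A) n = crs (z - A) n * (B - A).2.
  apply/eqP; rewrite -subr_eq0; apply/eqP.
  have -> : (z - A).2 * crs (B - A) n - crs (z - A) n * (B - A).2 =
    n.2 * orient A B z by rewrite /orient /crs; ring.
  by rewrite oz mulr0.
apply: pairE; rewrite /ray /=.
  by rewrite mulrAC -e1 mulfK //= addrC subrK.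
by rewrite mulrAC -e2 mulfK //= addrC subrK.
Qed.

Let crsB u w : crs (u - w) n = crs u n - crs w n.
Proof. by rewrite /crs /=; ring. Qed.

Lemma between_segment A B z : orient A B z = 0 ->
  crs A n < crs z n < crs B n \/ crs B n < crs z n < crs A n -> segment A B z.
Proof.
move=> oz bt.
have d0 : crs (B - A) n != 0.
  by rewrite crsB subr_eq0 neq_lt; case: bt => /andP[h1 h2];
    rewrite (lt_trans h1 h2) ?orbT.
have [t [ez et]] := orient_on_line d0 oz.
exists t => //; move: bt; rewrite et crsB; rewrite crsB in d0.
move: d0; rewrite subr_eq0; move: (crs A n) (crs B n) => a b ab.
move=> [/andP[h1 h2]|/andP[h1 h2]]; apply/andP; split; rewrite leNgt; apply/negP => h;
  move: h1 h2 h; nra.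
Qed.

Lemma vertical_segment A B z : n != 0 -> crs A n = crs z n -> crs B n = crs z n ->
  0 < dot (A - z) n -> dot (B - z) n <= 0 -> segment A B z.
Proof.
move=> n0 eA eB a b.
have d0 : dot (A - z) n - dot (B - z) n != 0 by rewrite gt_eqF // subr_gt0; lra.
have N0 : dot n n != 0 by rewrite dot_eq0.
pose t := dot (A - z) n / (dot (A - z) n - dot (B - z) n).
have tE : t * (dot (A - z) n - dot (B - z) n) = dot (A - z) n by rewrite mulfVK.
exists t.
  have h : 0 < dot (A - z) n - dot (B - z) n by lra.
  rewrite divr_ge0 ?(ltW a) ?(ltW h) //= ler_pdivrMr // mul1r; lra.
have cA : crs (A - z) n = 0 by rewrite crsB eA subrr.
have cB : crs (B - z) n = 0 by rewrite crsB eB subrr.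
have c1 (u : plane R) : crs u n = 0 -> dot n n * u.1 = dot u n * n.1 /\ dot n n * u.2 = dot u n * n.2.
  move=> e; split.
    have -> : dot n n * u.1 = dot u n * n.1 + n.2 * crs u n by rewrite /dot /crs; ring.
    by rewrite e mulr0 addr0.
  have -> : dot n n * u.2 = dot u n * n.2 - n.1 * crs u n by rewrite /dot /crs; ring.
  by rewrite e mulr0 subr0.
have [A1 A2] := c1 _ cA; have [B1 B2] := c1 _ cB.
have h (a1 b1 n1 : R) : dot n n * a1 = dot (A - z) n * n1 ->
    dot n n * b1 = dot (B - z) n * n1 -> a1 + t * (b1 - a1) = 0.
  move=> ea eb; apply: (mulfI N0); rewrite mulr0 mulrDr mulrCA mulrBr ea eb.
  have -> : dot (A - z) n * n1 + t * (dot (B - z) n * n1 - dot (A - z) n * n1) =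
    n1 * (dot (A - z) n - t * (dot (A - z) n - dot (B - z) n)) by ring.
  by rewrite tE subrr mulr0.
have f1 := h _ _ _ A1 B1; have f2 := h _ _ _ A2 B2.
by apply: pairE => /=; move: f1 f2 => /=; lra.
Qed.

Let near_left k x : crs (p k) n != crs x n -> \forall y \near x, vleft k y = vleft k x.
Proof.
move=> ne; rewrite /vleft; move: ne; case: ltgtP => // h _.
  by apply: filterS (near_gt (@continuous_crsl R n) h) => y /ltW ->.
by apply: filterS (near_lt (@continuous_crsl R n) h) => y; rewrite ltNge => /negbTE.
Qed.

Let near_ahead k x : orient (p k) (p (k + 1)) x != 0 ->
  \forall y \near x, ahead k y = ahead k x.
Proof.
move=> h; rewrite /ahead; set d := _ - _.
have [->|d0] := eqVneq d 0; first by apply: filterE => y; rewrite !mulr0.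
apply: near_sign; last by rewrite mulf_neq0.
by move=> z; apply: cvgMl; exact: continuous_orient.
Qed.

(** While [y] moves near [x], the crossing of side [k] changes only when the line through [y] sweeps
    over an end of the side that lies in front. The formula charges every change to a vertex; since
    each vertex is charged by both of its sides, the changes cancel in [parity]. *)
Let crosses_near k x : n != 0 -> ~ side p k x -> exists e, \forall y \near x,
  crosses k y = e (+) (vleft k y && vup k x) (+) (vleft (k + 1) y && vup (k + 1) x).
Proof.
move=> n0 nx; set A := p k in nx *; set B := p (k + 1) in nx *.
have N0 : 0 < dot n n by rewrite dot_gt0.
have endl : A <> x by move=> e; apply: nx; rewrite -e; exact: segment_endl.
have endr : B <> x by move=> e; apply: nx; rewrite -e; exact: segment_endr.
have up0 (z : plane R) : crs z n = crs x n -> z <> x -> dot (z - x) n != 0.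
  move=> e zx; apply/negP => /eqP d; apply: zx; apply/eqP; rewrite -subr_eq0 -dot_eq0.
  have := lagrange (z - x) n; rewrite d crsB e subrr expr0n /= addr0 => /esym/eqP.
  by rewrite mulf_eq0 [dot n n == 0]gt_eqF // orbF.
(* If the line through [x] passes through an end [z] of the side, it meets the side's line at [z]
   itself, so [ahead] asks whether [z] is in front of [x]. *)
have ahead_vertex (z : plane R) : (z = A \/ z = B) -> crs z n = crs x n ->
    crs A n != crs B n ->
    (orient A B x * (crs B n - crs A n) != 0) /\
    (orient A B x * (crs B n - crs A n) < 0) = (0 < dot (z - x) n).
  move=> zAB ez AB; have AB' : crs B n - crs A n != 0 by rewrite subr_eq0 eq_sym.
  have zx : z <> x by case: zAB => ->.
  have d0 := up0 z ez zx.
  have e : dot n n * (orient A B x * (crs B n - crs A n)) =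
      - dot (z - x) n * (crs B n - crs A n) ^+ 2.
    have -> : orient A B x = - crs (B - A) (z - x).
      by case: zAB => ->; rewrite /orient /crs /=; ring.
    have dc : dot n n * crs (B - A) (z - x) = dot (z - x) n * (crs B n - crs A n).
      by rewrite dot_crs_decomp ?crsB // ez subrr.
    transitivity (- (dot n n * crs (B - A) (z - x)) * (crs B n - crs A n)); first by ring.
    by rewrite dc; ring.
  split.
    apply: contraNneq d0 => h; move/eqP: e; rewrite h mulr0 eq_sym mulf_eq0 oppr_eq0.
    by rewrite sqrf_eq0 (negbTE AB') orbF.
  rewrite -(pmulr_rlt0 _ N0) e mulNr oppr_lt0 pmulr_lgt0 //.
  by rewrite lt_def sqrf_eq0 AB' sqr_ge0.
have [eA|nA] := eqVneq (crs A n) (crs x n); have [eB|nB] := eqVneq (crs B n) (crs x n).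
(* The side is parallel to [n] and misses [x]: its ends are both in front or both behind, and
   [vleft] agrees on them. *)
- exists false; apply: filterE => y.
  have l : vleft k y = vleft (k + 1) y by rewrite /vleft -/A -/B eA eB.
  have u : vup k x = vup (k + 1) x.
    rewrite /vup -/A -/B.
    case: (ltP 0 (dot (A - x) n)) => a; case: (ltP 0 (dot (B - x) n)) => b //; exfalso.
      by apply: nx; exact: (vertical_segment n0).
    have := vertical_segment n0 eB eA b a => -[t /andP[t0 t1] e]; apply: nx.
    exists (1 - t); first by apply/andP; split; lra.
    by rewrite {1}e; apply: pairE => /=; ring.
  by rewrite /crosses l addbb u addFb addbb.
- have AB : crs A n != crs B n by rewrite eA eq_sym.
  have [h0 h1] := ahead_vertex A (or_introl erefl) eA AB.
  exists (vleft (k + 1) x && (vup k x (+) vup (k + 1) x)).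
  have o0 : orient A B x != 0 by move: h0; rewrite mulf_eq0 negb_or => /andP[].
  near=> y; have -> : crosses k y = (vleft k y (+) vleft (k + 1) x) && vup k x.
    have a : ahead k y = ahead k x by near: y; exact: near_ahead.
    have l : vleft (k + 1) y = vleft (k + 1) x by near: y; exact: near_left.
    by rewrite /crosses a l /ahead -/A -/B h1.
  have -> : vleft (k + 1) y = vleft (k + 1) x by near: y; exact: near_left.
  by move: (vleft k y) (vleft (k + 1) x) (vup k x) (vup (k + 1) x) => [] [] [] [].
- have AB : crs A n != crs B n by rewrite eB.
  have [h0 h1] := ahead_vertex B (or_intror erefl) eB AB.
  exists (vleft k x && (vup k x (+) vup (k + 1) x)).
  have o0 : orient A B x != 0 by move: h0; rewrite mulf_eq0 negb_or => /andP[].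
  near=> y; have -> : crosses k y = (vleft k x (+) vleft (k + 1) y) && vup (k + 1) x.
    have a : ahead k y = ahead k x by near: y; exact: near_ahead.
    have l : vleft k y = vleft k x by near: y; exact: near_left.
    by rewrite /crosses a l /ahead -/A -/B h1.
  have -> : vleft k y = vleft k x by near: y; exact: near_left.
  by move: (vleft k x) (vleft (k + 1) y) (vup k x) (vup (k + 1) x) => [] [] [] [].
- exists (crosses k x (+) (vleft k x && vup k x) (+) (vleft (k + 1) x && vup (k + 1) x)).
  near=> y.
  have -> : vleft k y = vleft k x by near: y; exact: near_left.
  have -> : vleft (k + 1) y = vleft (k + 1) x by near: y; exact: near_left.
  have -> : crosses k y = crosses k x.
    near: y; case lr : (vleft k x (+) vleft (k + 1) x); last first.
      near=> y.
      have l1 : vleft k y = vleft k x by near: y; exact: near_left.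
      have l2 : vleft (k + 1) y = vleft (k + 1) x by near: y; exact: near_left.
      by rewrite /crosses l1 l2 lr.
    have o0 : orient A B x != 0.
      apply/negP => /eqP o; apply: nx; apply: between_segment o _.
      move: lr nA nB; rewrite /vleft -/A -/B.
      by case: (ltgtP (crs A n)) => //; case: (ltgtP (crs B n)) => // *;
        [left|right]; apply/andP.
    near=> y.
    have l1 : vleft k y = vleft k x by near: y; exact: near_left.
    have l2 : vleft (k + 1) y = vleft (k + 1) x by near: y; exact: near_left.
    have a : ahead k y = ahead k x by near: y; exact: near_ahead.
    by rewrite /crosses l1 l2 a.
  by move: (crosses k x) (vleft k x && _) (vleft (k + 1) x && _) => [] [] [].
Unshelve. all: by end_near. Qed.

Let sum_shift (f : 'I_5 -> bool) :
  \big[addb/false]_(k < 5) f (k + 1) = \big[addb/false]_(k < 5) f k.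
Proof. by rewrite [RHS](reindex_inj (addIr 1)). Qed.

Lemma parity_near x : n != 0 -> ~ outline p x -> \forall y \near x, parity y = parity x.
Proof.
move=> n0 nx.
have nk k : ~ side p k x by move=> h; apply: nx; exists k.
have /choice[e He] : forall k, exists e, \forall y \near x,
    crosses k y = e (+) (vleft k y && vup k x) (+) (vleft (k + 1) y && vup (k + 1) x).
  by move=> k; exact: crosses_near.
have H : \forall y \near x, parity y = \big[addb/false]_(k < 5) e k.
  near=> y.
  have hy : forall k, crosses k y =
      e k (+) (vleft k y && vup k x) (+) (vleft (k + 1) y && vup (k + 1) x).
    by near: y; apply: filter_forall.
  rewrite /parity (eq_bigr _ (fun k _ => hy k)) !big_split /=.
  rewrite (sum_shift (fun k => vleft k y && vup k x)).
  by rewrite -addbA addbb addbF.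
near=> y.
have -> : parity y = \big[addb/false]_(k < 5) e k by near: y.
by rewrite (nbhs_singleton H).
Unshelve. all: by end_near. Qed.

(** Near a relative interior point of side [k] the other sides contribute a constant as in
    [crosses_near], while side [k] is counted exactly when it is ahead. Hence parity flips across
    the side. *)
Lemma parity_near_side k x : n != 0 -> (forall l, l != k -> ~ side p l x) ->
  crs (p k) n < crs x n < crs (p (k + 1)) n \/
  crs (p (k + 1)) n < crs x n < crs (p k) n ->
  exists e, \forall y \near x,
    parity y = e (+) (orient (p k) (p (k + 1)) y * (crs (p (k + 1)) n - crs (p k) n) < 0).
Proof.
move=> n0 nx bt.
have /choice[e He] : forall l, exists e, l != k -> \forall y \near x,
    crosses l y = e (+) (vleft l y && vup l x) (+) (vleft (l + 1) y && vup (l + 1) x).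
  move=> l; have [->|lk] := eqVneq l k; first by exists false.
  have [e He] := @crosses_near l x n0 (nx l lk).
  by exists e.
have nA : crs (p k) n != crs x n.
  by rewrite neq_lt; case: bt => /andP[h h']; rewrite ?h ?h' ?orbT.
have nB : crs (p (k + 1)) n != crs x n.
  by rewrite neq_lt; case: bt => /andP[h h']; rewrite ?h ?h' ?orbT.
pose g y l := (vleft l y && vup l x) (+) (vleft (l + 1) y && vup (l + 1) x).
have g0 y : \big[addb/false]_(l < 5) g y l = false.
  by rewrite big_split /= (sum_shift (fun l => vleft l y && vup l x)) addbb.
exists ((\big[addb/false]_(l < 5 | l != k) e l) (+) g x k).
near=> y.
have hy : forall l, l != k -> crosses l y = e l (+) g y l.
  near: y; apply: filter_forall => l; have [->|lk] := eqVneq l k.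
    by apply: filterE.
  by apply: filterS (He l lk) => y h _; rewrite h /g addbA.
have l1 : vleft k y = vleft k x by near: y; exact: near_left.
have l2 : vleft (k + 1) y = vleft (k + 1) x by near: y; exact: near_left.
have gk : g y k = g x k by rewrite /g l1 l2.
have ck : crosses k y = ahead k y.
  rewrite /crosses l1 l2; suff -> : vleft k x (+) vleft (k + 1) x by [].
  rewrite /vleft; case: bt => /andP[h1 h2].
    by rewrite (ltW h1) [_ <= _]leNgt h2.
  by rewrite (ltW h1) [_ <= _]leNgt h2.
rewrite /parity (bigD1 k) //= ck (eq_bigr _ hy) big_split /=.
have := g0 y; rewrite (bigD1 k) //= gk.
rewrite -/(ahead k y).
move: (\big[_/_]_(_ < 5 | _) e _) (\big[_/_]_(_ < 5 | _) g y _) (ahead k y) (g x k).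
by move=> [] [] [] [].
Unshelve. all: by end_near. Qed.

Let crossing k y : n != 0 -> vleft k y (+) vleft (k + 1) y ->
  exists P s, [/\ side p k P, P = ray y n s & ahead k y = (0 < s)].
Proof.
move=> n0 lr; set A := p k; set B := p (k + 1).
have N0 : 0 < dot n n by rewrite dot_gt0.
have d0 : crs B n - crs A n != 0.
  apply/negP; rewrite subr_eq0 => /eqP e; move: lr.
  by rewrite /vleft -/A -/B e addbb.
pose t := (crs y n - crs A n) / (crs B n - crs A n).
have tE : t * (crs B n - crs A n) = crs y n - crs A n by rewrite mulfVK.
have t01 : 0 <= t <= 1.
  move: lr; rewrite /vleft -/A -/B; move: d0 tE.
  move: (crs y n) (crs A n) (crs B n) => y' a b d0 tE.
  case: leP => h1; case: leP => h2 // _; apply/andP; split; rewrite leNgt; apply/negP => h;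
    move: tE h h1 h2; nra.
pose P := ray A (B - A) t.
have cP : crs (P - y) n = 0.
  have -> : crs (P - y) n = crs A n - crs y n + t * (crs B n - crs A n).
    by rewrite /crs /P /ray /=; ring.
  by rewrite tE; ring.
pose s := dot (P - y) n / dot n n.
have sE : s * dot n n = dot (P - y) n by rewrite mulfVK // gt_eqF.
have Ps : P = ray y n s.
  apply: pairE; rewrite /ray /=; apply: (mulfI (lt0r_neq0 N0)).
    have -> : dot n n * (y.1 + s * n.1) = dot n n * y.1 + (s * dot n n) * n.1 by ring.
    rewrite sE; apply/eqP; rewrite -subr_eq0; apply/eqP.
    transitivity (n.2 * crs (P - y) n); last by rewrite cP mulr0.
    by rewrite /crs /dot /=; ring.
  have -> : dot n n * (y.2 + s * n.2) = dot n n * y.2 + (s * dot n n) * n.2 by ring.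
  rewrite sE; apply/eqP; rewrite -subr_eq0; apply/eqP.
  transitivity (- n.1 * crs (P - y) n); last by rewrite cP mulr0.
  by rewrite /crs /dot /=; ring.
exists P, s; split => //; first by exists t.
rewrite /ahead -/A -/B.
have -> : orient A B y * (crs B n - crs A n) = - s * (crs B n - crs A n) ^+ 2.
  have oP : orient A B P = 0 by rewrite /P /ray /orient /crs /=; ring.
  have -> : orient A B y = - s * (crs B n - crs A n).
    move: oP; rewrite Ps /orient /ray /crs /=; lra.
  by ring.
by rewrite mulNr oppr_lt0 pmulr_lgt0 // lt_def sqrf_eq0 d0 sqr_ge0.
Qed.

Lemma parity_ahead_false k y : n != 0 -> dot n (p k) <= dot n y ->
  dot n (p (k + 1)) <= dot n y -> crosses k y = false.
Proof.
move=> n0 h1 h2; apply/negbTE/negP => /andP[lr].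
have [P [s [sP eP ->]]] := crossing n0 lr => s0.
have := @segment_dot_le R _ _ (- n) (- dot n y) _ sP.
have dN u : dot (- n) u = - dot n u by rewrite /dot /=; ring.
rewrite !dN !lerN2 => /(_ h1 h2); rewrite eP.
have -> : dot n (ray y n s) = dot n y + s * dot n n by rewrite /ray /dot /=; ring.
by rewrite gerDl leNgt mulr_gt0 ?dot_gt0.
Qed.

(* A ray in direction -n also meets an odd number of sides, as a line meets an
   even number: so y lies between two points of the outline. *)
Lemma parity_between y : n != 0 -> parity y -> exists P Q s t,
  [/\ outline p P, outline p Q, 0 < s, 0 <= t & P = ray y n s /\ Q = ray y n (- t)].
Proof.
move=> n0 py.
have ex (f : 'I_5 -> bool) : \big[addb/false]_(k < 5) f k -> exists k, f k.
  move=> h; apply: contrapT => ne; move: h; rewrite big1 // => k _.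
  by apply/negbTE/negP => fk; apply: ne; exists k.
have [k /andP[lr ak]] := ex _ py.
have [P [s [sP eP es]]] := crossing n0 lr.
have tot : \big[addb/false]_(k < 5) (vleft k y (+) vleft (k + 1) y) = false.
  by rewrite big_split /= (sum_shift (fun l => vleft l y)) addbb.
have E : \big[addb/false]_(k < 5) ((vleft k y (+) vleft (k + 1) y) && ~~ ahead k y) =
    parity y (+) \big[addb/false]_(k < 5) (vleft k y (+) vleft (k + 1) y).
  rewrite /parity -big_split /=; apply: eq_bigr => l _.
  by rewrite /crosses; move: (vleft l y (+) _) (ahead l y) => [] [].
rewrite tot py in E; have {}E : \big[addb/false]_(k < 5)
  ((vleft k y (+) vleft (k + 1) y) && ~~ ahead k y) by rewrite E.
move: E => /ex[l /andP[lr' al]].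
have [Q [t [sQ eQ et]]] := crossing n0 lr'.
exists P, Q, s, (- t); split.
- by exists k.
- by exists l.
- by rewrite -es.
- by rewrite oppr_ge0 leNgt -et.
- by rewrite opprK.
Qed.

End Parity.

(** * Odd parity implies inside *)

Section InsideParity.
Variable R : realType.
Implicit Types (p : pentagon R) (n x y : plane R).

Lemma outline_norm p : exists2 M : R, 0 <= M & forall z, outline p z ->
  `|z.1| <= M /\ `|z.2| <= M.
Proof.
exists (\sum_k (`|(p k).1| + `|(p k).2|)); first by apply: sumr_ge0 => k _; rewrite addr_ge0.
move=> z [k _ [t /andP[t0 t1] ->]] /=.
have b l : `|(p l).1| + `|(p l).2| <= \sum_k (`|(p k).1| + `|(p k).2|).
  rewrite (bigD1 l) //= lerDl; apply: sumr_ge0 => i _; by rewrite addr_ge0.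
set M := \sum_k _ in b *.
have h (a c : R) : `|a| <= M -> `|c| <= M -> `|a + t * (c - a)| <= M.
  move=> ha hc; have -> : a + t * (c - a) = (1 - t) * a + t * c by ring.
  apply: le_trans (ler_normD _ _) _; rewrite !normrM (ger0_norm t0).
  rewrite (ger0_norm (_ : 0 <= 1 - t)) ?subr_ge0 //.
  by move: (`|a|) (`|c|) ha hc => a' c'; nra.
have b1 l : `|(p l).1| <= M by apply: le_trans (b l); rewrite lerDl.
have b2 l : `|(p l).2| <= M by apply: le_trans (b l); rewrite lerDr.
by split; apply: h.
Qed.

(** Parity is constant on the component of [x], and every point of odd parity lies between two
    points of the outline, so the component stays in a box that contains the outline. *)
Lemma parity_inside p n x : n != 0 -> ~ outline p x -> parity p n x -> inside p x.
Proof.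
move=> n0 nx px; split => //.
set K := connected_component _ _.
have [M M0 HM] := outline_norm p.
have KO : forall y, K y -> parity p n y = parity p n x.
  move=> y Ky.
  apply: (@connected_locally_constant _ (~` outline p) K (parity p n)) => //.
  - move=> z nz; near=> w; split; first by near: w; exact: near_not_outline.
    by near: w; exact: parity_near.
  - exact: connected_component_sub.
  - exact: component_connected.
  - exact: connected_component_refl.
exists M; split; first exact: num_real.
move=> M' MM' y /KO; rewrite px => py /=.
have [P [Q [s [t [oP oQ s0 t0 [eP eQ]]]]]] := parity_between n0 py.
have [P1 P2] := HM _ oP; have [Q1 Q2] := HM _ oQ.
have st : 0 < s + t by rewrite ltr_wpDr.
have avg (a b c : R) : `|a| <= M -> `|b| <= M -> c * (s + t) = t * a + s * b -> `|c| <= M.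
  move=> ha hb e; rewrite -(ler_pM2r st) -{1}(gtr0_norm st) -normrM e.
  apply: le_trans (ler_normD _ _) _; rewrite !normrM (gtr0_norm s0) (ger0_norm t0).
  by move: (`|a|) (`|b|) ha hb => a' b'; nra.
apply: le_trans (ltW MM'); rewrite prod_normE ge_max; apply/andP; split.
  by apply: avg P1 Q1 _; rewrite eP eQ /ray /=; ring.
by apply: avg P2 Q2 _; rewrite eP eQ /ray /=; ring.
Unshelve. all: by end_near. Qed.

End InsideParity.

Lemma near_forall (T : topologicalType) (I : finType) (x : T) (P : I -> T -> Prop) :
  (forall i, \forall y \near x, P i y) -> \forall y \near x, forall i, P i y.
Proof. by move=> h; apply: filter_forall. Qed.

(** * The interior near a side and near an exposed vertex *)

Section LocalInterior.
Variable R : realType.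
Implicit Types (p : pentagon R) (n x y z : plane R) (k l : 'I_5).

Lemma vertex_inj p : injective p.
Proof. by have [] := vertex_simple p. Qed.

Lemma vertexS_neq p k : p (k + 1) - p k != 0.
Proof.
rewrite subr_eq0; apply/eqP => /vertex_inj/eqP.
by rewrite -subr_eq0 addrAC subrr add0r.
Qed.

Lemma segment_sym (A B z : plane R) : segment A B z -> segment B A z.
Proof.
move=> [t /andP[t0 t1] ->]; exists (1 - t); first by apply/andP; split; lra.
by apply: pairE => /=; ring.
Qed.

Definition midpoint p k : plane R := ray (p k) (p (k + 1) - p k) (1 / 2).

Lemma midpoint_side p k : side p k (midpoint p k).
Proof. by exists (1 / 2) => //; apply/andP; split; lra. Qed.

Lemma midpoint_other p k l : l != k -> ~ side p l (midpoint p k).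
Proof.
move=> lk h; have [_ /(_ l k _ lk h (midpoint_side p k))] := vertex_simple p.
have d0 := vertexS_neq p k.
have ne (c : R) : c != 0 -> ray (p k) (p (k + 1) - p k) (1 / 2) <> ray (p k) (p (k + 1) - p k) (1 / 2 + c).
  move=> c0 e; move/eqP: d0; apply; apply: pairE => /=.
    have : c * (p (k + 1) - p k).1 = 0.
      by move: (congr1 fst e); rewrite /ray /=; lra.
    by move/eqP; rewrite mulf_eq0 (negPf c0) => /eqP.
  have : c * (p (k + 1) - p k).2 = 0.
    by move: (congr1 snd e); rewrite /ray /=; lra.
  by move/eqP; rewrite mulf_eq0 (negPf c0) => /eqP.
case=> [[_ e]|[-> e]].
  apply: (ne (- (1 / 2))); first by apply/eqP; lra.
  by rewrite subrr ray0.
apply: (ne (1 / 2)); first by apply/eqP; lra.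
rewrite -/(midpoint p k) e; by apply: pairE; rewrite /ray /=; field.
Qed.

(** Only side [k] passes near its midpoint, and parity flips there, so one of the two half-rays has
    odd parity. *)
Lemma side_inside p k n : crs (p (k + 1) - p k) n != 0 ->
  (\forall t \near (0 : R)^'+, inside p (ray (midpoint p k) n t)) \/
  (\forall t \near (0 : R)^'+, inside p (ray (midpoint p k) n (- t))).
Proof.
move=> d0; set m := midpoint p k; set D := crs _ n in d0.
have [_ n0] := crs_neq0 d0.
have mE : crs m n = crs (p k) n + 1 / 2 * D by rewrite /m /D /midpoint /ray /crs /=; ring.
have BE : crs (p (k + 1)) n = crs (p k) n + D by rewrite /D /crs /=; ring.
have bt : crs (p k) n < crs m n < crs (p (k + 1)) n \/
  crs (p (k + 1)) n < crs m n < crs (p k) n.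
  rewrite mE BE; move: d0; rewrite neq_lt => /orP[h|h]; [right|left];
    by apply/andP; split; lra.
have [e He] := parity_near_side n0 (fun l lk => @midpoint_other p k l lk) bt.
have oray t : orient (p k) (p (k + 1)) (ray m n t) = t * D.
  by rewrite /D /m /midpoint /orient /ray /crs /=; ring.
have DD : 0 < D * D by rewrite -expr2 lt_def sqrf_eq0 d0 sqr_ge0.
have nout : \forall y \near m, forall l : 'I_5, l != k -> ~ side p l y.
  apply: (@near_forall _ _ _ (fun l y => l != k -> ~ side p l y)) => l.
  have [->|lk] := eqVneq l k; first exact: filterE.
  by apply: filterS (near_not_side (@midpoint_other p k l lk)).
have key : \forall t \near (0 : R), (forall l : 'I_5, l != k -> ~ side p l (ray m n t)) /\
     parity p n (ray m n t) = e (+) (t * D * D < 0).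
  have h1 := near_ray n nout; have h2 := near_ray n He.
  near=> t; split; first by near: t.
  have : parity p n (ray m n t) = e (+) (orient (p k) (p (k + 1)) (ray m n t) *
    (crs (p (k + 1)) n - crs (p k) n) < 0) by near: t.
  by rewrite oray BE addrAC subrr add0r.
have ok t : t != 0 -> (forall l, l != k -> ~ side p l (ray m n t)) ->
    ~ outline p (ray m n t).
  move=> t0 h [l _]; have [->|lk] := eqVneq l k; last exact: h.
  move=> /segment_orient; rewrite oray => /eqP.
  by rewrite mulf_eq0 (negPf t0) (negPf d0).
case: e key {He} => key; [left; have key' := near_right key|right; have key' := near_rightN key].
  near=> t; have t0 : 0 < t by [].
  have [h par] : (forall l, l != k -> ~ side p l (ray m n t)) /\
     parity p n (ray m n t) = true (+) (t * D * D < 0) by near: t.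
  apply: (parity_inside n0); first by apply: ok => //; rewrite gt_eqF.
  rewrite par -mulrA; have -> : (t * (D * D) < 0) = false; last by [].
  by apply/negbTE; rewrite -leNgt mulr_ge0 // ltW.
near=> t; have t0 : 0 < t by [].
have [h par] : (forall l, l != k -> ~ side p l (ray m n (- t))) /\
   parity p n (ray m n (- t)) = false (+) ((- t) * D * D < 0) by near: t.
apply: (parity_inside n0); first by apply: ok => //; rewrite oppr_eq0 gt_eqF.
by rewrite par -mulrA mulNr oppr_lt0 mulr_gt0.
Unshelve. all: by end_near. Qed.

Lemma direction_norm p k l : k != l -> dot (direction (p k) (p l)) (direction (p k) (p l)) = 1.
Proof.
move=> kl.
have l0 : 0 < edist (p k) (p l).
  by apply: edist_gt0; apply: contra_neq kl => /vertex_inj.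
have l0' := lt0r_neq0 l0.
have -> : dot (direction (p k) (p l)) (direction (p k) (p l)) =
  dot (p l - p k) (p l - p k) / edist (p k) (p l) ^+ 2.
  by rewrite /dot /direction /=; field.
by rewrite -elength_sqr divff // expf_neq0.
Qed.

(* [p], [q], [D] are crs u n, crs w n and crs u w for the sides u, w at a vertex
   of which the ray in direction n leaves the polygon. *)
Lemma wedge_parity (P Q D du dw N t lu lw : R) :
  0 < N -> D * N = P * dw - Q * du -> du < 0 -> dw < 0 -> D != 0 ->
  0 < t -> 0 < lu -> 0 < lw ->
  (P != 0 -> t * `|P + Q| < lu * `|P|) -> (Q != 0 -> t * `|P + Q| < lw * `|Q|) ->
  (((0 <= t * (P + Q)) (+) (lu * P <= t * (P + Q))) && (D * P < 0)) (+)
  (((lw * Q <= t * (P + Q)) (+) (0 <= t * (P + Q))) && (0 < D * Q)).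
Proof.
move=> N0 DN du0 dw0 D0 t0 lu0 lw0 hP hQ.
have abs (x : R) : t * `|x| = `|t * x| by rewrite normrM gtr0_norm.
have big (l X : R) : 0 < l -> (X != 0 -> t * `|P + Q| < l * `|X|) ->
    (0 < X -> (l * X <= t * (P + Q)) = false) /\ (X < 0 -> (l * X <= t * (P + Q)) = true).
  move=> l0 h; split=> X0.
    have := h (lt0r_neq0 X0); rewrite abs (gtr0_norm X0) => h'.
    by apply/negbTE; rewrite -ltNge; apply: le_lt_trans h'; exact: ler_norm.
  have := h (ltr0_neq0 X0); rewrite abs (ltr0_norm X0) mulrN => h'.
  apply/ltW; rewrite -lterN2; apply: le_lt_trans h'.
  by rewrite -normrN ler_norm.
have [UP UN] := big _ _ lu0 hP; have [WP WN] := big _ _ lw0 hQ.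
have Dlt : 0 <= P -> Q <= 0 -> D < 0.
  move=> p0 q0; rewrite lt_neqAle D0 /= -(pmulr_lle0 _ N0) DN.
  by move: p0 q0 du0 dw0; nra.
have Dgt : P <= 0 -> 0 <= Q -> 0 < D.
  move=> p0 q0; rewrite lt_def D0 /= -(pmulr_lge0 _ N0) DN.
  by move: p0 q0 du0 dw0; nra.
have sP (x : R) : (0 <= t * x) = (0 <= x) by rewrite pmulr_rge0.
case: (ltgtP P 0) => p0; case: (ltgtP Q 0) => q0.
- rewrite UN // WN //; have -> : (0 <= t * (P + Q)) = false.
    by apply/negbTE; rewrite sP -ltNge; lra.
  by rewrite /= nmulr_llt0 // nmulr_lgt0 //; case: ltgtP D0.
- have D1 := Dgt (ltW p0) (ltW q0).
  rewrite UN // WP // [D * P < 0]pmulr_rlt0 // p0 pmulr_rgt0 // q0.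
  by case: (0 <= _).
- have D1 : 0 < D by apply: Dgt; rewrite ?q0 // ltW.
  rewrite UN // q0 !mulr0 ltxx andbF addbF pmulr_rlt0 // p0 andbT.
  by rewrite addr0 sP leNgt p0.
- have D1 := Dlt (ltW p0) (ltW q0).
  rewrite UP // WN // [D * P < 0]nmulr_rlt0 // p0 nmulr_rgt0 // q0.
  by case: (0 <= _).
- rewrite UP // WP //; have -> : (0 <= t * (P + Q)) = true.
    by rewrite sP; lra.
  by rewrite /= pmulr_llt0 // pmulr_lgt0 //; case: ltgtP D0.
- have D1 : D < 0 by apply: Dlt; rewrite ?q0 // ltW.
  rewrite UP // q0 !mulr0 ltxx andbF addbF nmulr_rlt0 // p0 andbT.
  by rewrite addr0 sP ltW.
- have D1 : D < 0 by apply: Dlt; rewrite ?p0 // ltW.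
  rewrite WN // p0 !mulr0 ltxx andbF addFb nmulr_rgt0 // q0 andbT.
  by rewrite add0r sP leNgt q0.
- have D1 : 0 < D by apply: Dgt; rewrite ?p0 // ltW.
  rewrite WP // p0 !mulr0 ltxx andbF addFb pmulr_rgt0 // q0 andbT.
  by rewrite add0r sP ltW.
- by exfalso; move/eqP: D0; apply; apply: (mulIf (lt0r_neq0 N0)); rewrite DN p0 q0 !mul0r subrr.
Qed.

(** Both sides at the vertex lead into the half-plane where [N] is positive. If they were collinear,
    they would have the same direction and overlap, against simplicity. *)
Lemma exposed_crs_neq0 p k N : (forall j, j != k -> 0 < dot N (p j - p k)) ->
  crs (p (k + 1) - p k) (p (k - 1) - p k) != 0.
Proof.
move=> ex; apply/negP => /eqP o0.
have [kk1 kk2 k1k k2k k21] := neqS5 k.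
pose n : plane R := (- N.2, N.1).
have cn z : crs z n = dot N z by rewrite /crs /dot /n /=; ring.
have a0 := ex _ k1k; have b0 := ex _ k2k.
have d0 : crs (p (k + 1) - p k) n != 0 by rewrite cn gt_eqF.
have [t [eW eN]] := orient_on_line d0 o0.
have t0 : 0 < t.
  move: b0; have -> : dot N (p (k - 1) - p k) = t * dot N (p (k + 1) - p k).
    by rewrite -!cn; move: eN; rewrite {1 2}/crs /crs /=; lra.
  by rewrite pmulr_lgt0.
have W1 : side p (k - 1) (p (k - 1)) by exact: segment_endl.
have U1 : side p k (p (k + 1)) by exact: segment_endr.
have simple := (vertex_simple p).2.
have [t1|t1] := leP t 1.
  have W2 : side p k (p (k - 1)) by exists t => //; rewrite (ltW t0).
  case: (simple _ _ _ kk2 W2 W1) => [[e _]|[_ /vertex_inj e]].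
    by rewrite e eqxx in k21.
  by rewrite e eqxx in k2k.
have U2 : side p (k - 1) (p (k + 1)).
  rewrite /side subrK; apply: segment_sym.
  exists t^-1; first by rewrite invr_ge0 (ltW t0) invf_le1 // ltW.
  have tn := lt0r_neq0 t0.
  by apply: pairE; rewrite /= eW /ray /=; field.
case: (simple _ _ _ kk2 U1 U2) => [[e _]|[_ /vertex_inj e]].
  by rewrite e eqxx in k21.
by rewrite e eqxx in k1k.
Qed.

(** From a point of the bisector close to the vertex, the ray in direction [- N] leaves the polygon
    through the corner: the other sides lie behind it, and it meets exactly one of the two sides at
    the vertex. So [interior_angle] takes its convex branch. *)
Lemma exposed_inside p k N (u := direction (p k) (p (k + 1)))
    (w := direction (p k) (p (k - 1))) :
  (forall j, j != k -> 0 < dot N (p j - p k)) ->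
  \forall t \near (0 : R)^'+,
     inside p ((p k).1 + t * (u + w).1, (p k).2 + t * (u + w).2).
Proof.
move=> ex; have [kk1 kk2 k1k k2k k21] := neqS5 k.
pose lu := edist (p k) (p (k + 1)); pose lw := edist (p k) (p (k - 1)).
have lu0 : 0 < lu by apply: edist_gt0; apply: contra_neq kk1 => /vertex_inj.
have lw0 : 0 < lw by apply: edist_gt0; apply: contra_neq kk2 => /vertex_inj.
have eU : p (k + 1) = ray (p k) u lu.
  have l0 := lt0r_neq0 lu0.
  by apply: pairE; rewrite /ray /u /direction /= -/lu; field.
have eW : p (k - 1) = ray (p k) w lw.
  have l0 := lt0r_neq0 lw0.
  by apply: pairE; rewrite /ray /w /direction /= -/lw; field.
pose n : plane R := - N.
have dN (z : plane R) : dot n z = - dot N z by rewrite /dot /n /=; ring.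
have du0 : dot u n < 0.
  have := ex _ k1k; have -> : dot N (p (k + 1) - p k) = - lu * dot u n.
    by rewrite eU /ray /dot /n /=; ring.
  by rewrite mulNr oppr_gt0 pmulr_rlt0.
have dw0 : dot w n < 0.
  have := ex _ k2k; have -> : dot N (p (k - 1) - p k) = - lw * dot w n.
    by rewrite eW /ray /dot /n /=; ring.
  by rewrite mulNr oppr_gt0 pmulr_rlt0.
have D0 : crs u w != 0.
  have := exposed_crs_neq0 ex.
  have -> : crs (p (k + 1) - p k) (p (k - 1) - p k) = lu * lw * crs u w.
    by rewrite eU eW /ray /crs /=; ring.
  by apply: contra_neq => ->; rewrite mulr0.
have n0 : n != 0.
  by apply/eqP => e; move: du0; rewrite e /dot /= !mulr0 addr0 ltxx.
have N0 := dot_gt0 n0.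
have DN : crs u w * dot n n = crs u n * dot w n - crs w n * dot u n.
  by rewrite /crs /dot; ring.
pose y t := ray (p k) (u + w) t.
have off l : l != k -> l != k - 1 -> ~ side p l (p k).
  move=> lk lk1 h.
  have l1k : l + 1 != k by apply: contra_neq lk1 => <-; rewrite addrK.
  have pos j : j != k -> dot N (p k) < dot N (p j).
    move=> /ex; have -> : dot N (p j - p k) = dot N (p j) - dot N (p k).
      by rewrite /dot /=; ring.
    by rewrite subr_gt0.
  by have := segment_dot h (pos _ lk) (pos _ l1k); rewrite ltxx.
have near1 : \forall t \near (0 : R), forall j : 'I_5, j != k -> dot n (p j) <= dot n (y t).
  apply: (@near_forall _ _ _ (fun j t => j != k -> dot n (p j) <= dot n (y t))) => j.
  have [->|jk] := eqVneq j k; first exact: filterE.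
  have h : dot N (p k) < dot N (p j).
    have := ex _ jk; have -> : dot N (p j - p k) = dot N (p j) - dot N (p k).
      by rewrite /dot /=; ring.
    by rewrite subr_gt0.
  have := near_ray (u + w) (near_lt (@continuous_dotr R N) h).
  by apply: filterS => t ht _; rewrite !dN lerN2 ltW.
have near2 : \forall t \near (0 : R), forall l : 'I_5, l != k -> l != k - 1 -> ~ side p l (y t).
  apply: (@near_forall _ _ _ (fun l t => l != k -> l != k - 1 -> ~ side p l (y t))) => l.
  have [->|lk] := eqVneq l k; first exact: filterE.
  have [->|lk1] := eqVneq l (k - 1); first exact: filterE.
  by have := near_ray (u + w) (near_not_side (off l lk lk1)); apply: filterS.
have near3 (l X : R) : 0 < l ->
    \forall t \near (0 : R)^'+, X != 0 -> t * `|crs u n + crs w n| < l * `|X|.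
  move=> l0; have [->|X0] := eqVneq X 0; first exact: filterE.
  have c0 : 0 < l * `|X| / (1 + `|crs u n + crs w n|).
    by rewrite divr_gt0 ?mulr_gt0 ?normr_gt0 // ltr_wpDr.
  near=> t => _.
  have t0 : 0 < t by [].
  have : t < l * `|X| / (1 + `|crs u n + crs w n|) by near: t; exact: nbhs_right_lt.
  rewrite ltr_pdivlMr; last by rewrite ltr_wpDr.
  by rewrite mulrDr mulr1; lra.
have m1 := near_right near1; have m2 := near_right near2.
have m3 := near3 _ (crs u n) lu0; have m4 := near3 _ (crs w n) lw0.
near=> t; rewrite -/(ray (p k) (u + w) t) -/(y t).
have t0 : 0 < t by [].
have h1 : forall j, j != k -> dot n (p j) <= dot n (y t) by near: t.
have h2 : forall l, l != k -> l != k - 1 -> ~ side p l (y t) by near: t.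
have h3 : crs u n != 0 -> t * `|crs u n + crs w n| < lu * `|crs u n| by near: t.
have h4 : crs w n != 0 -> t * `|crs u n + crs w n| < lw * `|crs w n| by near: t.
have o1 : orient (p k) (p (k + 1)) (y t) = t * lu * crs u w.
  by rewrite eU /y /orient /ray /crs /=; ring.
have o2 : orient (p (k - 1)) (p k) (y t) = t * lw * crs u w.
  by rewrite eW /y /orient /ray /crs /=; ring.
apply: (parity_inside n0).
  move=> [l _]; have [->|lk] := eqVneq l k.
    move=> /segment_orient; rewrite o1 => /eqP.
    by rewrite !mulf_eq0 (gt_eqF t0) (gt_eqF lu0) (negPf D0).
  have [->|lk1] := eqVneq l (k - 1); last exact: h2.
  move=> /segment_orient; rewrite subrK o2 => /eqP.
  by rewrite !mulf_eq0 (gt_eqF t0) (gt_eqF lw0) (negPf D0).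
have other l : l != k -> l != k - 1 -> crosses p n l (y t) = false.
  move=> lk lk1; apply: parity_ahead_false => //; apply: h1 => //.
  by apply: contra_neq lk1 => <-; rewrite addrK.
rewrite /parity (bigD1 k) //= (bigD1 (k - 1)) //= big1 => [|l /andP[lk lk1]]; last first.
  exact: other.
rewrite addbF.
have := wedge_parity N0 DN du0 dw0 D0 t0 lu0 lw0 h3 h4; congr is_true.
rewrite /crosses /vleft /ahead subrK o1 o2.
have yE : crs (y t) n = crs (p k) n + t * (crs u n + crs w n).
  by rewrite /y /ray /crs /=; ring.
have UE : crs (p (k + 1)) n = crs (p k) n + lu * crs u n.
  by rewrite eU /ray /crs /=; ring.
have WE : crs (p (k - 1)) n = crs (p k) n + lw * crs w n.
  by rewrite eW /ray /crs /=; ring.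
rewrite yE UE WE lerDl !lerD2l.
have -> : (t * lu * crs u w * (crs (p k) n + lu * crs u n - crs (p k) n) < 0) =
    (crs u w * crs u n < 0).
  have -> : t * lu * crs u w * (crs (p k) n + lu * crs u n - crs (p k) n) =
    (t * lu * lu) * (crs u w * crs u n) by ring.
  by rewrite pmulr_rlt0 // !mulr_gt0.
have -> : (t * lw * crs u w * (crs (p k) n - (crs (p k) n + lw * crs w n)) < 0) =
    (0 < crs u w * crs w n).
  have -> : t * lw * crs u w * (crs (p k) n - (crs (p k) n + lw * crs w n)) =
    - ((t * lw * lw) * (crs u w * crs w n)) by ring.
  by rewrite oppr_lt0 pmulr_rgt0 // !mulr_gt0.
by [].
Unshelve. all: by end_near. Qed.

Lemma direction_dot_itv p k : -1 <= dot (direction (p k) (p (k + 1)))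
  (direction (p k) (p (k - 1))) <= 1.
Proof.
have [kk1 kk2 _ _ _] := neqS5 k.
set u := direction _ _; set w := direction _ _.
have u1 : dot u u = 1 by exact: direction_norm.
have w1 : dot w w = 1 by exact: direction_norm.
have := lagrange u w; rewrite u1 w1 mulr1.
by move: (dot u w) (crs u w) => a b h; apply/andP; split; nra.
Qed.

Lemma exposed_angle p k N : (forall j, j != k -> 0 < dot N (p j - p k)) ->
  interior_angle p k <= pi.
Proof.
move=> /exposed_inside h; rewrite /interior_angle.
by case: asboolP => // _; rewrite acos_lepi // direction_dot_itv.
Qed.

(** A value below [pi] can only come from the first branch of [interior_angle]; the other one gives
    at least [pi]. *)
Lemma interior_angle_cos p k (a : R) : a < pi -> interior_angle p k = a ->
  dot (direction (p k) (p (k + 1))) (direction (p k) (p (k - 1))) = cos a.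
Proof.
rewrite /interior_angle; have := direction_dot_itv p k.
set d := dot _ _ => dI ap; case: asboolP => _ e.
  by rewrite -e acosK // in_itv.
by exfalso; have := acos_lepi dI; lra.
Qed.

End LocalInterior.

(** * Convex hulls of pentagons and lower bounds on perimeters *)

Section Hulls.
Variable R : realType.
Implicit Types (p : pentagon R) (N x y z A B C : plane R) (k l : 'I_5).

Lemma in_tri_vert1 A B C : in_tri A B C A.
Proof.
by exists 1, 0, 0; split; rewrite ?ler01 //; [lra|apply: pairE => /=; ring].
Qed.

Lemma in_tri_vert2 A B C : in_tri A B C B.
Proof. by apply: in_tri_swap12; exact: in_tri_vert1. Qed.

Lemma in_tri_vert3 A B C : in_tri A B C C.
Proof. by apply: in_tri_swap23; exact: in_tri_vert2. Qed.

Lemma in_tri_convex A B C u v w x : in_tri A B C u -> in_tri A B C v ->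
  in_tri A B C w -> in_tri u v w x -> in_tri A B C x.
Proof.
move=> [a1 [b1 [c1 [a10 b10 c10 s1 ->]]]] [a2 [b2 [c2 [a20 b20 c20 s2 ->]]]].
move=> [a3 [b3 [c3 [a30 b30 c30 s3 ->]]]] [a [b [c [a0 b0 c0 s ->]]]] /=.
exists (a * a1 + b * a2 + c * a3), (a * b1 + b * b2 + c * b3), (a * c1 + b * c2 + c * c3).
split; rewrite ?addr_ge0 ?mulr_ge0 //.
  transitivity (a * (a1 + b1 + c1) + b * (a2 + b2 + c2) + c * (a3 + b3 + c3)).
    by ring.
  by rewrite s1 s2 s3 !mulr1.
by apply: pairE => /=; ring.
Qed.

Lemma dotB N x y : dot N (x - y) = dot N x - dot N y.
Proof. by rewrite /dot /=; ring. Qed.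

Lemma in_tri_separated (s : seq (plane R)) u v w x N : in_tri u v w x ->
  u \in s -> v \in s -> w \in s -> (forall y, y \in s -> 0 < dot N (y - x)) -> False.
Proof.
move=> h us vs ws H.
have dC (y z : plane R) : dot N (y - z) = dot N y - dot N z by exact: dotB.
have := H _ us; have := H _ vs; have := H _ ws; rewrite !dC.
move: h => [a [b [c [a0 b0 c0 sm ->]]]].
have -> : dot N (a * u.1 + b * v.1 + c * w.1, a * u.2 + b * v.2 + c * w.2) =
  a * dot N u + b * dot N v + c * dot N w by rewrite /dot /=; ring.
have -> : a = 1 - b - c by lra.
have a0' : 0 <= 1 - b - c by lra.
move: (dot N u) (dot N v) (dot N w) => P Q S h1 h2 h3.
pose m := (1 - b - c) * P + b * Q + c * S.
have e : (1 - b - c) * (P - m) + b * (Q - m) + c * (S - m) = 0 by rewrite /m; ring.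
have := e; have z1 : 0 <= (1 - b - c) * (P - m) by rewrite mulr_ge0 // ltW.
have z2 : 0 <= b * (Q - m) by rewrite mulr_ge0 // ltW.
have z3 : 0 <= c * (S - m) by rewrite mulr_ge0 // ltW.
have [b1|b1] := ltP 0 b.
  by have : 0 < b * (Q - m) by [rewrite mulr_gt0]; lra.
have [c1|c1] := ltP 0 c.
  by have : 0 < c * (S - m) by [rewrite mulr_gt0]; lra.
by have : 0 < (1 - b - c) * (P - m) by [rewrite mulr_gt0 //; lra]; lra.
Qed.

Definition others p k : seq (plane R) := [seq p j | j <- [:: k + 1; k + 2; k + 3; k + 4]].

(** By Carathéodory's theorem, membership of the vertex in the convex hull of the other four. *)
Definition hidden p k := exists u v w, [/\ u \in others p k, v \in others p k,
  w \in others p k & in_tri u v w (p k)].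

Lemma I5_shiftP k j : [\/ j = k \/ j = k + 1, j = k + 2, j = k + 3 | j = k + 4].
Proof.
have e : j = k + (j - k) by rewrite addrC subrK.
have s4 : i3 = 3 :> 'I_5 by apply: val_inj; rewrite /= !inordK.
have s5 : i4 = 4 :> 'I_5 by apply: val_inj; rewrite /= !inordK.
have s2 : i1 = 1 :> 'I_5 by apply: val_inj; rewrite /= !inordK.
have s3 : i2 = 2 :> 'I_5 by apply: val_inj; rewrite /= !inordK.
have s1 : i0 = 0 :> 'I_5 by apply: val_inj; rewrite /= !inordK.
rewrite {}e; have [->|[->|[->|[->|->]]]] := I5P (j - k); rewrite ?s1 ?s2 ?s3 ?s4 ?s5.
- by apply: Or41; left; rewrite addr0.
- by apply: Or41; right.
- exact: Or42.
- exact: Or43.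
- exact: Or44.
Qed.

Lemma mem_others p k j : j != k -> p j \in others p k.
Proof.
rewrite /others /= !inE.
by have [[->|->]|->|->|->] := I5_shiftP k j; rewrite eqxx ?orbT.
Qed.

Lemma others_neq p k u : u \in others p k -> exists2 j, j != k & u = p j.
Proof.
have ne (c : 'I_5) : c != 0 -> k + c != k.
  by apply: contra_neq => /(congr1 (fun z : 'I_5 => z - k)); rewrite addrAC subrr add0r.
rewrite /others /= !inE => /or4P[] /eqP->; [exists (k + 1)|exists (k + 2)|
  exists (k + 3)|exists (k + 4)] => //; exact: ne.
Qed.

Lemma hidden_or_exposed p k :
  hidden p k \/ exists N, forall j, j != k -> 0 < dot N (p j - p k).
Proof.
have [[N H]|h] := separation (others p k) (p k); last by left.
by right; exists N => j jk; apply: H; exact: mem_others.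
Qed.

Lemma reflex_hidden p k : pi < interior_angle p k -> hidden p k.
Proof.
by have [//|[N /exposed_angle]] := hidden_or_exposed p k; rewrite leNgt => /negP.
Qed.

(** A functional that separates [x] from the other four vertices separates it from the hidden one
    too, and [region_separated] applies. *)
Lemma region_hidden p k x : hidden p k -> region p x ->
  exists u v w, [/\ u \in others p k, v \in others p k,
    w \in others p k & in_tri u v w x].
Proof.
move=> [a [b [c [ha hb hc habc]]]] rx.
have [[N H]|//] := separation (others p k) x.
exfalso; apply: (@region_separated R p x N _ rx) => j.
have [->|jk] := eqVneq j k; last by apply: H; exact: mem_others.
rewrite dotB subr_gt0 ltNge; apply/negP => le.
apply: (in_tri_separated (s := others p k) (N := N) habc ha hb hc) => y ys.
have := H _ ys; rewrite !dotB !subr_gt0; exact: le_lt_trans.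
Qed.

(* Two hidden vertices never hide each other: the hull is spanned by the rest. *)
Lemma region_two_hidden p k l (A B C : plane R) : k != l -> hidden p k -> hidden p l ->
  (forall j, j != k -> j != l -> p j \in [:: A; B; C]) ->
  region p `<=` in_tri A B C.
Proof.
wlog suff main : k l / forall N x, k != l -> hidden p k ->
   (forall j, j != k -> j != l -> 0 < dot N (p j - x)) ->
   dot N (p k - x) <= dot N (p l - x) -> 0 < dot N (p k - x).
  move=> kl hk hl ABC x rx.
  have [[N H]|[u [v [w [us vs ws h]]]]] := separation [:: A; B; C] x; last first.
    have m y : y \in [:: A; B; C] -> in_tri A B C y.
      rewrite !inE => /or3P[] /eqP->; first exact: in_tri_vert1.
        exact: in_tri_vert2.
      exact: in_tri_vert3.
    by apply: in_tri_convex h; exact: m.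
  exfalso; apply: (@region_separated R p x N _ rx) => j.
  have Hj i : i != k -> i != l -> 0 < dot N (p i - x) by move=> ik il; apply: H; exact: ABC.
  have [le|lt] := leP (dot N (p k - x)) (dot N (p l - x)).
    have pk := main k l N x kl hk Hj le.
    have [->//|jk] := eqVneq j k; have [->|jl] := eqVneq j l; last exact: Hj.
    exact: lt_le_trans le.
  have pl : 0 < dot N (p l - x).
    apply: (main l k N x) => //; first by rewrite eq_sym.
      by move=> i il ik; exact: Hj.
    exact: ltW.
  have [->//|jl] := eqVneq j l; have [->|jk] := eqVneq j k; last exact: Hj.
  exact: lt_trans lt.
move=> N x kl [u [v [w [hu hv hw [a [b [c [a0 b0 c0 s e]]]]]]]] Hj le.
rewrite ltNge; apply/negP => neg.
(* If [p k] fails the inequality, [f] is nonnegative on the other vertices and vanishes at most at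
   [p l]. The convex combination that hides [p k] has mean 0 under [f], so all its weight sits on
   [p l], making the two vertices equal. *)
pose f y := dot N (y - x) - dot N (p k - x).
have fpos y : y \in others p k -> 0 <= f y /\ (f y = 0 -> y = p l).
  move=> /others_neq[j jk ->]; have [->|jl] := eqVneq j l.
    by split => //; rewrite subr_ge0.
  have : 0 < f (p j) by rewrite /f subr_gt0; apply: le_lt_trans neg _; exact: Hj.
  by move=> h; split; [exact: ltW|move=> h'; rewrite h' ltxx in h].
have sum0 : a * f u + b * f v + c * f w = 0.
  have -> : a * f u + b * f v + c * f w =
    (a * dot N u + b * dot N v + c * dot N w) - (a + b + c) * dot N (p k).
    by rewrite /f !dotB; ring.
  rewrite s mul1r e /dot /=; ring.
have [fu eu] := fpos _ hu; have [fv ev] := fpos _ hv; have [fw ew] := fpos _ hw.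
have pu : 0 <= a * f u by rewrite mulr_ge0.
have pv : 0 <= b * f v by rewrite mulr_ge0.
have pw : 0 <= c * f w by rewrite mulr_ge0.
have zero (d : R) y : d * f y = 0 -> (f y = 0 -> y = p l) ->
    d * y.1 = d * (p l).1 /\ d * y.2 = d * (p l).2.
  move=> /eqP; rewrite mulf_eq0 => /orP[/eqP->|/eqP h] h'; first by rewrite !mul0r.
  by rewrite h'.
have [|u1 u2] := zero a u _ eu; first by lra.
have [|v1 v2] := zero b v _ ev; first by lra.
have [|w1 w2] := zero c w _ ew; first by lra.
move/eqP: kl; apply; apply: (@vertex_inj R p); rewrite e.
by apply: pairE; rewrite /= ?u1 ?v1 ?w1 ?u2 ?v2 ?w2 -!mulrDl s mul1r.
Qed.

Lemma perimeterE p : perimeter p = plength p. Proof. by []. Qed.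

(** The triangle inequality applied when two vertices are skipped. Exchanging [k] and [l] reduces
    the cyclic gaps 3 and 4 to 2 and 1. *)
Lemma perimeter_ge_triangle p k l : k != l -> exists A B C : plane R,
  (forall j, j != k -> j != l -> p j \in [:: A; B; C]) /\
  edist A B + edist B C + edist C A <= perimeter p.
Proof.
have five (v : 'I_5 -> plane R) : plength v = edist (v i0) (v i1) + edist (v i1) (v i2) +
    edist (v i2) (v i3) + edist (v i3) (v i4) + edist (v i4) (v i0).
  by have [s0 s1 s2 s3 s4] := succ5; rewrite /plength sum5 s0 s1 s2 s3 s4.
have s1 : 1 = i1 by apply: val_inj; rewrite /= !inordK.
have s2 : 2 = i2 by apply: val_inj; rewrite /= !inordK.
have s3 : 3 = i3 by apply: val_inj; rewrite /= !inordK.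
have s4 : 4 = i4 by apply: val_inj; rewrite /= !inordK.
wlog main : k l / l = k + 1 \/ l = k + 2.
  move=> H kl; have [[e|e]|e|e|e] := I5_shiftP k l.
  - by rewrite e eqxx in kl.
  - by apply: H => //; left.
  - by apply: H => //; right.
  - have [|//|A [B [C [h1 h2]]]] := H l k; last 2 first.
    + by rewrite eq_sym.
    + by exists A, B, C; split => // j jk jl; exact: h1.
    right; rewrite e -addrA (_ : 3 + 2 = 0 :> 'I_5) ?addr0 //; exact: val_inj.
  - have [|//|A [B [C [h1 h2]]]] := H l k; last 2 first.
    + by rewrite eq_sym.
    + by exists A, B, C; split => // j jk jl; exact: h1.
    left; rewrite e -addrA (_ : 4 + 1 = 0 :> 'I_5) ?addr0 //; exact: val_inj.
move=> kl; rewrite perimeterE -(plength_shift p k) five.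
set v := fun i => p (k + i).
have t := @edist_tri R.
have pk : v i0 = p k by rewrite /v; congr (p _); apply: val_inj; rewrite /= inordK // addn0 modn_small.
case: main => e.
  exists (v i2), (v i3), (v i4); split; last first.
    have := t (v i4) (v i0) (v i1); have := t (v i4) (v i1) (v i2); lra.
  move=> j jk jl; rewrite !inE /v -s2 -s3 -s4.
  have [[h|h]|->|->|->] := I5_shiftP k j; rewrite ?eqxx ?orbT //.
    by rewrite h eqxx in jk.
  by rewrite h e eqxx in jl.
exists (v i1), (v i3), (v i4); split; last first.
  have := t (v i4) (v i0) (v i1); have := t (v i1) (v i2) (v i3); lra.
move=> j jk jl; rewrite !inE /v -s1 -s3 -s4.
have [[h|->]|h|->|->] := I5_shiftP k j; rewrite ?eqxx ?orbT //.
  by rewrite h eqxx in jk.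
by rewrite h e eqxx in jl.
Qed.

Lemma area_cover p (s : seq (plane R * plane R * plane R)) :
  (forall x, region p x -> exists2 t, t \in s & in_tri t.1.1 t.1.2 t.2 x) ->
  (area p <= (\sum_(t <- s) `|orient t.1.1 t.1.2 t.2| / 2)%:E)%E.
Proof. exact: mu2_cover. Qed.

(** The hull triangle has area at least 1, so its [orient] is at least 2 in absolute value, and
    [heron] gives [108 * 2 ^ 2 = 432]. *)
Lemma type2_perimeter p : type2 p -> area p = 1%E -> 432 <= perimeter p ^+ 4.
Proof.
move=> t2 a1.
have [k [l [kl hk hl]]] : exists k l, [/\ k != l, hidden p k & hidden p l].
  have := t2; rewrite /type2; set X := [pred k | _] => c2.
  have /card_gt0P[k kP] : (0 < #|X|)%N by rewrite c2.
  have := cardD1 k X; rewrite kP c2 add1n => -[/esym e].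
  have /card_gt0P[l] : (0 < #|[predD1 X & k]|)%N by rewrite e.
  rewrite !inE => /andP[lk lP]; exists k, l; split; first by rewrite eq_sym.
    by apply: reflex_hidden; move: kP; rewrite inE.
  exact: reflex_hidden.
have [A [B [C [ABC len]]]] := perimeter_ge_triangle p kl.
have sub := region_two_hidden kl hk hl ABC.
have := @area_cover p [:: (A, B, C)]; rewrite a1 big_seq1 /= lee_fin.
have h : forall x, region p x -> exists2 t, t \in [:: (A, B, C)] & in_tri t.1.1 t.1.2 t.2 x.
  by move=> x /sub; exists (A, B, C); rewrite ?mem_head.
move=> /(_ h) O2; have O2' : 2 <= `|orient A B C| by move: O2; lra.
have := heron A B C; rewrite -[orient A B C ^+ 2]real_normK ?num_real // => hr.
have P0 : 0 <= edist A B + edist B C + edist C A by rewrite !addr_ge0 ?edist_ge0.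
apply: (@le_trans _ _ ((edist A B + edist B C + edist C A) ^+ 4)); last first.
  by rewrite lerXn2r ?nnegrE // (le_trans P0).
apply: le_trans hr.
have : 2 * 2 <= `|orient A B C| ^+ 2 by rewrite expr2 ler_pM.
by lra.
Qed.

(** * Area of the hull of four points *)

Section FourPoints.
Variable P : 'I_4 -> plane R.

Let tri i := in_tri (P (i + 1)) (P (i + 2)) (P (i + 3)).
Let det i : R := orient (P (i + 1)) (P (i + 2)) (P (i + 3)).
Let j0 : 'I_4 := inord 0.
Let j1 : 'I_4 := inord 1.
Let j2 : 'I_4 := inord 2.
Let j3 : 'I_4 := inord 3.

Let I4P (k : 'I_4) : k = j0 \/ k = j1 \/ k = j2 \/ k = j3.
Proof.
case: k => [[|[|[|[|//]]]] h].
- by left; apply: val_inj; rewrite /= inordK.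
- by right; left; apply: val_inj; rewrite /= inordK.
- by right; right; left; apply: val_inj; rewrite /= inordK.
- by right; right; right; apply: val_inj; rewrite /= inordK.
Qed.

Let sum4 (f : 'I_4 -> R) : \sum_k f k = f j0 + f j1 + f j2 + f j3.
Proof.
rewrite !big_ord_recl big_ord0 addr0 !addrA.
by congr (f _ + f _ + f _ + f _); apply: val_inj; rewrite /= inordK.
Qed.

Let shift4 : [/\ [/\ j0 + 1 = j1, j1 + 1 = j2, j2 + 1 = j3 & j3 + 1 = j0],
  [/\ j0 + 2 = j2, j1 + 2 = j3, j2 + 2 = j0 & j3 + 2 = j1] &
  [/\ j0 + 3 = j3, j1 + 3 = j0, j2 + 3 = j1 & j3 + 3 = j2]].
Proof. by split; split; apply: val_inj; rewrite /= !inordK. Qed.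

(* Coefficients of the affine dependency between the four points. *)
Let dep (i : 'I_4) : R := if odd i then - det i else det i.

Let depE : [/\ dep j0 = orient (P j1) (P j2) (P j3), dep j1 = - orient (P j2) (P j3) (P j0),
  dep j2 = orient (P j3) (P j0) (P j1) & dep j3 = - orient (P j0) (P j1) (P j2)].
Proof.
have [[a0 a1 a2 a3] [b0 b1 b2 b3] [c0 c1 c2 c3]] := shift4.
by split; rewrite /dep /det inordK //= ?a0 ?a1 ?a2 ?a3 ?b0 ?b1 ?b2 ?b3 ?c0 ?c1 ?c2 ?c3.
Qed.

Let dep0 : [/\ \sum_i dep i = 0, \sum_i dep i * (P i).1 = 0 & \sum_i dep i * (P i).2 = 0].
Proof.
have [e0 e1 e2 e3] := depE.
by rewrite !sum4 e0 e1 e2 e3 /orient /crs /=; split; ring.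
Qed.

Let weights (la : 'I_4 -> R) x := [/\ forall i, 0 <= la i, \sum_i la i = 1,
  x.1 = \sum_i la i * (P i).1 & x.2 = \sum_i la i * (P i).2].

Let weights_tri la x i : weights la x -> la i = 0 -> tri i x.
Proof.
move=> [l0]; rewrite !sum4 => s x1 x2 li.
exists (la (i + 1)), (la (i + 2)), (la (i + 3)).
have [[a0 a1 a2 a3] [b0 b1 b2 b3] [c0 c1 c2 c3]] := shift4.
split => //.
  by rewrite -s; have [h|[h|[h|h]]] := I4P i; rewrite h ?a0 ?a1 ?a2 ?a3 ?b0 ?b1 ?b2 ?b3 ?c0 ?c1 ?c2 ?c3
    in li *; rewrite li; ring.
apply: pairE; rewrite ?x1 ?x2 /=; have [h|[h|[h|h]]] := I4P i;
  rewrite h ?a0 ?a1 ?a2 ?a3 ?b0 ?b1 ?b2 ?b3 ?c0 ?c1 ?c2 ?c3 in li *; rewrite li; ring.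
Qed.

(* Moving along the dependency until a weight vanishes. *)
Let drop_weight (c la : 'I_4 -> R) x : weights la x -> \sum_i c i = 0 ->
  \sum_i c i * (P i).1 = 0 -> \sum_i c i * (P i).2 = 0 ->
  (exists i, 0 < c i) -> exists2 i, 0 < c i & tri i x.
Proof.
move=> [l0 s x1 x2] c0 c1 c2 [i ci].
pose m := [arg min_(j < i | 0 < c j) (la j / c j)]%O.
have [cm mP] : 0 < c m /\ forall j, 0 < c j -> la m / c m <= la j / c j.
  by rewrite /m; case: (@arg_minP _ _ _ i (fun j => 0 < c j) (fun j => la j / c j) ci).
exists m => //; pose t := la m / c m.
have t0 : 0 <= t by rewrite divr_ge0 // ltW.
apply: (@weights_tri (fun j => la j - t * c j)); last by rewrite /t mulfVK ?subrr // gt_eqF.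
split.
- move=> j; rewrite subr_ge0; have [cj|cj] := ltP 0 (c j).
    by rewrite -ler_pdivlMr // mP.
  by apply: le_trans (l0 j); rewrite mulr_ge0_le0.
- by rewrite sumrB s -mulr_sumr c0 mulr0 subr0.
- rewrite x1; under [RHS]eq_bigr => j _ do rewrite mulrBl -mulrA.
  by rewrite sumrB -mulr_sumr c1 mulr0 subr0.
- rewrite x2; under [RHS]eq_bigr => j _ do rewrite mulrBl -mulrA.
  by rewrite sumrB -mulr_sumr c2 mulr0 subr0.
Qed.

Let hull4 x := exists u v w : 'I_4, in_tri (P u) (P v) (P w) x.

Let hull4_weights x : hull4 x -> exists2 la, weights la x & exists i, la i = 0.
Proof.
move=> [u [v [w [a [b [c [a0 b0 c0 s ->]]]]]]].
have [i iu] : exists i, i \notin [:: u; v; w].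
  apply: contrapT => ne; have : (#|'I_4| <= #|[:: u; v; w]|)%N.
    apply: subset_leq_card; apply/fintype.subsetP => i _; apply/negPn/negP => h.
    by apply: ne; exists i.
  by rewrite card_ord leqNgt (leq_ltn_trans (card_size _)).
exists (fun i => a * (i == u)%:R + b * (i == v)%:R + c * (i == w)%:R); last first.
  exists i; move: iu; rewrite !inE !negb_or => /and3P[/negPf-> /negPf-> /negPf->].
  by rewrite !mulr0 !addr0.
have sm (d : 'I_4 -> R) : \sum_i (a * (i == u)%:R + b * (i == v)%:R + c * (i == w)%:R) * d i
    = a * d u + b * d v + c * d w.
  have one (e : R) (j : 'I_4) : \sum_i (e * (i == j)%:R) * d i = e * d j.
    rewrite (bigD1 j) //= eqxx mulr1 big1 ?addr0 // => k kj.
    by rewrite (negPf kj) mulr0 mul0r.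
  rewrite -(one a u) -(one b v) -(one c w) -!big_split /=.
  by apply: eq_bigr => k _; rewrite !mulrDl.
split => //=.
- by move=> j; rewrite !addr_ge0 ?mulr_ge0.
- have := sm (fun=> 1); rewrite !mulr1 s => s1; rewrite -[RHS]s1.
  by apply: eq_bigr => j _; rewrite mulr1.
Qed.

(** The triangles opposite the points with positive coefficient in the affine dependency cover the
    hull, and so do those opposite the points with negative coefficient. The bound is the average of
    the two covers; if all coefficients vanish, the four triangles are degenerate. *)
Lemma hull4_area (X : set (plane R)) : X `<=` hull4 ->
  (((@lebesgue_measure R) \x (@lebesgue_measure R)) X <=
   ((\sum_i `|det i|) / 4)%:E)%E.
Proof.
move=> XH; set mu2 := (_ \x _)%E.
have bound (b : bool) (c := fun i => if b then dep i else - dep i) :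
    (exists i, 0 < c i) ->
    (mu2 X <= (\sum_i (if 0 < c i then `|det i| / 2 else 0))%:E)%E.
  move=> ex.
  pose s := [seq (P (i + 1), P (i + 2), P (i + 3)) | i <- enum 'I_4 & 0 < c i].
  have h : forall x, X x -> exists2 t, t \in s & in_tri t.1.1 t.1.2 t.2 x.
    move=> x /XH/hull4_weights[la wl _]; have [s0 s1 s2] := dep0.
    have [|||//|i ci ti] := @drop_weight c la x wl.
    - by rewrite /c; case: b {c ex s}; rewrite ?sumrN ?s0 ?oppr0.
    - rewrite /c; case: b {c ex s} => //.
      by under eq_bigr do rewrite mulNr; rewrite sumrN s1 oppr0.
    - rewrite /c; case: b {c ex s} => //.
      by under eq_bigr do rewrite mulNr; rewrite sumrN s2 oppr0.
    exists (P (i + 1), P (i + 2), P (i + 3)) => //.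
    by apply/mapP; exists i; rewrite // mem_filter ci mem_enum.
  have := mu2_cover h; rewrite big_map big_filter /= -big_mkcond /=.
  by rewrite big_enum_cond.
have absd i : `|dep i| = `|det i| by rewrite /dep; case: ifP; rewrite ?normrN.
have [p|np] := pselect (exists i, 0 < dep i).
  have [q|nq] := pselect (exists i, 0 < - dep i).
    have b1 := bound true p; have b2 := bound false q.
    have e : (\sum_i (if (0 < dep i)%R then `|det i| / 2 else 0) +
       \sum_i (if (0 < - dep i)%R then `|det i| / 2 else 0) <= (\sum_i `|det i|) / 2)%R.
      rewrite -big_split /= mulr_suml; apply: ler_sum => i _.
      rewrite oppr_gt0; case: ltgtP => h; rewrite ?addr0 ?add0r //.
    move: b1 b2; case: (mu2 X) => [r| |]; rewrite ?lee_fin //; last by move=> *; rewrite leNye.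
    by move: e; lra.
  exfalso; have [s0 _ _] := dep0; case: p => i pi0.
  have : 0 < \sum_i dep i.
    rewrite (bigD1 i) //=; apply: ltr_wpDr => //; apply: sumr_ge0 => j _.
    by rewrite leNgt -oppr_gt0; apply/negP => h; apply: nq; exists j.
  by rewrite s0 ltxx.
have z i : dep i = 0.
  have [s0 _ _] := dep0.
  have n j : dep j <= 0 by rewrite leNgt; apply/negP => h; apply: np; exists j.
  apply/le_anti; rewrite n /= -s0 (bigD1 i) //= gerDl.
  by apply: sumr_le0 => j _; exact: n.
have d0 i : `|det i| = 0 by rewrite -absd z normr0.
pose s := [seq (P (i + 1), P (i + 2), P (i + 3)) | i <- enum 'I_4].
have h : forall x, X x -> exists2 t, t \in s & in_tri t.1.1 t.1.2 t.2 x.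
  move=> x /XH/hull4_weights[la wl [i li]].
  exists (P (i + 1), P (i + 2), P (i + 3)); last exact: weights_tri wl li.
  by apply/mapP; exists i; rewrite // mem_enum.
apply: (le_trans (mu2_cover h)); rewrite lee_fin big_map big1 ?divr_ge0 ?sumr_ge0 //.
by move=> i _ /=; rewrite d0 mul0r.
Qed.

(** Each determinant is at most the product of two neighbouring sides. The four products add up to
    [(e0 + e2) (e1 + e3)], at most a quarter of the squared length. *)
Lemma hull4_perimeter (X : set (plane R)) : X `<=` hull4 ->
  (((@lebesgue_measure R) \x (@lebesgue_measure R)) X <=
   ((\sum_i edist (P i) (P (i + 1))) ^+ 2 / 16)%:E)%E.
Proof.
move=> /hull4_area h; apply: (le_trans h); rewrite lee_fin.
pose e i := edist (P i) (P (i + 1)).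
have d i : `|det i| <= e (i + 1) * e (i + 2).
  rewrite /det /e; have -> : i + 2 = i + 1 + 1 by rewrite -addrA.
  have -> : i + 3 = i + 1 + 1 + 1 by rewrite -!addrA.
  set A := P _; set B := P _; set C := P _.
  have -> : orient A B C = crs (B - A) (C - B) by rewrite /orient /crs /=; ring.
  exact: crs_le_elength.
have [[a0 a1 a2 a3] [b0 b1 b2 b3] _] := shift4.
have := (d j0, d j1, d j2, d j3); rewrite a0 a1 a2 a3 b0 b1 b2 b3.
case=> [[[h0 h1] h2] h3]; rewrite -/(e _) !sum4.
rewrite -!/(e _).
have : 0 <= (e j0 + e j2 - e j1 - e j3) ^+ 2 by rewrite sqr_ge0.
move: h0 h1 h2 h3; move: (e j0) (e j1) (e j2) (e j3) => x y z t.
by move: `|det j0| `|det j1| `|det j2| `|det j3| => p q r s' *; nra.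
Qed.

End FourPoints.

End Hulls.

(** * Convex position from the absence of hidden vertices *)

Section ConvexPosition.
Variable R : realType.
Implicit Types (p : pentagon R) (N x y z A B C D : plane R) (k l : 'I_5).

Lemma orient_line A B z : A != B -> orient A B z = 0 -> exists t, z = ray A (B - A) t.
Proof.
move=> AB oz; pose n : plane R := (- (B - A).2, (B - A).1).
have d0 : crs (B - A) n != 0.
  have -> : crs (B - A) n = dot (B - A) (B - A) by rewrite /crs /dot /n /=; ring.
  by rewrite dot_eq0 subr_eq0 eq_sym.
by have [t [e _]] := orient_on_line d0 oz; exists t.
Qed.

Lemma collinear_between A B C : orient A B C = 0 ->
  [\/ segment B C A, segment A C B | segment A B C].
Proof.
move=> oABC; have [->|AB] := eqVneq A B; first by apply: Or31; exact: segment_endl.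
have [t e] := orient_line AB oABC.
have [t0|t0] := leP 0 t; have [t1|t1] := leP t 1.
- by apply: Or33; exists t => //; rewrite t0.
- have tn := lt0r_neq0 (lt_trans ltr01 t1).
  apply: Or32; exists t^-1; first by rewrite invr_ge0 t0 invf_le1 ?ltW // (lt_trans ltr01).
  by apply: pairE; rewrite /= e /ray /=; field.
- apply: Or31; exists (1 / (1 - t)).
    have h : 0 < 1 - t by lra.
    by rewrite divr_ge0 ?(ltW h) //= ler_pdivrMr // mul1r; lra.
  have h : 1 - t != 0 by apply/eqP; lra.
  by apply: pairE; rewrite /= e /ray /=; field.
- by exfalso; lra.
Qed.

Lemma segment_in_tri A B C x : segment A B x -> in_tri A B C x.
Proof.
move=> [t /andP[t0 t1] ->]; exists (1 - t), t, 0; split; rewrite ?subr_ge0 // ?subrK ?addr0 //.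
by apply: pairE => /=; ring.
Qed.

(** Radon's argument. If [C] and [D] were on opposite sides of [A B], their coefficients in the
    affine dependency would have equal signs; then either one of [A], [B] lies in the triangle of
    the other points, or the segments [A B] and [C D] meet. *)
Lemma quad_side A B C D : ~ in_tri B C D A -> ~ in_tri A C D B ->
  ~ in_tri A B D C -> ~ in_tri A B C D ->
  (forall x, segment A B x -> segment C D x -> False) ->
  0 < orient A B C * orient A B D.
Proof.
move=> nA nB nC nD cr.
have c1 : orient B C D != 0.
  apply/eqP => /collinear_between[] h.
  - by apply: nB; apply/in_tri_swap12/in_tri_swap23/segment_in_tri.
  - by apply: nC; apply/in_tri_swap12/in_tri_swap23/segment_in_tri.
  - by apply: nD; apply/in_tri_swap12/in_tri_swap23/segment_in_tri.
have c2 : orient A C D != 0.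
  apply/eqP => /collinear_between[] h.
  - by apply: nA; apply/in_tri_swap12/in_tri_swap23/segment_in_tri.
  - by apply: nC; apply/in_tri_swap23/segment_in_tri.
  - by apply: nD; apply/in_tri_swap23/segment_in_tri.
have c3 : orient A B D != 0.
  apply/eqP => /collinear_between[] h.
  - by apply: nA; apply/in_tri_swap23/segment_in_tri.
  - by apply: nB; apply/in_tri_swap23/segment_in_tri.
  - by apply: nD; apply/segment_in_tri.
have c4 : orient A B C != 0.
  apply/eqP => /collinear_between[] h.
  - by apply: nA; apply/segment_in_tri.
  - by apply: nB; apply/segment_in_tri.
  - by apply: nC; apply/segment_in_tri.
have sumE : orient B C D - orient A C D + orient A B D - orient A B C = 0.
  by rewrite /orient /crs /=; ring.
have dep1 : orient B C D * A.1 - orient A C D * B.1 + orient A B D * C.1 - orient A B C * D.1 = 0.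
  by rewrite /orient /crs /=; ring.
have dep2 : orient B C D * A.2 - orient A C D * B.2 + orient A B D * C.2 - orient A B C * D.2 = 0.
  by rewrite /orient /crs /=; ring.
have main (a b c d : R) : a != 0 -> b != 0 -> 0 < c -> 0 < d -> a + b + c + d = 0 ->
    a * A.1 + b * B.1 + c * C.1 + d * D.1 = 0 ->
    a * A.2 + b * B.2 + c * C.2 + d * D.2 = 0 -> False.
  move=> a0 b0 cp dp s e1 e2.
  have [ap|an] := ltP 0 a.
    have bn : 0 < - b by lra.
    apply: nB; exists (a / - b), (c / - b), (d / - b).
    split; rewrite ?divr_ge0 ?(ltW ap) ?(ltW cp) ?(ltW dp) ?(ltW bn) //.
      by rewrite -!mulrDl (_ : a + c + d = - b) ?divff ?oppr_eq0 //; lra.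
    apply: pairE => /=; apply: (mulfI (lt0r_neq0 bn)).
      transitivity (a * A.1 + c * C.1 + d * D.1); first by lra.
      by field.
    transitivity (a * A.2 + c * C.2 + d * D.2); first by lra.
    by field.
  have {}an : 0 < - a by rewrite oppr_gt0 lt_neqAle a0.
  have [bp|bn] := ltP 0 b.
    apply: nA; exists (b / - a), (c / - a), (d / - a).
    split; rewrite ?divr_ge0 ?(ltW an) ?(ltW cp) ?(ltW dp) ?(ltW bp) //.
      by rewrite -!mulrDl (_ : b + c + d = - a) ?divff ?oppr_eq0 //; lra.
    apply: pairE => /=; apply: (mulfI (lt0r_neq0 an)).
      transitivity (b * B.1 + c * C.1 + d * D.1); first by lra.
      by field.
    transitivity (b * B.2 + c * C.2 + d * D.2); first by lra.
    by field.
  have {}bn : 0 < - b by rewrite oppr_gt0 lt_neqAle b0.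
  have cd : 0 < c + d by rewrite addr_gt0.
  have cd0 := lt0r_neq0 cd.
  have dcd : 0 <= d / (c + d) <= 1.
    by rewrite divr_ge0 ?(ltW dp) ?(ltW cd) //= ler_pdivrMr // mul1r; lra.
  have bcd : 0 <= - b / (c + d) <= 1.
    by rewrite divr_ge0 ?(ltW bn) ?(ltW cd) //= ler_pdivrMr // mul1r; lra.
  apply: (cr (C.1 + d / (c + d) * (D - C).1, C.2 + d / (c + d) * (D - C).2)); last first.
    by exists (d / (c + d)).
  exists (- b / (c + d)) => //.
  apply: pairE => /=; apply: (mulfI cd0).
    transitivity (c * C.1 + d * D.1); first by field.
    transitivity (- a * A.1 - b * B.1); first by lra.
    have -> : - a = c + d + b by lra.
    by field.
  transitivity (c * C.2 + d * D.2); first by field.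
  transitivity (- a * A.2 - b * B.2); first by lra.
  have -> : - a = c + d + b by lra.
  by field.
rewrite lt_neqAle eq_sym mulf_neq0 //= leNgt; apply/negP => neg.
have [c4p|c4n] := ltP 0 (orient A B C).
  have c3n : 0 < - orient A B D by rewrite oppr_gt0; move: neg; rewrite pmulr_rlt0.
  apply: (@main (- orient B C D) (orient A C D) (- orient A B D) (orient A B C)) => //;
    rewrite ?oppr_eq0 //; lra.
have {}c4n : 0 < - orient A B C by rewrite oppr_gt0 lt_neqAle c4.
have c3p : 0 < orient A B D by move: neg; rewrite nmulr_rlt0 // -oppr_gt0.
apply: (@main (orient B C D) (- orient A C D) (orient A B D) (- orient A B C)) => //;
  rewrite ?oppr_eq0 //; lra.
Qed.

Definition rev (v : 'I_5 -> plane R) i := v (- i).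

(** The side on which the other vertices lie is the same for all [k], because sides [k] and [k + 1]
    share the triple [k, k + 1, k + 2]. *)
Lemma same_side_ccw v : (forall k i j, i != k -> i != k + 1 -> j != k -> j != k + 1 ->
  0 < orient (v k) (v (k + 1)) (v i) * orient (v k) (v (k + 1)) (v j)) -> ccw v \/ ccw (rev v).
Proof.
move=> same.
have ne (a b : 'I_5) k : a != b -> k + a != k + b by rewrite (inj_eq (addrI k)).
have ne0 (a : 'I_5) k : a != 0 -> k + a != k by rewrite -{2}(addr0 k) (inj_eq (addrI k)).
pose f k j := orient (v k) (v (k + 1)) (v (k + j)).
have s23 k : 0 < f k 2 * f k 3 by apply: same; rewrite ?ne0 ?ne.
have s34 k : 0 < f k 3 * f k 4 by apply: same; rewrite ?ne0 ?ne.
have s42 k : f k 2 = f (k + 1) 4.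
  have e1 : k + 1 + 1 = k + 2 by rewrite -addrA; congr (_ + _); exact: val_inj.
  have e2 : k + 1 + 4 = k by rewrite -addrA -[RHS]addr0; congr (_ + _); exact: val_inj.
  by rewrite /f orient_rot e1 e2.
have tr (a b c : R) : 0 < a * b -> 0 < b * c -> 0 < a * c.
  move=> ab bc; have b0 : b != 0 by apply/eqP => b0; rewrite b0 mulr0 ltxx in ab.
  have : 0 < (a * c) * b ^+ 2.
    by have -> : (a * c) * b ^+ 2 = (a * b) * (b * c) by [ring]; rewrite mulr_gt0.
  by rewrite pmulr_lgt0 // lt_def sqrf_eq0 b0 sqr_ge0.
have s24 k : 0 < f k 2 * f k 4 := tr _ _ _ (s23 k) (s34 k).
have succ k : 0 < f k 2 * f (k + 1) 2 by rewrite s42 mulrC; exact: s24.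
have [s0 s1 s2 s3 _] := succ5.
have all2 k : 0 < f i0 2 * f k 2.
  have h0 : 0 < f i0 2 * f i0 2.
    have : f i0 2 != 0 by apply/eqP => e; have := s23 i0; rewrite e mul0r ltxx.
    by move=> e; rewrite -expr2 lt_def sqrf_eq0 e sqr_ge0.
  have h1 := tr _ _ _ h0 (succ i0); rewrite s0 in h1.
  have h2 := tr _ _ _ h1 (succ i1); rewrite s1 in h2.
  have h3 := tr _ _ _ h2 (succ i2); rewrite s2 in h3.
  have h4 := tr _ _ _ h3 (succ i3); rewrite s3 in h4.
  by have [->|[->|[->|[->|->]]]] := I5P k.
have all k j : j != k -> j != k + 1 -> 0 < f i0 2 * orient (v k) (v (k + 1)) (v j).
  move=> jk jk1; have [[e|e]|->|->|->] := I5_shiftP k j.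
  - by rewrite e eqxx in jk.
  - by rewrite e eqxx in jk1.
  - exact: all2.
  - exact: tr (all2 k) (s23 k).
  - exact: tr (all2 k) (s24 k).
have [pos|neg] := ltP 0 (f i0 2).
  by left => k j jk jk1; have := all k j jk jk1; rewrite pmulr_rgt0.
right=> k j jk jk1; rewrite /rev.
have f0 : f i0 2 < 0.
  rewrite lt_neqAle neg andbT; apply/eqP => e; have := all2 i0.
  by rewrite e mul0r ltxx.
have e : - (k + 1) + 1 = - k by rewrite opprD subrK.
have := all (- (k + 1)) (- j); rewrite e !(inj_eq oppr_inj) => h.
by have := h jk1 jk; rewrite nmulr_rgt0 // (orient_swap (v (- (k + 1)))) oppr_lt0.
Qed.

(** Sides without a common vertex do not meet, so by [quad_side] the ends of each lie on one side of
    the line of the other. This links [k + 2] to [k + 3] and [k + 3] to [k + 4]. *)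
Lemma unhidden_ccw p : (forall k, ~ hidden p k) -> ccw p \/ ccw (rev p).
Proof.
move=> nh.
have nt k j1 j2 j3 : j1 != k -> j2 != k -> j3 != k -> ~ in_tri (p j1) (p j2) (p j3) (p k).
  move=> h1 h2 h3 h; apply: (nh k); exists (p j1), (p j2), (p j3).
  by split => //; apply: mem_others.
have [simple_inj simple] := vertex_simple p.
have step k j : j != k -> j != k + 1 -> j + 1 != k ->
    0 < orient (p k) (p (k + 1)) (p j) * orient (p k) (p (k + 1)) (p (j + 1)).
  move=> jk jk1 j1k; have [kk1 _ k1k _ _] := neqS5 k; have [jj1 _ j1j _ _] := neqS5 j.
  have j1k1 : j + 1 != k + 1 by rewrite (inj_eq (addIr 1)).
  apply: quad_side; try (apply: nt; rewrite // eq_sym //).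
  move=> x xk xj; have kj : k != j by rewrite eq_sym.
  have [[e _]|[e _]] := simple k j x kj xk xj; first by rewrite e eqxx in jk1.
  by rewrite e eqxx in j1k.
apply: same_side_ccw => k i j ik ik1 jk jk1.
have tr (a b c : R) : 0 < a * b -> 0 < b * c -> 0 < a * c.
  move=> ab bc; have b0 : b != 0 by apply/eqP => b0; rewrite b0 mulr0 ltxx in ab.
  have : 0 < (a * c) * b ^+ 2.
    by have -> : (a * c) * b ^+ 2 = (a * b) * (b * c) by [ring]; rewrite mulr_gt0.
  by rewrite pmulr_lgt0 // lt_def sqrf_eq0 b0 sqr_ge0.
have ne (a b : 'I_5) : a != b -> k + a != k + b by rewrite (inj_eq (addrI k)).
have ne0 (a : 'I_5) : a != 0 -> k + a != k by rewrite -{2}(addr0 k) (inj_eq (addrI k)).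
have e3 : k + 2 + 1 = k + 3 by rewrite -addrA; congr (_ + _); exact: val_inj.
have e4 : k + 3 + 1 = k + 4 by rewrite -addrA; congr (_ + _); exact: val_inj.
have s23 : 0 < orient (p k) (p (k + 1)) (p (k + 2)) * orient (p k) (p (k + 1)) (p (k + 3)).
  by have := step k (k + 2); rewrite e3; apply; rewrite ?ne0 ?ne.
have s34 : 0 < orient (p k) (p (k + 1)) (p (k + 3)) * orient (p k) (p (k + 1)) (p (k + 4)).
  by have := step k (k + 3); rewrite e4; apply; rewrite ?ne0 ?ne.
have mid (m : 'I_5) : m != k -> m != k + 1 ->
    0 < orient (p k) (p (k + 1)) (p m) * orient (p k) (p (k + 1)) (p (k + 3)).
  move=> mk mk1; have [[e|e]|->|->|->] := I5_shiftP k m => //.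
  - by rewrite e eqxx in mk.
  - by rewrite e eqxx in mk1.
  - by apply: (tr _ _ _ s34); rewrite mulrC; exact: s34.
  - by rewrite mulrC.
by apply: tr (mid i ik ik1) _; rewrite mulrC; exact: mid.
Qed.

Lemma small_perimeter_unhidden p : area p = 1%E -> perimeter p < 4 -> forall k, ~ hidden p k.
Proof.
move=> a1 per k hk.
pose P (i : 'I_4) := p (k + 1 + (inord i : 'I_5)).
have PE : [/\ P 0 = p (k + 1), P 1 = p (k + 2), P 2 = p (k + 3) & P 3 = p (k + 4)].
  by split; rewrite /P -addrA; congr (p (k + _)); apply: val_inj; rewrite /= inordK.
have [P0 P1 P2 P3] := PE.
have sub : region p `<=` fun x => exists u v w : 'I_4, in_tri (P u) (P v) (P w) x.
  move=> x /(region_hidden hk)[u [v [w [hu hv hw h]]]].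
  have idx y : y \in others p k -> exists i, y = P i.
    rewrite /others /= !inE => /or4P[] /eqP->; [exists 0|exists 1|exists 2|exists 3] => //.
  have [a ea] := idx _ hu; have [b eb] := idx _ hv; have [c ec] := idx _ hw.
  by exists a, b, c; rewrite -ea -eb -ec.
have := hull4_perimeter sub; have -> : ((@lebesgue_measure R) \x (@lebesgue_measure R))%E (region p) = 1%E by [].
rewrite lee_fin; set L := \sum_i _ => hL.
have L0 : 0 <= L by apply: sumr_ge0 => i _; exact: edist_ge0.
have LE : L = edist (p (k + 1)) (p (k + 2)) + edist (p (k + 2)) (p (k + 3)) +
    edist (p (k + 3)) (p (k + 4)) + edist (p (k + 4)) (p (k + 1)).
  rewrite -P0 -P1 -P2 -P3 /L !big_ord_recl big_ord0 addr0 !addrA.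
  by congr (edist (P _) (P _) + edist (P _) (P _) + edist (P _) (P _) + edist (P _) (P _));
    apply: val_inj.
have Lp : L <= perimeter p.
  rewrite perimeterE -(plength_shift p k) /plength sum5.
  have s1 : 1 = i1 by apply: val_inj; rewrite /= !inordK.
  have s2 : 2 = i2 by apply: val_inj; rewrite /= !inordK.
  have s3 : 3 = i3 by apply: val_inj; rewrite /= !inordK.
  have s4 : 4 = i4 by apply: val_inj; rewrite /= !inordK.
  have z : k + i0 = k by apply: val_inj; rewrite /= inordK // addn0 modn_small.
  have [e0 e1 e2 e3 e4] := succ5; rewrite e0 e1 e2 e3 e4 z.
  rewrite LE -s1 -s2 -s3 -s4.
  by have := edist_tri (p (k + 4)) (p k) (p (k + 1)); lra.
by move: hL Lp L0 per; move: (perimeter p) => q; nra.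
Qed.

End ConvexPosition.

(** * Region and area of a convex pentagon *)

Section ConvexRegion.
Variable R : realType.
Implicit Types (p : pentagon R) (N x y z A B C : plane R) (k l : 'I_5).
Implicit Types v : 'I_5 -> plane R.

(** A counterclockwise listing of the vertices of a convex pentagon; the reversed alternative serves
    pentagons given in clockwise order. *)
Definition traces p v := ccw v /\ ((forall i, v i = p i) \/ (forall i, v i = p (- i))).

Definition cpoly v : set (plane R) := [set y | forall k, 0 <= orient (v k) (v (k + 1)) y].
Definition opoly v : set (plane R) := [set y | forall k, 0 < orient (v k) (v (k + 1)) y].

Lemma traces_outline p v z : traces p v ->
  outline p z <-> exists k, segment (v k) (v (k + 1)) z.
Proof.
move=> [_ [e|e]]; split.
- by move=> [k _ h]; exists k; rewrite !e.
- by move=> [k h]; exists k => //; rewrite /side -!e.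
- move=> [k _ h]; exists (- (k + 1)); have -> : - (k + 1) + 1 = - k by rewrite opprD subrK.
  by rewrite !e !opprK; apply: segment_sym.
- move=> [k h]; exists (- (k + 1)) => //; rewrite /side.
  have -> : - (k + 1) + 1 = - k by rewrite opprD subrK.
  by rewrite -!e; apply: segment_sym.
Qed.

Lemma traces_vertex p v : traces p v ->
  (forall k, exists j, v k = p j) /\ (forall k, exists j, p k = v j).
Proof.
move=> [_ [e|e]]; split => k; try by exists k; rewrite e.
- by exists (- k); rewrite e.
- by exists (- k); rewrite e opprK.
Qed.

Lemma ccw_orient_ge0 v k j : ccw v -> 0 <= orient (v k) (v (k + 1)) (v j).
Proof.
move=> cv; have [->|jk] := eqVneq j k; first by rewrite orient1.
have [->|jk1] := eqVneq j (k + 1); first by rewrite orient2.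
exact/ltW/cv.
Qed.

Lemma cpoly_segment v k x : ccw v -> cpoly v x -> orient (v k) (v (k + 1)) x = 0 ->
  segment (v k) (v (k + 1)) x.
Proof.
move=> cv cx o0.
have AB : v k != v (k + 1) by rewrite eq_sym -subr_eq0 ccw_neq.
have [t e] := orient_line AB o0; exists t => //.
have [n1 n2 n3 n4 n5] := neqS5 k.
apply/andP; split.
  have := cx (k - 1); rewrite subrK.
  have -> : orient (v (k - 1)) (v k) x = t * orient (v k) (v (k + 1)) (v (k - 1)).
    by rewrite e /ray /orient /crs /=; ring.
  by rewrite pmulr_lge0 //; exact: cv.
have := cx (k + 1).
have -> : orient (v (k + 1)) (v (k + 1 + 1)) x =
   (1 - t) * orient (v (k + 1)) (v (k + 1 + 1)) (v k).
  by rewrite e /ray /orient /crs /=; ring.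
have [m1 m2 m3 m4 m5] := neqS5 (k + 1).
rewrite pmulr_lge0 ?subr_ge0 //; apply: cv => //.
by rewrite addrK in m5.
Qed.

Lemma orient_sum A B C z : orient A B C = orient B C z + orient C A z + orient A B z.
Proof. by rewrite /orient /crs /=; ring. Qed.

Lemma in_tri_orient A B C z : 0 < orient A B C -> 0 <= orient A B z ->
  0 <= orient B C z -> 0 <= orient C A z -> in_tri A B C z.
Proof.
move=> o0 h1 h2 h3; have n0 := lt0r_neq0 o0.
exists (orient B C z / orient A B C), (orient C A z / orient A B C), (orient A B z / orient A B C).
split; rewrite ?divr_ge0 ?(ltW o0) //; first by rewrite -!mulrDl -orient_sum divff.
have e1 : orient A B C * z.1 = orient B C z * A.1 + orient C A z * B.1 + orient A B z * C.1.
  by rewrite /orient /crs /=; ring.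
have e2 : orient A B C * z.2 = orient B C z * A.2 + orient C A z * B.2 + orient A B z * C.2.
  by rewrite /orient /crs /=; ring.
by apply: pairE; apply: (mulfI n0) => /=; rewrite ?e1 ?e2; field.
Qed.

Definition fan v : seq (plane R * plane R * plane R) :=
  [:: (v i0, v i1, v i2); (v i0, v i2, v i3); (v i0, v i3, v i4)].

Lemma cpoly_fan v y : ccw v -> cpoly v y -> exists2 t, t \in fan v & in_tri t.1.1 t.1.2 t.2 y.
Proof.
move=> cv cy; have [s0 s1 s2 s3 s4] := succ5.
have [[t1 t2 t3 _ _] _] := ccw_triples cv.
have c0 := cy i0; have c1 := cy i1; have c2 := cy i2; have c3 := cy i3; have c4 := cy i4.
rewrite s0 in c0; rewrite s1 in c1; rewrite s2 in c2; rewrite s3 in c3; rewrite s4 in c4.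
have [h2|h2] := leP (orient (v i0) (v i2) y) 0.
  exists (v i0, v i1, v i2); first by rewrite inE eqxx.
  by apply: in_tri_orient => //=; rewrite orient_swap oppr_ge0.
have [h3|h3] := leP (orient (v i0) (v i3) y) 0.
  exists (v i0, v i2, v i3); first by rewrite !inE eqxx orbT.
  by apply: in_tri_orient => //=; rewrite ?(ltW h2) // orient_swap oppr_ge0.
exists (v i0, v i3, v i4); first by rewrite !inE eqxx !orbT.
by apply: in_tri_orient => //=; exact: ltW.
Qed.

Lemma in_tri_norm A B C y (M : R) : in_tri A B C y ->
  (forall z, z \in [:: A; B; C] -> `|z.1| <= M /\ `|z.2| <= M) -> `|y.1| <= M /\ `|y.2| <= M.
Proof.
move=> [a [b [c [a0 b0 c0 s ->]]]] H.
have [A1 A2] := H A (mem_head _ _).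
have [B1 B2] : `|B.1| <= M /\ `|B.2| <= M by apply: H; rewrite !inE eqxx orbT.
have [C1 C2] : `|C.1| <= M /\ `|C.2| <= M by apply: H; rewrite !inE eqxx !orbT.
have h (f g e : R) : `|f| <= M -> `|g| <= M -> `|e| <= M -> `|a * f + b * g + c * e| <= M.
  move=> hf hg he; have -> : M = a * M + b * M + c * M by rewrite -!mulrDl s mul1r.
  apply: le_trans (ler_normD _ _) _; apply: lerD; first apply: le_trans (ler_normD _ _) _.
    by apply: lerD; rewrite normrM ger0_norm // ler_wpM2l.
  by rewrite normrM ger0_norm // ler_wpM2l.
by split; apply: h.
Qed.

(** Membership in [opoly] is locally constant off the outline, because a point of [cpoly] outside
    [opoly] lies on a side. So the component of [x] remains in the bounded set [opoly]. *)
Lemma opoly_inside p v : traces p v -> opoly v `<=` inside p.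
Proof.
move=> tr x ox; have cv := tr.1.
have nout y : opoly v y -> ~ outline p y.
  move=> oy /(traces_outline _ tr)[k] /segment_orient e.
  by have := oy k; rewrite e ltxx.
split; first exact: nout.
set K := connected_component _ _.
have nf y : cpoly v y -> ~ outline p y -> opoly v y.
  move=> cy ny k; rewrite lt_neqAle cy andbT eq_sym; apply/eqP => e; apply: ny.
  by apply/(traces_outline _ tr); exists k; exact: cpoly_segment.
have oO y : opoly v y -> \forall z \near y, opoly v z.
  by move=> oy; apply: near_forall => k; apply: near_gt; [exact: continuous_orient|exact: oy].
have KO y : K y -> opoly v y.
  move=> Ky; have : `[< opoly v y >] = `[< opoly v x >].
    apply: (@connected_locally_constant _ (~` outline p) K (fun y => `[< opoly v y >])) => //.
    - move=> z nz; have [oz|noz] := pselect (opoly v z).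
        have h := oO z oz; near=> w; have ow : opoly v w by near: w.
        by split; [exact: nout|rewrite !(asboolT ow) asboolT].
      have [k neg] : exists k, orient (v k) (v (k + 1)) z < 0.
        apply/not_existsP => h; apply: noz; apply: nf => // k.
        by rewrite leNgt; apply/negP => /h.
      have h := near_lt (@continuous_orient _ (v k) (v (k + 1))) neg.
      near=> w; have nw : orient (v k) (v (k + 1)) w < 0 by near: w.
      split; first by near: w; exact: near_not_outline.
      rewrite !asboolF // => ow; have := ow k; first by rewrite ltNge (ltW nw).
    - exact: connected_component_sub.
    - exact: component_connected.
    - by apply: connected_component_refl; exact: nout.
  by rewrite (asboolT ox) => /asboolP.
have [M M0 HM] := outline_norm p.
have HMv k : `|(v k).1| <= M /\ `|(v k).2| <= M.
  by apply: HM; apply/(traces_outline _ tr); exists k; exact: segment_endl.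
exists M; split; first exact: num_real.
move=> M' MM' y /KO oy /=.
have cy : cpoly v y by move=> k; exact/ltW/oy.
have [t tf ty] := cpoly_fan cv cy.
have [y1 y2] : `|y.1| <= M /\ `|y.2| <= M.
  apply: (in_tri_norm ty) => z; move: tf; rewrite !inE.
  by move=> /or3P[] /eqP-> /= /or3P[] /eqP->; exact: HMv.
by apply: le_trans (ltW MM'); rewrite prod_normE ge_max y1 y2.
Unshelve. all: by end_near. Qed.

Lemma region_cpoly p v : traces p v -> region p `<=` cpoly v.
Proof.
move=> tr x rx k; rewrite leNgt; apply/negP => neg.
have [_ ver] := traces_vertex tr.
pose n : plane R := (- (v (k + 1) - v k).2, (v (k + 1) - v k).1).
apply: (@region_separated R p x n _ rx) => l; have [j ->] := ver l.
have -> : dot n (v j - x) = orient (v k) (v (k + 1)) (v j) - orient (v k) (v (k + 1)) x.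
  by rewrite /dot /orient /crs /n /=; ring.
by rewrite subr_gt0; apply: lt_le_trans neg _; exact: ccw_orient_ge0 tr.1.
Qed.

Lemma area_le_shoelace p v : traces p v -> (area p <= (shoelace v / 2)%:E)%E.
Proof.
move=> tr; have [[t1 t2 t3 _ _] _] := ccw_triples tr.1.
apply: (@le_trans _ _ (\sum_(t <- fan v) `|orient t.1.1 t.1.2 t.2| / 2)%:E).
  by apply: area_cover => x /(region_cpoly tr) cx; exact: cpoly_fan tr.1 cx.
rewrite /fan !big_cons big_nil /= !gtr0_norm // addr0 addrA -!mulrDl.
by rewrite -shoelace_fan.
Qed.

Lemma orient_mix A B C P Q z : orient A B C * orient P Q z =
  orient B C z * orient P Q A + orient C A z * orient P Q B + orient A B z * orient P Q C.
Proof. by rewrite /orient /crs /=; ring. Qed.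

(** A side has at most two of the three vertices as ends, so in the barycentric expansion of
    [orient] along it one term is positive and none is negative. *)
Lemma open_tri_opoly v i j l : ccw v -> i != j -> i != l -> j != l ->
  0 < orient (v i) (v j) (v l) -> open_tri (v i) (v j) (v l) `<=` opoly v.
Proof.
move=> cv ij il jl o0 z []; rewrite !pmulr_rgt0 // => z1 z2 z3 k.
rewrite -(pmulr_rgt0 _ o0) orient_mix.
have g m := @ccw_orient_ge0 v k m cv.
have [ki|ki] := boolP ((i != k) && (i != k + 1)).
  move/andP: ki => [a b]; apply: ltr_wpDr; first by rewrite mulr_ge0 // ltW.
  by apply: ltr_wpDr; [rewrite mulr_ge0 // ltW|rewrite mulr_gt0 // cv].
have [kj|kj] := boolP ((j != k) && (j != k + 1)).
  move/andP: kj => [a b]; apply: ltr_wpDr; first by rewrite mulr_ge0 // ltW.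
  by apply: ltr_wpDl; [rewrite mulr_ge0 // ltW|rewrite mulr_gt0 // cv].
have kl : (l != k) && (l != k + 1).
  move: ki kj; rewrite !negb_and !negbK => /orP[]/eqP ei /orP[]/eqP ej; subst => //.
  - by rewrite eqxx in ij.
  - by rewrite ![l == _]eq_sym il jl.
  - by rewrite ![l == _]eq_sym il jl.
  - by rewrite eqxx in ij.
move/andP: kl => [a b]; apply: ltr_wpDl; last by rewrite mulr_gt0 // cv.
by rewrite addr_ge0 // mulr_ge0 // ltW.
Qed.

(** Bounds the shoelace sum of a unit-area Cairo or Prismatic pentagon from above by 2, and with it
    the perimeter. *)
Lemma area_ge_shoelace p v : traces p v -> ((shoelace v / 2)%:E <= area p)%E.
Proof.
move=> tr; have [[t1 t2 t3 _ _] _] := ccw_triples tr.1.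
have [[n01 n02 n03 n04 n12] [n13 n14 n23 n24 n34]] := neq5.
set T1 := open_tri (v i0) (v i1) (v i2); set T2 := open_tri (v i0) (v i2) (v i3).
set T3 := open_tri (v i0) (v i3) (v i4).
have mT A B C : measurable (open_tri A B C) by exact: measurable_open_tri.
have sub : (T1 `|` T2) `|` T3 `<=` region p.
  move=> z h; right; apply: (opoly_inside tr); move: z h.
  by move=> z [[]|]; apply: open_tri_opoly => //; exact: tr.1.
have d12 : T1 `&` T2 = set0.
  rewrite -subset0 => z [[_ _ h1] [h2 _ _]]; move: h1 h2; rewrite !pmulr_rgt0 //.
  by rewrite orient_swap oppr_gt0 => a b; have := lt_trans a b; rewrite ltxx.
have d3 : (T1 `|` T2) `&` T3 = set0.
  rewrite -subset0 => z [[[h1 h2 h3]|[_ _ h1]] [h4 _ _]].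
    move: h1 h2 h3 h4; rewrite !pmulr_rgt0 // => h1 h2 h3 h4.
    have := orient_mix (v i0) (v i1) (v i2) (v i0) (v i3) z.
    rewrite orient1 mulr0 add0r.
    have : orient (v i0) (v i3) (v i1) < 0.
      by rewrite orient_swap23 oppr_lt0; have [[_ _ _ + _] _] := ccw_triples tr.1.
    have : orient (v i0) (v i3) (v i2) < 0 by rewrite orient_swap23 oppr_lt0.
    have : 0 < orient (v i0) (v i1) (v i2) * orient (v i0) (v i3) z by rewrite mulr_gt0.
    by move=> a b c e; move: a; rewrite e ltNge -oppr_ge0 opprD -!mulrN
      addr_ge0 // mulr_ge0 ?oppr_ge0 ?ltW.
  move: h1 h4; rewrite !pmulr_rgt0 //.
  by rewrite orient_swap oppr_gt0 => a b; have := lt_trans a b; rewrite ltxx.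
apply: le_trans (mu2_le sub).
have m12 : measurable (T1 `|` T2) by apply: measurableU; exact: mT.
have mT1 : measurable T1 := mT _ _ _.
have mT2 : measurable T2 := mT _ _ _.
have mT3 : measurable T3 := mT _ _ _.
have eU := measureU (lebesgue_measure \x lebesgue_measure)%E m12 mT3 d3.
rewrite (measureU (lebesgue_measure \x lebesgue_measure)%E mT1 mT2 d12) in eU.
rewrite [leRHS]eU.
rewrite shoelace_fan.
have -> : forall a b c : R, (a + b + c) / 2 = a / 2 + b / 2 + c / 2 by move=> *; rewrite !mulrDl.
rewrite !EFinD; apply: leeD; first apply: leeD.
- by have := mu2_open_tri_ge (lt0r_neq0 t1); rewrite gtr0_norm.
- by have := mu2_open_tri_ge (lt0r_neq0 t2); rewrite gtr0_norm.
- by have := mu2_open_tri_ge (lt0r_neq0 t3); rewrite gtr0_norm.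
Qed.

End ConvexRegion.

(** * Sign patterns of turns *)

Section TurnSigns.
Variable R : realType.

(** [c] and [s] are cosine and sine of turns by [pi / 2] or [pi / 3], and [x], [y] those of the
    partial sums. The unsigned turns add up to [2 pi]; reversing one changes the total to [pi] or
    [4 pi / 3] up to sign, whose cosine is not 1, so the directions do not close up. *)
Lemma single_odd_turn (q c0 c1 c2 c3 c4 s0 s1 s2 s3 s4 x1 y1 x2 y2 x3 y3 : R) :
  0 < q -> q * q = 3 ->
  (c0 = 0 /\ s0 = 1) \/ (c0 = 1 / 2 /\ s0 = q / 2) ->
  (c1 = 0 /\ s1 = - 1) \/ (c1 = 1 / 2 /\ s1 = - q / 2) ->
  (c2 = 0 /\ s2 = - 1) \/ (c2 = 1 / 2 /\ s2 = - q / 2) ->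
  (c3 = 0 /\ s3 = - 1) \/ (c3 = 1 / 2 /\ s3 = - q / 2) ->
  (c4 = 0 /\ s4 = - 1) \/ (c4 = 1 / 2 /\ s4 = - q / 2) ->
  c0 + c1 + c2 + c3 + c4 = 3 / 2 ->
  x1 = c0 * c1 - s0 * s1 -> y1 = s0 * c1 + c0 * s1 ->
  x2 = x1 * c2 - y1 * s2 -> y2 = y1 * c2 + x1 * s2 ->
  x3 = x2 * c3 - y2 * s3 -> y3 = y2 * c3 + x2 * s3 ->
  x3 * c4 - y3 * s4 = 1 -> False.
Proof.
move=> q0 qq h0 h1 h2 h3 h4 sc ex1 ey1 ex2 ey2 ex3 ey3 e.
case: h0 => -[e0 e0']; case: h1 => -[e1 e1']; rewrite e0 e0' e1 e1' in sc ex1 ey1;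
  case: h2 => -[e2 e2']; rewrite e2 e2' in sc ex2 ey2;
  case: h3 => -[e3 e3']; rewrite e3 e3' in sc ex3 ey3;
  case: h4 => -[e4 e4']; rewrite e4 e4' in sc e; try lra;
  rewrite ex1 ey1 in ex2 ey2; rewrite ex2 ey2 in ex3 ey3; rewrite ex3 ey3 in e;
  have q3 : q * (q * q) = 3 * q by [rewrite qq mulrC];
  have q4 : (q * q) * (q * q) = 9 by [rewrite qq; ring];
  by lra.
Qed.

(** Around a 5-cycle the number of sign changes is even. The first exclusion rules out changes on
    two disjoint edges, which leaves none, or two on adjacent edges; the latter isolate a single
    sign, the second exclusion. *)
Lemma constant_signs (s : 'I_5 -> R) : (forall k, s k != 0) ->
  (forall m, s (m - 1) * s m < 0 -> s (m + 1) * s (m + 2) < 0 -> False) ->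
  (forall j, s j * s (j + 1) < 0 -> s j * s (j + 2) < 0 -> s j * s (j + 3) < 0 ->
     s j * s (j + 4) < 0 -> False) ->
  (forall k, 0 < s k) \/ (forall k, s k < 0).
Proof.
move=> n0 h1 h2; pose b k := 0 < s k.
have sg k l : b k != b l -> s k * s l < 0.
  have nk := n0 k; have nl := n0 l; rewrite /b.
  have [pk|pk] := ltP 0 (s k); have [pl|pl] := ltP 0 (s l) => // _.
    by rewrite pmulr_rlt0 // lt_neqAle nl.
  by rewrite pmulr_llt0 // lt_neqAle nk.
have g1 m : b (m - 1) != b m -> b (m + 1) != b (m + 2) -> False.
  by move=> u w; exact: h1 (sg _ _ u) (sg _ _ w).
have g2 j : b j != b (j + 1) -> b j != b (j + 2) -> b j != b (j + 3) -> b j != b (j + 4) -> False.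
  by move=> u w x y; exact: h2 (sg _ _ u) (sg _ _ w) (sg _ _ x) (sg _ _ y).
have [s0 s1 s2 s3 s4] := succ5; have [p0 p1 p2 p3 p4] := pred5.
have a2 k : k + 2 = k + 1 + 1 by rewrite -addrA.
have a3 k : k + 3 = k + 1 + 1 + 1 by rewrite -!addrA.
have a4 k : k + 4 = k + 1 + 1 + 1 + 1 by rewrite -!addrA.
have g1' m : ~~ ((b (m - 1) != b m) && (b (m + 1) != b (m + 2))).
  by apply/negP => /andP[] /g1.
have g2' j : ~~ [&& b j != b (j + 1), b j != b (j + 2), b j != b (j + 3) & b j != b (j + 4)].
  by apply/negP => /and4P[] /g2.
have key : forall x0 x1 x2 x3 x4 : bool,
  ~~ ((x4 != x0) && (x1 != x2)) -> ~~ ((x0 != x1) && (x2 != x3)) ->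
  ~~ ((x1 != x2) && (x3 != x4)) -> ~~ ((x2 != x3) && (x4 != x0)) ->
  ~~ ((x3 != x4) && (x0 != x1)) ->
  ~~ [&& x0 != x1, x0 != x2, x0 != x3 & x0 != x4] ->
  ~~ [&& x1 != x2, x1 != x3, x1 != x4 & x1 != x0] ->
  ~~ [&& x2 != x3, x2 != x4, x2 != x0 & x2 != x1] ->
  ~~ [&& x3 != x4, x3 != x0, x3 != x1 & x3 != x2] ->
  ~~ [&& x4 != x0, x4 != x1, x4 != x2 & x4 != x3] ->
  x1 = x0 /\ x2 = x0 /\ x3 = x0 /\ x4 = x0 by do 5 case.
have all : b i1 = b i0 /\ b i2 = b i0 /\ b i3 = b i0 /\ b i4 = b i0.
  have := g1' i0; have := g1' i1; have := g1' i2; have := g1' i3; have := g1' i4.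
  have := g2' i0; have := g2' i1; have := g2' i2; have := g2' i3; have := g2' i4.
  rewrite !a4 !a3 !a2 !(s0, s1, s2, s3, s4) !(p0, p1, p2, p3, p4).
  by move=> A1 A2 A3 A4 A5 B1 B2 B3 B4 B5; apply: key.
have [e1 [e2 [e3 e4]]] := all.
have bk k : b k = b i0 by have [->|[->|[->|[->|->]]]] := I5P k.
case b0 : (b i0); [left|right] => k; have := bk k; rewrite b0 /b //.
by move/negbT; rewrite -leNgt lt_neqAle n0.
Qed.

End TurnSigns.

(** * Perimeters of Cairo and Prismatic pentagons *)

Section Tangential.
Variable R : realType.
Implicit Types (p : pentagon R) (x y : plane R) (k l : 'I_5).
Implicit Types v : 'I_5 -> plane R.

Lemma rev_ccw v : (forall k j, j != k -> j != k + 1 -> orient (v k) (v (k + 1)) (v j) < 0) ->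
  ccw (rev v).
Proof.
move=> h k j jk jk1; rewrite /rev orient_swap oppr_gt0.
have e : - (k + 1) + 1 = - k by rewrite opprD subrK.
by have := h (- (k + 1)) (- j); rewrite e !(inj_eq oppr_inj); apply.
Qed.

Lemma plength_rev v : plength (rev v) = plength v.
Proof.
rewrite /plength [RHS](reindex_inj (inj_comp oppr_inj (addIr 1))) /=.
apply: eq_bigr => k _; rewrite /rev edistC; congr (edist _ (v _)).
by rewrite opprD subrK.
Qed.

Lemma traces_plength p v : traces p v -> plength v = perimeter p.
Proof.
case=> _ [e|e]; rewrite perimeterE.
  by apply: eq_bigr => k _; rewrite !e.
by rewrite -(plength_rev p); apply: eq_bigr => k _; rewrite /rev !e.
Qed.

Lemma dot_turn (a u b : plane R) : dot u u = 1 ->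
  dot a b = dot a u * dot u b - crs a u * crs u b.
Proof. by move=> h; rewrite -[LHS]mulr1 -h /dot /crs; ring. Qed.

Lemma crs_turn (a u b : plane R) : dot u u = 1 ->
  crs a b = crs a u * dot u b + dot a u * crs u b.
Proof. by move=> h; rewrite -[LHS]mulr1 -h /dot /crs; ring. Qed.

Section Turns.
Variable p : pentagon R.
Variable b : pred 'I_5.
Hypothesis angles : forall k, interior_angle p k = if b k then pi / 2 else 2 * pi / 3.
(** Counts exactly two right angles, through the cosines of the turns, without placing them; this
    treats Cairo and Prismatic pentagons together. *)
Hypothesis two_right : \sum_k (if b k then 0 else 1 / 2) = 3 / 2 :> R.

Let d k := dir p k.
Let len k := edist (p k) (p (k + 1)).
Let c k : R := if b k then 0 else 1 / 2.
Let s k := crs (d (k - 1)) (d k).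

Let len_gt0 k : 0 < len k.
Proof. by rewrite elength_gt0 // vertexS_neq. Qed.

Let d1 k : dot (d k) (d k) = 1.
Proof. by apply: direction_norm; have [] := neqS5 k. Qed.

Let edgeE k : p (k + 1) - p k = (len k * (d k).1, len k * (d k).2).
Proof.
have l0 := lt0r_neq0 (len_gt0 k).
by apply: pairE; rewrite /d /dir /direction /= -/(len k); field.
Qed.

Let turn_dot k : dot (d (k - 1)) (d k) = c k.
Proof.
have ap : interior_angle p k < pi.
  by rewrite angles; have := pi_gt0 R; case: ifP; lra.
have := interior_angle_cos ap erefl.
have -> : direction (p k) (p (k - 1)) = - d (k - 1).
  rewrite /d /dir subrK /direction (edistC (p k)).
  by apply: pairE => /=; rewrite -mulNr opprB.
have -> : dot (direction (p k) (p (k + 1))) (- d (k - 1)) = - dot (d (k - 1)) (d k).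
  by rewrite /d /dir /dot /=; ring.
by rewrite angles /c; case: ifP => _; rewrite ?cos_pihalf ?cos_2pi3; lra.
Qed.

Let norm_turn k : c k ^+ 2 + s k ^+ 2 = 1.
Proof.
rewrite -turn_dot /s.
have := dot_turn (d (k - 1)) (d (k - 1)) (d1 k).
by rewrite d1 (dotC (d k)) (crsC (d k)) => e; rewrite [RHS]e; ring.
Qed.

Let s0 k : s k != 0.
Proof.
apply/eqP => e; have := norm_turn k; rewrite e /c; case: ifP => _; lra.
Qed.

Let c_ge0 k : 0 <= c k. Proof. by rewrite /c; case: ifP => _; lra. Qed.

Let edge_sum : \sum_k len k * (d k).1 = 0 /\ \sum_k len k * (d k).2 = 0.
Proof.
have z (f : 'I_5 -> R) : \sum_k (f (k + 1) - f k) = 0.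
  rewrite sumrB [X in _ - X](reindex_inj (addIr 1)) /= subrr //.
split.
  by rewrite -[RHS](z (fun k => (p k).1)); apply: eq_bigr => k _; have /(congr1 fst) /= := edgeE k.
by rewrite -[RHS](z (fun k => (p k).2)); apply: eq_bigr => k _; have /(congr1 snd) /= := edgeE k.
Qed.

(** Under these sign changes every side direction has a nonnegative product with [d m], and [d m]
    itself a positive one, although the side vectors add up to zero. *)
Let no_distant_changes m : s (m - 1) * s m < 0 -> s (m + 1) * s (m + 2) < 0 -> False.
Proof.
move=> h1 h2.
have [e1 e2] := edge_sum.
have tot : \sum_k len k * dot (d m) (d k) = 0.
  transitivity ((d m).1 * (\sum_k len k * (d k).1) + (d m).2 * (\sum_k len k * (d k).2)).
    by rewrite !sum5 /dot; ring.
  by rewrite e1 e2 !mulr0 addr0.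
have pos k : 0 <= dot (d m) (d k).
  have e : m + 2 = m + 1 + 1 by rewrite -addrA.
  have [[->|->]|->|->|->] := I5_shiftP m k.
  - by rewrite d1.
  - by have := turn_dot (m + 1); rewrite addrK => ->.
  - have t1 := turn_dot (m + 1); have t2 := turn_dot (m + 2).
    rewrite (dot_turn _ _ (d1 (m + 1))).
    rewrite addrK in t1; rewrite [in m + 2 - 1]e addrK in t2.
    move: h2; rewrite /s addrK [in m + 2 - 1]e addrK t1 t2 => h2.
    by rewrite addr_ge0 // ?mulr_ge0 // oppr_ge0 ltW.
  - have e3 : m + 3 = m - 1 - 1 by rewrite -!addrA; congr (_ + _); exact: val_inj.
    have t1 := turn_dot m; have t2 := turn_dot (m - 1).
    rewrite dotC e3 (dot_turn _ _ (d1 (m - 1))) t1 t2.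
    by rewrite addr_ge0 // ?mulr_ge0 // oppr_ge0 ltW.
  - have e4 : m + 4 = m - 1 by congr (_ + _); exact: val_inj.
    by rewrite e4 dotC turn_dot.
have : 0 < \sum_k len k * dot (d m) (d k).
  rewrite (bigD1 m) //= d1 mulr1 ltr_wpDr // sumr_ge0 // => k _.
  by rewrite mulr_ge0 // ltW.
by rewrite tot ltxx.
Qed.

Let turn_value (e : R) k : (e = 1 \/ e = - 1) -> 0 < e * s k ->
  (c k = 0 /\ e * s k = 1) \/ (c k = 1 / 2 /\ e * s k = Num.sqrt 3 / 2).
Proof.
move=> he ps; have := norm_turn k.
have -> : s k ^+ 2 = (e * s k) ^+ 2 by case: he => ->; ring.
move: (e * s k) ps => t t0.
have q0 : 0 < Num.sqrt 3 :> R by rewrite sqrtr_gt0; lra.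
have qq : Num.sqrt 3 ^+ 2 = 3 :> R by rewrite sqr_sqrtr //; lra.
rewrite /c; case: ifP => _ h; [left|right]; split => //.
  by apply/eqP; rewrite -(eqrXn2 (n := 2)) ?ler01 ?ltW //; apply/eqP; lra.
apply/eqP; rewrite -(eqrXn2 (n := 2)) ?divr_ge0 ?ltW //.
by apply/eqP; rewrite expr_div_n qq; lra.
Qed.

Let no_single_odd j : s j * s (j + 1) < 0 -> s j * s (j + 2) < 0 ->
  s j * s (j + 3) < 0 -> s j * s (j + 4) < 0 -> False.
Proof.
move=> h1 h2 h3 h4.
(* Reflects the picture if necessary, so that the exceptional turn becomes positive. *)
pose e : R := if 0 < s j then 1 else - 1.
have he : e = 1 \/ e = - 1 by rewrite /e; case: ifP; [left|right].
have ej : 0 < e * s j.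
  rewrite /e; have [sj|sj] := ltP 0 (s j); first by rewrite mul1r.
  by rewrite mulN1r oppr_gt0 lt_neqAle s0.
have hn : - e = 1 \/ - e = - 1 by case: he => ->; [right|left]; lra.
have en k : s j * s k < 0 -> 0 < - e * s k.
  move=> h; have : 0 < (e * s j) * (- e * s k).
    have -> : e * s j * (- e * s k) = - (e ^+ 2 * (s j * s k)) by ring.
    by case: he => ->; rewrite ?sqrrN expr1n mul1r oppr_gt0.
  by rewrite pmulr_rgt0.
have q0 : 0 < Num.sqrt 3 :> R by rewrite sqrtr_gt0; lra.
have qq : Num.sqrt 3 * Num.sqrt 3 = 3 :> R by rewrite -expr2 sqr_sqrtr //; lra.
have neg k : s j * s k < 0 ->
    (c k = 0 /\ e * s k = - 1) \/ (c k = 1 / 2 /\ e * s k = - Num.sqrt 3 / 2).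
  by move=> /en /(turn_value hn); rewrite !mulNr => -[[-> h]|[-> h]]; [left|right]; split => //; lra.
have a1 : j + 2 - 1 = j + 1 by rewrite -addrA; congr (_ + _); exact: val_inj.
have a2 : j + 3 - 1 = j + 2 by rewrite -addrA; congr (_ + _); exact: val_inj.
have a3 : j + 4 - 1 = j + 3 by rewrite -addrA; congr (_ + _); exact: val_inj.
have a4 : j + 4 = j - 1 by congr (_ + _); exact: val_inj.
have t1 := turn_dot (j + 1); rewrite addrK in t1.
have t2 := turn_dot (j + 2); rewrite a1 in t2.
have t3 := turn_dot (j + 3); rewrite a2 in t3.
have t4 := turn_dot (j + 4); rewrite a3 in t4.
have u1 : s (j + 1) = crs (d j) (d (j + 1)) by rewrite /s addrK.
have u2 : s (j + 2) = crs (d (j + 1)) (d (j + 2)) by rewrite /s a1.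
have u3 : s (j + 3) = crs (d (j + 2)) (d (j + 3)) by rewrite /s a2.
have u4 : s (j + 4) = crs (d (j + 3)) (d (j + 4)) by rewrite /s a3.
have ee (x y : R) : (e * x) * (e * y) = x * y by case: he => ->; ring.
pose X k := dot (d (j - 1)) (d k); pose Y k := e * crs (d (j - 1)) (d k).
have sum : c j + c (j + 1) + c (j + 2) + c (j + 3) + c (j + 4) = 3 / 2.
  rewrite -[RHS]two_right (reindex_inj (addrI j)) /= sum5 -/(c _).
  have s1 : 1 = i1 by apply: val_inj; rewrite /= !inordK.
  have s2 : 2 = i2 by apply: val_inj; rewrite /= !inordK.
  have s3 : 3 = i3 by apply: val_inj; rewrite /= !inordK.
  have s4 : 4 = i4 by apply: val_inj; rewrite /= !inordK.
  have z : j + i0 = j by apply: val_inj; rewrite /= inordK // addn0 modn_small.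
  by rewrite -s1 -s2 -s3 -s4 z.
have X1 := dot_turn (d (j - 1)) (d (j + 1)) (d1 j).
have Y1 := crs_turn (d (j - 1)) (d (j + 1)) (d1 j).
have X2 := dot_turn (d (j - 1)) (d (j + 2)) (d1 (j + 1)).
have Y2 := crs_turn (d (j - 1)) (d (j + 2)) (d1 (j + 1)).
have X3 := dot_turn (d (j - 1)) (d (j + 3)) (d1 (j + 2)).
have Y3 := crs_turn (d (j - 1)) (d (j + 3)) (d1 (j + 2)).
have X4 := dot_turn (d (j - 1)) (d (j + 4)) (d1 (j + 3)).
rewrite {1}a4 d1 in X4.
apply: (@single_odd_turn R (Num.sqrt 3) (c j) (c (j + 1)) (c (j + 2)) (c (j + 3)) (c (j + 4))
  (e * s j) (e * s (j + 1)) (e * s (j + 2)) (e * s (j + 3)) (e * s (j + 4))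
  (X (j + 1)) (Y (j + 1)) (X (j + 2)) (Y (j + 2)) (X (j + 3)) (Y (j + 3))
  q0 qq (turn_value he ej) (neg _ h1) (neg _ h2) (neg _ h3) (neg _ h4) sum).
- by rewrite ee /X X1 turn_dot t1 -u1.
- by rewrite /Y Y1 turn_dot t1 -u1 /s; ring.
- by rewrite ee /X X2 t2 -u2.
- by rewrite /Y Y2 t2 -u2 /X; ring.
- by rewrite ee /X X3 t3 -u3.
- by rewrite /Y Y3 t3 -u3 /X; ring.
- by rewrite ee /X [RHS]X4 t4 -u4.
Qed.

(** The angles fix only the cosines of the turns. Once all turns have one sign, acute or right turns
    put every vertex on one side of each side line. The cotangents are two times 1 and three times
    [1 / sqrt 3]. *)
Lemma tangential_traces : exists v, [/\ traces p v &
  \sum_k hcot (corner_angle v k) = 2 + Num.sqrt 3].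
Proof.
have q0 : 0 < Num.sqrt 3 :> R by rewrite sqrtr_gt0; lra.
have qq : Num.sqrt 3 ^+ 2 = 3 :> R by rewrite sqr_sqrtr //; lra.
have orientE (e : R) : (forall k, 0 < e * s k) ->
    forall k j, j != k -> j != k + 1 -> 0 < e * orient (p k) (p (k + 1)) (p j).
  move=> es k j jk jk1.
  have e2 : k + 2 = k + 1 + 1 by rewrite -addrA.
  have O2 m : orient (p m) (p (m + 1)) (p (m + 1 + 1)) = len m * len (m + 1) * s (m + 1).
    have -> : orient (p m) (p (m + 1)) (p (m + 1 + 1)) =
      crs (p (m + 1) - p m) (p (m + 1 + 1) - p (m + 1)) by rewrite /orient /crs /=; ring.
    by rewrite !edgeE /s addrK /crs /=; ring.
  have [[jj|jj]|->|->|->] := I5_shiftP k j.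
  - by rewrite jj eqxx in jk.
  - by rewrite jj eqxx in jk1.
  - rewrite e2 O2 mulrCA; do 2 apply: mulr_gt0 => //.
  - have e3 : k + 3 = k + 1 + 1 + 1 by rewrite -!addrA.
    have -> : orient (p k) (p (k + 1)) (p (k + 3)) =
      crs (p (k + 1) - p k) (p (k + 1 + 1) - p (k + 1)) +
      crs (p (k + 1) - p k) (p (k + 1 + 1 + 1) - p (k + 1 + 1)).
      by rewrite e3 /orient /crs /=; ring.
    rewrite !edgeE.
    have -> : crs (len k * (d k).1, len k * (d k).2)
     (len (k + 1) * (d (k + 1)).1, len (k + 1) * (d (k + 1)).2) =
       len k * len (k + 1) * s (k + 1) by rewrite /s addrK /crs /=; ring.
    have -> : crs (len k * (d k).1, len k * (d k).2)
     (len (k + 1 + 1) * (d (k + 1 + 1)).1, len (k + 1 + 1) * (d (k + 1 + 1)).2) =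
       len k * len (k + 1 + 1) * crs (d k) (d (k + 1 + 1)) by rewrite /crs /=; ring.
    have -> : crs (d k) (d (k + 1 + 1)) = s (k + 1) * c (k + 1 + 1) + c (k + 1) * s (k + 1 + 1).
      rewrite (crs_turn _ _ (d1 (k + 1))) -!turn_dot /s !addrK //.
    set l0 := len k; set l1 := len (k + 1); set l2 := len (k + 1 + 1).
    have -> : e * (l0 * l1 * s (k + 1) + l0 * l2 * (s (k + 1) * c (k + 1 + 1) + c (k + 1) * s (k + 1 + 1)))
      = l0 * l1 * (e * s (k + 1)) + l0 * l2 * ((e * s (k + 1)) * c (k + 1 + 1) + c (k + 1) * (e * s (k + 1 + 1))) by ring.
    have [L0 L1 L2] : [/\ 0 < l0, 0 < l1 & 0 < l2] by split; exact: len_gt0.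
    have A : 0 < l0 * l1 * (e * s (k + 1)) by apply: mulr_gt0 => //; exact: mulr_gt0.
    apply: lt_le_trans A _; rewrite lerDl.
    apply: mulr_ge0; first by apply: mulr_ge0; apply: ltW.
    by apply: addr_ge0; apply: mulr_ge0 => //; apply: ltW.
  - have e4 : k + 4 = k - 1 by congr (_ + _); exact: val_inj.
    rewrite e4 orient_rot orient_rot; have := O2 (k - 1); rewrite subrK => ->.
    by rewrite mulrCA; do 2 apply: mulr_gt0 => //.
have sumf : \sum_k (if b k then 1 else (Num.sqrt 3)^-1) = 2 + Num.sqrt 3 :> R.
  have qi : (Num.sqrt 3)^-1 = Num.sqrt 3 / 3 :> R.
    by apply: (mulfI (lt0r_neq0 q0)); rewrite divff ?lt0r_neq0 // mulrA -expr2 qq divff //; lra.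
  transitivity (\sum_k (1 - (2 - 2 * Num.sqrt 3 / 3) * (if b k then 0 else 1 / 2)) : R).
    by apply: eq_bigr => k _; case: ifP => _; rewrite ?qi; lra.
  rewrite sumrB -mulr_sumr two_right sum5; lra.
have hv v k j : ccw v -> dot (dir v (k - 1)) (dir v k) = c j ->
    hcot (corner_angle v k) = if b j then 1 else (Num.sqrt 3)^-1.
  move=> cv dd; rewrite -dir_hcot // dd.
  have pos := dir_crs_gt0 cv k.
  have nn : dot (dir v (k - 1)) (dir v k) ^+ 2 + crs (dir v (k - 1)) (dir v k) ^+ 2 = 1.
    by rewrite -[RHS](mulr1 1) -{1}(dir_norm cv (k - 1)) -(dir_norm cv k) /dot /crs; ring.
  rewrite dd in nn; move: nn pos; move: (crs _ _) => t; rewrite /c; case: ifP => _ nn t0.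
    have -> : t = 1 by apply/eqP; rewrite -(eqrXn2 (n := 2)) ?ler01 ?ltW //; apply/eqP; lra.
    by rewrite subr0 divr1.
  have -> : t = Num.sqrt 3 / 2.
    apply/eqP; rewrite -(eqrXn2 (n := 2)) ?divr_ge0 ?ltW //.
    by apply/eqP; rewrite expr_div_n qq; lra.
  have := lt0r_neq0 q0; move: (Num.sqrt 3) => z z0; field; lra.
have [sp|sn] := constant_signs s0 no_distant_changes no_single_odd.
  have cv : ccw p.
    move=> k j jk jk1; rewrite -[orient _ _ _]mul1r; apply: orientE => // i.
    by rewrite mul1r.
  exists p; split; first by split => //; left.
  by rewrite -sumf; apply: eq_bigr => k _; apply: hv => //; exact: turn_dot.
have cv : ccw (rev p).
  apply: rev_ccw => k j jk jk1; rewrite -oppr_gt0 -mulN1r; apply: orientE => // i.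
  by rewrite mulN1r oppr_gt0.
exists (rev p); split; first by split => //; right.
rewrite -sumf [RHS](reindex_inj oppr_inj) /=.
apply: eq_bigr => k _; apply: hv => //.
have dr i : dir (rev p) i = - d (- i - 1).
  rewrite /dir /rev opprD /d /dir subrK /direction edistC.
  by apply: pairE => /=; rewrite -mulNr opprB.
rewrite !dr opprB addrAC subrr add0r -turn_dot dotC /dot /=; ring.
Qed.

End Turns.

(** The touching point bounds the distance of the side from [x] by [r] from above; the point of the
    disc farthest towards the side, lying in the convex region, bounds it from below. *)
Lemma disc_tangent p v x (r : R) : traces p v -> 0 < r ->
  [set y | edist x y <= r] `<=` region p ->
  (forall k, exists2 y, side p k y & edist x y = r) ->
  forall k, crs (v k - x) (dir v k) = r.
Proof.
move=> tr r0 sub touch k; have cv := tr.1.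
have dn := dir_norm cv k; have l0 := ccw_len cv k; have dr := dir_ray cv k.
set l := edist _ _ in l0 dr; set d := dir v k in dn dr *.
have on : forall y, orient (v k) (v (k + 1)) y = l * crs (v k - y) d.
  by move=> y; rewrite dr /ray /orient /crs /=; ring.
apply/eqP; rewrite eq_le; apply/andP; split.
  have [j ej] : exists j, forall y, side p j y -> segment (v k) (v (k + 1)) y.
    case: (tr) => _ [e|e]; first by exists k => y; rewrite !e.
    exists (- (k + 1)) => y; rewrite /side opprD subrK -opprD => h.
    by rewrite !e; exact: segment_sym.
  have [y /ej /segment_orient yk <-] := touch j.
  have -> : crs (v k - x) d = crs (y - x) d.
    move/eqP: yk; rewrite on mulf_eq0 (gt_eqF l0) /= => /eqP h.
    have -> : crs (v k - x) d = crs (v k - y) d + crs (y - x) d by rewrite /crs /=; ring.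
    by rewrite h add0r.
  apply: le_trans (ler_norm _) _; apply: le_trans (crs_le_elength _ _) _.
  by rewrite /edist {2}/elength dn sqrtr1 mulr1.
pose y : plane R := (x.1 + r * d.2, x.2 - r * d.1).
have /sub /(region_cpoly tr) /(_ k) : edist x y <= r.
  rewrite /edist /elength.
  have -> : dot (y - x) (y - x) = r ^+ 2 by rewrite -[RHS]mulr1 -dn /dot /y /=; ring.
  by rewrite sqrtr_sqr ger0_norm // ltW.
rewrite on pmulr_rge0 //.
have -> : crs (v k - y) d = crs (v k - x) d - r * dot d d by rewrite /crs /dot /y /=; ring.
by rewrite dn mulr1 subr_ge0.
Qed.

(** With [S] the shoelace sum and [C] the sum of cotangents, [p = 2 r C] and [S = r p] give
    [p^2 = 2 C S], and [S <= 2]. *)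
Lemma tangential_perimeter p (b : pred 'I_5) : circumscribed p -> area p = 1%E ->
  (forall k, interior_angle p k = if b k then pi / 2 else 2 * pi / 3) ->
  \sum_k (if b k then 0 else 1 / 2) = 3 / 2 :> R ->
  perimeter p ^+ 2 <= 4 * (2 + Num.sqrt 3).
Proof.
move=> [x [r [r0 sub touch]]] a1 ang two.
have [v [tr hc]] := tangential_traces ang two.
have [e1 e2] := circumscribed_measure tr.1 (disc_tangent tr r0 sub touch).
have := area_ge_shoelace tr; rewrite a1 lee_fin => S.
rewrite -(traces_plength tr) expr2 {1}e1 hc.
have -> : 2 * r * (2 + Num.sqrt 3) * plength v = 2 * (2 + Num.sqrt 3) * shoelace v.
  by rewrite e2; ring.
have := sqrtr_ge0 (3 : R); move: (Num.sqrt 3) (shoelace v) S => q S; nra.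
Qed.

Let two_sum (m k : 'I_5) : m = 1 \/ m = 2 ->
  \sum_i (if (i == k) || (i == k + m) then 0 else 1 / 2) = 3 / 2 :> R.
Proof.
move=> hm; rewrite (reindex_inj (addrI k)) /= !big_ord_recl big_ord0.
have e (i j : 'I_5) : (k + i == k + j) = (i == j) by rewrite (inj_eq (addrI k)).
have e0 (i : 'I_5) : (k + i == k) = (i == 0) by rewrite -{2}(addr0 k) e.
rewrite !e !e0; case: hm => ->; rewrite /eq_op /=; lra.
Qed.

Lemma cairo_perimeter p : cairo p -> area p = 1%E -> perimeter p ^+ 2 <= 4 * (2 + Num.sqrt 3).
Proof.
move=> [ci [k ang]] a1.
by apply: (@tangential_perimeter p (fun i => (i == k) || (i == k + 2))) => //; apply: two_sum; right.
Qed.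

Lemma prismatic_perimeter p : prismatic p -> area p = 1%E ->
  perimeter p ^+ 2 <= 4 * (2 + Num.sqrt 3).
Proof.
move=> [ci [k ang]] a1.
by apply: (@tangential_perimeter p (fun i => (i == k) || (i == k + 1))) => //; apply: two_sum; left.
Qed.

End Tangential.

(** * Excess of a corner over the chord, and the numerical contradiction *)

Section CornerExcess.
Variable R : realType.
Implicit Types (a : R) (p : pentagon R).

(** Minus the slope of the chord: [hcot] drops by [1 - 1 / sqrt 3] between angles [pi / 6] apart. *)
Definition chord_slope : R := 6 * (1 - (Num.sqrt 3)^-1) / pi.

(* [hcot] minus the chord of its graph through the angles [pi / 2] and
   [2 * pi / 3]; over the corners of a pentagon the chord sums to [2 + sqrt 3]. *)
Definition corner_excess a : R := hcot a - (1 + (pi / 2 - a) * chord_slope).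

(** With [k = chord_slope] and [c = 1 - 1 / sqrt 3], the tangents at the two ends of the chord cross
    below it at depth [(pi / 2) (k - 2 / 3) (1 - k) = 5 c - (18 c^2 / pi + pi / 3)]. This constant
    is an upper bound for that depth without [pi]. *)
Definition excess_floor : R := (1 - (Num.sqrt 3)^-1) * (5 - 2 * Num.sqrt 6).

Let q : R := Num.sqrt 3.
Let q0 : 0 < q. Proof. by rewrite sqrtr_gt0; lra. Qed.
Let qq : q * q = 3. Proof. by rewrite -expr2 sqr_sqrtr //; lra. Qed.
Let q_itv : 71 / 41 <= q <= 33 / 19.
Proof. by have := q0; have := qq; move: q => z zz z0; apply/andP; split; nra. Qed.
Let qi : q^-1 = q / 3.
Proof. by apply: (mulfI (lt0r_neq0 q0)); rewrite divff ?lt0r_neq0 // mulrA qq divff //; lra. Qed.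

Let hcot_right : hcot (pi / 2) = 1 :> R.
Proof. by rewrite /hcot cos_pihalf sin_pihalf; lra. Qed.

Let hcot_flat : hcot (2 * pi / 3) = q^-1.
Proof.
rewrite /hcot cos_2pi3 sin_2pi3 -/q.
by rewrite invf_div mulrA (_ : (1 - 1 / 2) * 2 = 1 :> R) ?mul1r //; lra.
Qed.

Let angles_itv : (0 < (pi : R) / 2 /\ (pi : R) / 2 < pi) /\ (0 < 2 * (pi : R) / 3 /\ 2 * (pi : R) / 3 < pi).
Proof. by have := pi_gt0 R; split; split; lra. Qed.

Let tangent_right a : 0 < a -> a < pi -> 1 - (a - pi / 2) <= hcot a.
Proof.
move=> a0 a1; have [[h1 h2] _] := angles_itv.
by have := @hcot_tangent R a _ (introT andP (conj a0 a1)) (introT andP (conj h1 h2)); rewrite hcot_right cos_pihalf subr0 divr1.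
Qed.

Let tangent_flat a : 0 < a -> a < pi -> q^-1 - (a - 2 * pi / 3) * (2 / 3) <= hcot a.
Proof.
move=> a0 a1; have [_ [h1 h2]] := angles_itv.
have := @hcot_tangent R a _ (introT andP (conj a0 a1)) (introT andP (conj h1 h2)); rewrite hcot_flat cos_2pi3.
have -> : 1 - - (1 / 2) = 3 / 2 :> R by lra.
by rewrite invf_div.
Qed.

Let slope_pi : chord_slope * pi = 6 * (1 - q^-1).
Proof. by rewrite /chord_slope divfK // lt0r_neq0 // pi_gt0. Qed.

(** By convexity the chord is less steep than the tangent at [pi / 2] and steeper than the one at
    [2 pi / 3]. Each bound is one tangent inequality taken at the other end of the chord. *)
Let slope_itv : 2 / 3 <= chord_slope <= 1.
Proof.
have [[h1 h2] [h3 h4]] := angles_itv; have p0 := pi_gt0 R.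
have t1 := tangent_right h3 h4; rewrite hcot_flat in t1.
have t2 := tangent_flat h1 h2; rewrite hcot_right in t2.
have e := slope_pi.
by rewrite -(ler_pM2r p0) -[in X in _ && X](ler_pM2r p0) e; apply/andP; split; lra.
Qed.

Lemma corner_excess_right a : 0 < a -> a < pi ->
  (pi / 2 - a) * (1 - chord_slope) <= corner_excess a.
Proof. by move=> a0 a1; have := tangent_right a0 a1; rewrite /corner_excess; lra. Qed.

Lemma corner_excess_flat a : 0 < a -> a < pi ->
  (a - 2 * pi / 3) * (chord_slope - 2 / 3) <= corner_excess a.
Proof.
move=> a0 a1; have := tangent_flat a0 a1; have := slope_pi; rewrite /corner_excess.
lra.
Qed.

Lemma corner_excess_floor a : 0 < a -> a < pi -> - excess_floor <= corner_excess a.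
Proof.
move=> a0 a1; have h1 := corner_excess_right a0 a1; have h2 := corner_excess_flat a0 a1.
have p0 := pi_gt0 R; have e := slope_pi; have /andP[s1 s2] := slope_itv.
(* The weights [chord_slope - 2 / 3] and [1 - chord_slope] eliminate [a] from the two tangent
   bounds; they add up to 1/3. *)
have h3 : - (pi / 2) * (chord_slope - 2 / 3) * (1 - chord_slope) <= corner_excess a.
  have w1 : 0 <= 1 - chord_slope by rewrite subr_ge0.
  have w2 : 0 <= chord_slope - 2 / 3 by rewrite subr_ge0.
  have g1 := ler_wpM2l w2 h1; have g2 := ler_wpM2l w1 h2.
  by move: (chord_slope) (corner_excess a) g1 g2 => k x; lra.
apply: le_trans h3.
(* AM-GM applied to [18 c^2 / pi] and [pi / 3], whose product is [6 c^2] *)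
have c0 : 0 <= 1 - q^-1 by rewrite qi; have /andP[] := q_itv; lra.
have r0 := sqrtr_ge0 (6 : R); have rr : Num.sqrt 6 ^+ 2 = 6 :> R by rewrite sqr_sqrtr //; lra.
rewrite -(ler_pM2r p0) /excess_floor -/q.
have -> : - (pi / 2) * (chord_slope - 2 / 3) * (1 - chord_slope) * pi =
  - (1 / 2) * (chord_slope * pi - 2 / 3 * pi) * (pi - chord_slope * pi) by ring.
rewrite e; move: (1 - q^-1 : R) (pi : R) (Num.sqrt 6 : R) c0 r0 rr => c P r c0 r0 rr.
have sq : 0 <= (6 * c - r * P / 3) ^+ 2 by exact: sqr_ge0.
have -> : - (c * (5 - 2 * r)) * P = - 5 * c * P + 2 * r * c * P by ring.
have -> : - (1 / 2) * (6 * c - 2 / 3 * P) * (P - 6 * c) = - 5 * c * P + 18 * c ^+ 2 + P ^+ 2 / 3 by field.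
have : (6 * c - r * P / 3) ^+ 2 = 36 * c ^+ 2 - 4 * r * c * P + r ^+ 2 * (P ^+ 2 / 9) by field.
by rewrite rr => e2; rewrite e2 in sq; lra.
Qed.

Lemma excess_floor_ge0 : 0 <= excess_floor.
Proof.
apply: mulr_ge0; first by rewrite -/q qi; have /andP[] := q_itv; lra.
have r0 := sqrtr_ge0 (6 : R); have rr : Num.sqrt 6 * Num.sqrt 6 = 6 :> R by rewrite -expr2 sqr_sqrtr //; lra.
by move: (Num.sqrt 6) r0 rr => r r0 rr; nra.
Qed.

(** [A] holds the efficient corners at a vertex and [m] counts the non-convex ones. For four or more
    efficient corners the tangents at [pi / 2] give a nonnegative total, since the mean angle is at
    most [pi / 2]. For at most three and [m = 0] those at [2 pi / 3] do, the mean being at least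
    [2 pi / 3]. Otherwise at most three corners lose [excess_floor] each. *)
Lemma vertex_excess (I : finType) (A : {set I}) (a : I -> R) (m : nat) :
  (forall i, i \in A -> 0 < a i < pi) -> \sum_(i in A) a i <= 2 * pi ->
  (m = 0%N -> 2 * pi <= \sum_(i in A) a i) ->
  - (3 * excess_floor) * m%:R <= \sum_(i in A) corner_excess (a i).
Proof.
move=> itv le2 ge2; have /andP[s1 s2] := slope_itv; have p0 := pi_gt0 R.
have f0 := excess_floor_ge0.
have neg : - (3 * excess_floor) * m%:R <= 0.
  by rewrite mulNr oppr_le0 mulr_ge0 // mulr_ge0.
have sumc (c : R) : \sum_(i in A) c = c * #|A|%:R by rewrite sumr_const mulr_natr.
have [d4|d3] := leqP 4 #|A|.
  apply: le_trans neg _.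
  apply: (@le_trans _ _ (\sum_(i in A) (pi / 2 - a i) * (1 - chord_slope))); last first.
    by apply: ler_sum => i /itv/andP[]; exact: corner_excess_right.
  rewrite -mulr_suml mulr_ge0 ?subr_ge0 // sumrB sumc.
  have : (4 : R) <= #|A|%:R by rewrite (ler_nat _ 4).
  by move: (#|A|%:R) (\sum_(i in A) a i) le2 => d s le2 d4'; nra.
have d3' : #|A|%:R <= 3 :> R by rewrite (ler_nat _ _ 3) -ltnS.
have [m0|m0] := posnP m.
  apply: le_trans neg _.
  apply: (@le_trans _ _ (\sum_(i in A) (a i - 2 * pi / 3) * (chord_slope - 2 / 3))); last first.
    by apply: ler_sum => i /itv/andP[]; exact: corner_excess_flat.
  rewrite -mulr_suml mulr_ge0 ?subr_ge0 // sumrB sumc.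
  have := ge2 m0.
  by move: (#|A|%:R) (\sum_(i in A) a i) d3' => d s d3' h; nra.
apply: (@le_trans _ _ (- excess_floor * #|A|%:R)).
  have m1 : 1 <= m%:R :> R by rewrite (ler_nat _ 1).
  by move: (m%:R) (#|A|%:R) m1 d3' => x y m1 d3'; nra.
by rewrite -sumc; apply: ler_sum => i /itv/andP[]; exact: corner_excess_floor.
Qed.

Lemma corner_excess_sum (v : 'I_5 -> plane R) : ccw v ->
  \sum_k corner_excess (corner_angle v k) =
  \sum_k hcot (corner_angle v k) - (2 + Num.sqrt 3).
Proof.
move=> cv; rewrite sumrB; congr (_ - _).
have e := corner_angle_sum cv.
transitivity (5 + (5 * (pi / 2) - \sum_k corner_angle v k) * chord_slope).
  by rewrite !sum5; ring.
rewrite e; have -> : 5 + (5 * (pi / 2) - 3 * pi) * chord_slope = 5 - 1 / 2 * (chord_slope * pi).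
  by field.
by rewrite slope_pi qi -/q; lra.
Qed.

Lemma efficient_traces p : efficient p -> exists v, traces p v.
Proof.
move=> [a1 [x [cx ax le]]].
have p4 : perimeter p < 4.
  have := cairo_perimeter cx ax; apply: contraTT; rewrite -!leNgt -ltNge => p4.
  have x4 := le_trans p4 le.
  have /andP[_ q2] := q_itv.
  by rewrite -/q; move: (perimeter x) q q2 x4 => y z z2 y4; nra.
by have [h|h] := unhidden_ccw (small_perimeter_unhidden a1 p4);
  [exists p; split => //; left|exists (rev p); split => //; right].
Qed.

Lemma efficient_perimeter_le p : efficient p -> 0 <= perimeter p /\
  perimeter p ^+ 2 <= 4 * (2 + Num.sqrt 3).
Proof.
move=> [a1 [x [cx ax le]]].
have h : 0 <= perimeter p by apply: sumr_ge0 => k _; exact: edist_ge0.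
split => //; apply: le_trans (cairo_perimeter cx ax).
by rewrite lerXn2r ?nnegrE //; exact: le_trans h le.
Qed.

Lemma perimeter_ge_hcot p (v : 'I_5 -> plane R) : traces p v -> area p = 1%E ->
  4 * (\sum_k hcot (corner_angle v k)) <= perimeter p ^+ 2.
Proof.
move=> tr a1; have := area_le_shoelace tr; rewrite a1 lee_fin => S.
have := lhuilier tr.1; rewrite (traces_plength tr).
have : 0 <= \sum_k hcot (corner_angle v k).
  apply: sumr_ge0 => k _; have itv := corner_itv tr.1 k.
  rewrite /hcot divr_ge0 //; last by rewrite ltW // sin_gt0_pi.
by move: (perimeter p) (shoelace v) (\sum_k _) S => x y z; nra.
Qed.

Let budget_root (W : R) : 0 <= W -> W * W = 4 * (2 + q) -> 27 / 7 <= W <= 58 / 15.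
Proof.
move=> W0 WW; have /andP[q1 q2] := q_itv.
apply/andP; split; rewrite leNgt; apply/negP => h.
  by have := ltr_pM W0 W0 h h; rewrite WW; move: q1; move: q => z; lra.
have c0 : 0 <= 58 / 15 :> R by lra.
by have := ltr_pM c0 c0 h h; rewrite WW; move: q2; move: q => z; lra.
Qed.

(** The fourth root of 432 is about 4.559 and [41 / 9] about 4.556. The root is taken in two stages,
    through [187 / 9], whose square is just below 432. *)
Let fourth_root (t : R) : 0 <= t -> 432 <= t ^+ 4 -> 41 / 9 <= t.
Proof.
move=> t0 t4.
have t2 : 187 / 9 <= t ^+ 2.
  rewrite leNgt; apply/negP => h; have s0 := sqr_ge0 t; have := ltr_pM s0 s0 h h.
  by rewrite -exprD; move: t4; move: (t ^+ 4); move=> w; lra.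
rewrite leNgt; apply/negP => h; have := ltr_pM t0 t0 h h; rewrite -expr2.
by move: t2; move: (t ^+ 2); move=> w; lra.
Qed.

(** [52 / 123] is [1 - 71 / 123], from [71 / 41 <= sqrt 3], and [3 / 29] is [5 - 142 / 29], from
    [71 / 29 <= sqrt 6]. *)
Let floor_le : excess_floor <= 52 / 123 * (3 / 29).
Proof.
have /andP[q1 q2] := q_itv.
have h0 : 0 <= 1 - q / 3 by move: q2; move: q => z; lra.
have h1 : 1 - q / 3 <= 52 / 123 by move: q1; move: q => z; lra.
have r1 : 71 / 29 <= Num.sqrt 6 :> R.
  rewrite leNgt; apply/negP => h.
  have r0 := sqrtr_ge0 (6 : R); have := ltr_pM r0 r0 h h.
  by rewrite -expr2 sqr_sqrtr //; lra.
have r2 : 0 <= 5 - 2 * Num.sqrt 6 :> R.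
  have := excess_floor_ge0; rewrite /excess_floor -/q qi; apply: contraTT; rewrite -!ltNge => r5.
  rewrite nmulr_llt0 //; move: q2; move: q => z; lra.
have r5 : 5 - 2 * Num.sqrt 6 <= 3 / 29 :> R by move: r1; move: (Num.sqrt 6) => r; lra.
by rewrite /excess_floor -/q qi; apply: ler_pM.
Qed.

Lemma perimeter_budget (x y pE pQ P C : R) : 0 < x -> 0 < y -> 0 <= pE -> 0 <= P ->
  P ^+ 2 <= 4 * (2 + Num.sqrt 3) -> pE ^+ 2 <= 4 * (2 + Num.sqrt 3) ->
  0 <= pQ -> 432 <= pQ ^+ 4 -> 4 * C <= pE ^+ 2 ->
  - (15 * excess_floor) * y <= x * (C - (2 + Num.sqrt 3)) ->
  x * pE + y * pQ <= (x + y) * P -> False.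
Proof.
move=> x0 y0 pE0 P0 hP hE pQ0 hQ hC hx hper.
pose W := Num.sqrt (4 * (2 + q)).
have WW : W * W = 4 * (2 + q) by rewrite -expr2 sqr_sqrtr //; have := q0; lra.
have W0 : 0 <= W by exact: sqrtr_ge0.
have /andP[W1 W2] := budget_root W0 WW; have pQ1 := fourth_root pQ0 hQ.
have le_W (t : R) : 0 <= t -> t ^+ 2 <= 4 * (2 + q) -> t <= W.
  move=> t0 ht; rewrite leNgt; apply/negP => h; have := ltr_pM W0 W0 h h.
  by rewrite WW -expr2 ltNge ht.
have PW := le_W _ P0 hP; have EW := le_W _ pE0 hE.
have s1 : y * (pQ - W) <= x * (W - pE).
  have : (x + y) * P <= (x + y) * W by rewrite ler_pM2l // addr_gt0.
  lra.
(* Enlarging the factor [W] to [W + pE] gives a difference of squares, which Lhuilier's bound and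
   the total excess control: [4 * 15 = 60]. *)
have s2 : x * (W - pE) * W <= 60 * excess_floor * y.
  have : x * (W - pE) * W <= x * (W - pE) * (W + pE).
    by rewrite ler_wpM2l ?lerDl // mulr_ge0 ?subr_ge0 // ltW.
  have -> : x * (W - pE) * (W + pE) = x * (W * W - pE ^+ 2) by ring.
  have : x * (W * W - pE ^+ 2) <= x * (4 * (2 + q) - 4 * C).
    by rewrite ler_wpM2l ?(ltW x0) // WW lerB.
  rewrite -/q in hx; lra.
have s3 : y * (pQ - W) * W <= x * (W - pE) * W by rewrite ler_wpM2r.
(* [31 / 45] is [41 / 9 - 58 / 15]. The product is about 2.657, while [s5] gives about 2.624. *)
have s4 : y * ((31 / 45) * (27 / 7)) <= y * (pQ - W) * W.
  rewrite -[leRHS]mulrA ler_wpM2l ?(ltW y0) //.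
  have d : 31 / 45 <= pQ - W by move: pQ1 W2; lra.
  by apply: ler_pM => //; lra.
have s5 : 60 * excess_floor * y <= 60 * (52 / 123 * (3 / 29)) * y.
  by rewrite ler_wpM2r ?(ltW y0) // ler_wpM2l // floor_le.
have := le_trans s4 (le_trans s3 (le_trans s2 s5)); move: y0; lra.
Qed.

End CornerExcess.

(** * Packings and coverings of directions by wedges *)

Section Wedges.
Variable R : realType.
Implicit Types (u w z : plane R) (theta alpha phi : R).

Definition owedge u w : set (plane R) := [set z | 0 < crs u z /\ 0 < crs z w].
Definition cwedge u w : set (plane R) := [set z | 0 <= crs u z /\ 0 <= crs z w].

Definition unit_vector phi : plane R := (cos phi, sin phi).

Let p0 : 0 < (pi : R). Proof. exact: pi_gt0. Qed.

Let cos_2pi : cos (2 * pi) = 1 :> R. Proof. by rewrite mulr_natl cos2pi. Qed.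
Let sin_2pi : sin (2 * pi) = 0 :> R. Proof. by rewrite mulr_natl sin2pi. Qed.
Let cos_mirror x : cos (2 * pi - x) = cos x :> R.
Proof. by rewrite cosB cos_2pi sin_2pi mul1r mul0r addr0. Qed.
Let sin_mirror x : sin (2 * pi - x) = - sin x :> R.
Proof. by rewrite sinB cos_2pi sin_2pi mul0r mul1r sub0r. Qed.

Lemma polar u : u != 0 -> exists theta, 0 <= theta < 2 * pi /\
  u = (elength u * cos theta, elength u * sin theta).
Proof.
move=> u0; have l0 : 0 < elength u by rewrite elength_gt0.
set c := u.1 / elength u; set s := u.2 / elength u.
have uE : u = (elength u * c, elength u * s).
  by apply: pairE; rewrite /= mulrC divfK // lt0r_neq0.
have cs : c ^+ 2 + s ^+ 2 = 1.
  rewrite !expr_div_n -mulrDl elength_sqr !expr2 divff //.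
  by rewrite dot_eq0.
have c1 : -1 <= c <= 1.
  have : c ^+ 2 <= 1 by have := sqr_ge0 s; lra.
  by move: c {uE cs} => t ht; apply/andP; split; nra.
have a0 := acos_ge0 c1; have ap := acos_lepi c1.
have ca : cos (acos c) = c by rewrite acosK // in_itv.
have sa : sin (acos c) = `|s|.
  by rewrite sin_acos // -sqrtr_sqr; congr Num.sqrt; lra.
have [s0|s0] := leP 0 s.
  exists (acos c); rewrite ca sa ger0_norm //; split => //.
  by rewrite a0 /=; apply: le_lt_trans ap _; rewrite ltr_pMl // ltr1n.
exists (2 * pi - acos c); split.
  have : 0 < acos c.
    rewrite lt_neqAle a0 andbT; apply/eqP => e; move: sa; rewrite -e sin0 => /esym/eqP.
    by rewrite normr_eq0 (lt_eqF s0).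
  by move=> ac; apply/andP; split; lra.
by rewrite cos_mirror sin_mirror ca sa ltr0_norm // opprK.
Qed.

Lemma wedge_polar u w : 0 < crs u w -> exists theta l m, [/\ 0 <= theta < 2 * pi, 0 < l, 0 < m &
  forall phi, crs u (unit_vector phi) = l * sin (phi - theta) /\
    crs (unit_vector phi) w = m * sin (theta + vang u w - phi)].
Proof.
move=> c0; have [u0 w0] := crs_neq0 (lt0r_neq0 c0).
have [theta [ti ue]] := polar u0.
have lu := elength_gt0 u0; have lw := elength_gt0 w0.
exists theta, (elength u), (elength w); split => // phi; split.
  by rewrite {1}ue /crs /unit_vector /= sinB; ring.
have hc : elength w * cos (vang u w) = cos theta * w.1 + sin theta * w.2.
  rewrite cos_vang // /vcos {1}ue /dot /=; field.
  by rewrite !lt0r_neq0.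
have hs : elength w * sin (vang u w) = cos theta * w.2 - sin theta * w.1.
  rewrite sin_vang // /vsin {1}ue /crs /=; field.
  by rewrite !lt0r_neq0.
rewrite sinB sinD cosD.
transitivity (cos phi * (cos theta * (elength w * sin (vang u w)) + sin theta * (elength w * cos (vang u w)))
  - sin phi * (cos theta * (elength w * cos (vang u w)) - sin theta * (elength w * sin (vang u w)))); last ring.
rewrite hc hs /crs /unit_vector /=; have := cos2Dsin2 theta => cs.
have -> : cos phi * w.2 - sin phi * w.1 =
  (cos theta ^+ 2 + sin theta ^+ 2) * (cos phi * w.2 - sin phi * w.1) by rewrite cs mul1r.
by ring.
Qed.

Notation lambda := (@lebesgue_measure R).

(** The open arc of directions modulo [2 pi], cut at [2 pi] and continued from 0 when it runs
    over. *)
Definition oarc theta alpha : set R :=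
  if theta + alpha <= 2 * pi then `]theta, theta + alpha[%classic
  else `]theta, 2 * pi[%classic `|` `[0, theta + alpha - 2 * pi[%classic.

(** The point 0 is added in the first case because an arc that ends exactly at [2 pi] contains
    direction 0. *)
Definition carc theta alpha : set R :=
  if theta + alpha <= 2 * pi then `[theta, theta + alpha]%classic `|` `[0, 0]%classic
  else `[theta, 2 * pi]%classic `|` `[0, theta + alpha - 2 * pi]%classic.

Let mItv (i : interval R) : measurable [set` i].
Proof. exact: measurable_itv. Qed.

Lemma measurable_oarc theta alpha : measurable (oarc theta alpha).
Proof. by rewrite /oarc; case: ifP => _; [|apply: measurableU]; exact: mItv. Qed.

Lemma measurable_carc theta alpha : measurable (carc theta alpha).
Proof. by rewrite /carc; case: ifP => _; apply: measurableU; exact: mItv. Qed.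

Let lambda_itv (b c : bool) (x y : R) : x <= y ->
  lambda [set` Interval (BSide b x) (BSide c y)] = (y - x)%:E.
Proof.
move=> xy; rewrite lebesgue_measure_itv /= lte_fin; case: ltgtP xy => // e _.
by rewrite e subrr.
Qed.

Lemma lambda_oarc theta alpha : 0 <= theta < 2 * pi -> 0 < alpha < pi ->
  lambda (oarc theta alpha) = alpha%:E.
Proof.
move=> /andP[t0 t1] /andP[a0 a1]; rewrite /oarc; case: (leP (theta + alpha) (2 * pi)) => h.
  by rewrite lambda_itv; [congr EFin; ring|lra].
have d : (`]theta, 2 * pi[%classic : set R) `&` `[0, theta + alpha - 2 * pi[%classic = set0.
  rewrite -subset0 => x [] /=; rewrite !in_itv /= => /andP[x1 x2] /andP[x3 x4].
  by exfalso; lra.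
have e := measureU lambda (mItv _) (mItv _) d.
have l1 := @lambda_itv false true theta (2 * pi) (ltW t1).
have l2 : lambda `[0, theta + alpha - 2 * pi[%classic = (theta + alpha - 2 * pi - 0)%:E.
  by apply: lambda_itv; lra.
apply: (etrans e); apply: (etrans (congr2 adde l1 l2)).
transitivity ((2 * pi - theta) + (theta + alpha - 2 * pi - 0))%:E => //.
by congr EFin; ring.
Qed.

Let lambda_U (A B : set R) (x y : R) : measurable A -> measurable B ->
  lambda A = x%:E -> lambda B = y%:E -> (lambda (A `|` B) <= (x + y)%:E)%E.
Proof.
move=> mA mB lA lB; apply: (@le_trans _ _ (lambda A + lambda B)%E); first exact: measureU2.
by rewrite lA lB.
Qed.

Lemma lambda_carc theta alpha : 0 <= theta < 2 * pi -> 0 < alpha < pi ->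
  (lambda (carc theta alpha) <= alpha%:E)%E.
Proof.
move=> /andP[t0 t1] /andP[a0 a1]; rewrite /carc; case: (leP (theta + alpha) (2 * pi)) => h.
  have l1 : lambda `[theta, theta + alpha]%classic = (theta + alpha - theta)%:E by apply: lambda_itv; lra.
  have l2 := @lambda_itv true false 0 0 (lexx _).
  by apply: le_trans (lambda_U (mItv _) (mItv _) l1 l2) _; rewrite lee_fin; lra.
have l1 := @lambda_itv true false theta (2 * pi) (ltW t1).
have l2 : lambda `[0, theta + alpha - 2 * pi]%classic = (theta + alpha - 2 * pi - 0)%:E.
  by apply: lambda_itv; lra.
by apply: le_trans (lambda_U (mItv _) (mItv _) l1 l2) _; rewrite lee_fin; lra.
Qed.

Let sin_shift x : sin (x + 2 * pi) = sin x :> R.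
Proof. by rewrite sinD cos_2pi sin_2pi mulr0 mulr1 addr0. Qed.

Lemma oarc_sin theta alpha phi : 0 <= theta < 2 * pi -> 0 < alpha < pi ->
  oarc theta alpha phi -> [/\ 0 <= phi < 2 * pi, 0 < sin (phi - theta) & 0 < sin (theta + alpha - phi)].
Proof.
move=> /andP[t0 t1] /andP[a0 a1]; rewrite /oarc; case: (leP (theta + alpha) (2 * pi)) => h.
  rewrite /= in_itv /= => /andP[h1 h2]; split; first by apply/andP; split; lra.
    by apply: sin_gt0_pi; apply/andP; split; lra.
  by apply: sin_gt0_pi; apply/andP; split; lra.
case=> /=; rewrite in_itv /= => /andP[h1 h2]; split; try (by apply/andP; split; lra);
  try (by apply: sin_gt0_pi; apply/andP; split; lra).
  by rewrite -sin_shift; apply: sin_gt0_pi; apply/andP; split; lra.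
rewrite -[theta + alpha - phi](subrK (2 * pi)) sin_shift.
by apply: sin_gt0_pi; apply/andP; split; lra.
Qed.

Let sin_ge0_itv (x : R) : - pi < x < 2 * pi -> 0 <= sin x -> 0 <= x <= pi.
Proof.
move=> /andP[x1 x2] sx; apply/andP; split; rewrite leNgt; apply/negP => h.
  have : 0 < sin (- x) by apply: sin_gt0_pi; apply/andP; split; lra.
  by rewrite sinN; lra.
have : 0 < sin (x - pi) by apply: sin_gt0_pi; apply/andP; split; lra.
by rewrite sinB sinpi cospi mulr0 subr0 mulrN1; lra.
Qed.

Lemma carc_sin theta alpha phi : 0 <= theta < 2 * pi -> 0 < alpha < pi -> 0 <= phi < 2 * pi ->
  0 <= sin (phi - theta) -> 0 <= sin (theta + alpha - phi) -> carc theta alpha phi.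
Proof.
move=> /andP[t0 t1] /andP[a0 a1] /andP[f0 f1] s1 s2.
have [h|h] := ltP (- pi) (phi - theta).
  have /andP[h1 h2] : 0 <= phi - theta <= pi by apply: sin_ge0_itv => //; apply/andP; split; lra.
  have /andP[h3 h4] : 0 <= theta + alpha - phi <= pi by apply: sin_ge0_itv => //; apply/andP; split; lra.
  by rewrite /carc; case: (leP (theta + alpha) (2 * pi)) => _; left; rewrite /= in_itv /=; apply/andP; split; lra.
have s2' : 0 <= sin (theta + alpha - phi - 2 * pi).
  by rewrite -sin_shift subrK.
have /andP[h3 h4] : 0 <= theta + alpha - phi - 2 * pi <= pi by apply: sin_ge0_itv => //; apply/andP; split; lra.
by rewrite /carc; case: (leP (theta + alpha) (2 * pi)) => hh; right; rewrite /= in_itv /=; apply/andP; split; lra.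
Qed.

(** Angles are turned into lengths of arcs in [[0, 2 pi]], so that additivity of the Lebesgue
    measure replaces any cyclic ordering of the wedges. *)
Lemma wedge_packing (I : eqType) (s : seq I) (u w : I -> plane R) : uniq s ->
  (forall i, i \in s -> 0 < crs (u i) (w i)) ->
  (forall i j z, i \in s -> j \in s -> i != j -> owedge (u i) (w i) z ->
     owedge (u j) (w j) z -> False) ->
  \sum_(i <- s) vang (u i) (w i) <= 2 * pi.
Proof.
move=> us pos disj.
have arcs i : i \in s -> exists S, [/\ measurable S, S `<=` `[0, 2 * pi]%classic,
    lambda S = (vang (u i) (w i))%:E & forall phi, S phi -> owedge (u i) (w i) (unit_vector phi)].
  move=> /pos c0; have [theta [l [m [ti l0 m0 H]]]] := wedge_polar c0.
  have ai : 0 < vang (u i) (w i) < pi by rewrite vang_gt0 ?vang_ltpi.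
  exists (oarc theta (vang (u i) (w i))); split.
  - exact: measurable_oarc.
  - by move=> phi /(oarc_sin ti ai)[/andP[f0 f1] _ _]; rewrite /= in_itv /= f0 ltW.
  - exact: lambda_oarc.
  - move=> phi /(oarc_sin ti ai)[_ s1 s2]; rewrite /owedge /=; have [-> ->] := H phi.
    by split; apply: mulr_gt0.
have [S [mS sS lS wS]] : exists S, [/\ measurable S, S `<=` `[0, 2 * pi]%classic,
    lambda S = (\sum_(i <- s) vang (u i) (w i))%:E &
    forall phi, S phi -> exists2 i, i \in s & owedge (u i) (w i) (unit_vector phi)].
  elim: s us {pos} disj arcs => [|i s IH] /=.
    by move=> *; exists set0; rewrite big_nil measure0; split => // x [].
  move=> /andP[nis us] disj arcs.
  have [||S [mS sS lS wS]] := IH us.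
  - by move=> a b z ha hb; apply: disj; rewrite inE ?ha ?hb orbT.
  - by move=> a ha; apply: arcs; rewrite inE ha orbT.
  have [S' [mS' sS' lS' wS']] := arcs i (mem_head _ _).
  have d : S' `&` S = set0.
    rewrite -subset0 => phi [/wS' h1 /wS[j js h2]].
    apply: (disj i j (unit_vector phi)) => //; rewrite ?mem_head ?inE ?js ?orbT //.
    by apply: contraNneq nis => ->.
  exists (S' `|` S); split; first exact: measurableU.
  - by move=> phi [/sS'|/sS].
  - by have e := measureU lambda mS' mS d; rewrite big_cons EFinD; apply: (etrans e); exact: (congr2 adde lS' lS).
  - move=> phi [/wS' h|/wS[j js h]]; first by exists i; rewrite ?mem_head.
    by exists j; rewrite // inE js orbT.
pose C : set R := `[0, 2 * pi]%classic.
have lC : lambda C = (2 * pi - 0)%:E by apply: lambda_itv; rewrite mulr_ge0 // ltW.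
have : (lambda S <= lambda C)%E by apply: lebesgue_le.
by rewrite lS lC subr0 lee_fin.
Qed.

(** The counterpart for closed arcs, by subadditivity; closed wedges are used so that directions
    along common sides are covered. *)
Lemma wedge_covering (I : eqType) (s : seq I) (u w : I -> plane R) :
  (forall i, i \in s -> 0 < crs (u i) (w i)) ->
  (forall phi, exists2 i, i \in s & cwedge (u i) (w i) (unit_vector phi)) ->
  2 * pi <= \sum_(i <- s) vang (u i) (w i).
Proof.
move=> pos cov.
have [S [mS lS wS]] : exists S, [/\ measurable S,
    (lambda S <= (\sum_(i <- s) vang (u i) (w i))%:E)%E &
    forall i phi, i \in s -> 0 <= phi < 2 * pi -> cwedge (u i) (w i) (unit_vector phi) -> S phi].
  elim: s pos {cov} => [|i s IH] pos.
    by exists set0; rewrite big_nil measure0.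
  have [|S [mS lS wS]] := IH; first by move=> j js; apply: pos; rewrite inE js orbT.
  have c0 := pos i (mem_head _ _); have [theta [l [m [ti l0 m0 H]]]] := wedge_polar c0.
  have ai : 0 < vang (u i) (w i) < pi by rewrite vang_gt0 ?vang_ltpi.
  have mc := measurable_carc theta (vang (u i) (w i)).
  exists (carc theta (vang (u i) (w i)) `|` S); split; first exact: measurableU.
    rewrite big_cons EFinD.
    apply: (@le_trans _ _ (lambda (carc theta (vang (u i) (w i))) + lambda S)%E).
      exact: measureU2.
    by apply: leeD => //; exact: lambda_carc.
  move=> j phi; rewrite inE => /orP[/eqP->|js] f; last by move=> h; right; exact: wS js f h.
  rewrite /cwedge /=; have [-> ->] := H phi; rewrite !pmulr_rge0 // => -[s1 s2].
  by left; exact: carc_sin.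
pose C : set R := `[0, 2 * pi[%classic.
have lC : lambda C = (2 * pi - 0)%:E by apply: lambda_itv; rewrite mulr_ge0 // ltW.
have : (lambda C <= lambda S)%E.
  apply: lebesgue_le => phi; rewrite /C /=; rewrite in_itv /= => f.
  by have [i js h] := cov phi; exact: wS js f h.
by rewrite lC subr0 => h; have := le_trans h lS; rewrite lee_fin.
Qed.

End Wedges.

(** * Invariance under congruence *)

Section Congruence.
Variable R : realType.
Implicit Types (p q : pentagon R) (x y z : plane R) (v w : 'I_5 -> plane R).

Lemma edist_sqr x y : edist x y ^+ 2 = dot (y - x) (y - x).
Proof. exact: elength_sqr. Qed.

Lemma isometry_dot (f : plane R -> plane R) x y z :
  (forall x y, edist (f x) (f y) = edist x y) ->
  dot (f x - f z) (f y - f z) = dot (x - z) (y - z).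
Proof.
move=> iso.
have pol (u a b : plane R) : dot (a - u) (b - u) = (edist u a ^+ 2 + edist u b ^+ 2 - edist b a ^+ 2) / 2.
  by rewrite !edist_sqr /dot /=; field.
by rewrite !pol !iso.
Qed.

(** A product of two orientations is unchanged by reflections too: a product of two cross products
    with a common factor is a polynomial in dot products. *)
Lemma isometry_orient (f : plane R -> plane R) A B C D :
  (forall x y, edist (f x) (f y) = edist x y) ->
  orient (f A) (f B) (f C) * orient (f A) (f B) (f D) = orient A B C * orient A B D.
Proof.
move=> iso; have e u a b : crs u a * crs u b = dot u u * dot a b - dot u a * dot u b :> R.
  by rewrite /crs /dot; ring.
by rewrite /orient !e !isometry_dot.
Qed.

Lemma corner_angle_rev v k : corner_angle (rev v) k = corner_angle v (- k).
Proof.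
rewrite /corner_angle /rev !opprD opprK /vang /vcos dotC.
by rewrite (mulrC (elength _)).
Qed.

(** The isometry and the relabelling permute the angles, so what survives is stated as equality of
    sums of an arbitrary function over the corners. *)
Lemma congruent_traces p q v : congruent p q -> traces p v -> exists w, traces q w /\
  forall F : R -> R, \sum_k F (corner_angle w k) = \sum_k F (corner_angle v k).
Proof.
move=> [f iso [m hm]] [cv hv].
have [c hc] : exists c : 'I_5, (forall i, f (v i) = q (c + i)) \/ (forall i, f (v i) = q (c - i)).
  case: hm => hm; case: hv => hv; exists m.
  - by left => i; rewrite hv -hm.
  - by right => i; rewrite hv -hm.
  - by right => i; rewrite hv -hm.
  - by left => i; rewrite hv -hm opprK.
have ang k : corner_angle (fun i => f (v i)) k = corner_angle v k.
  have d x z : elength (f x - f z) = elength (x - z) by rewrite /elength isometry_dot.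
  by rewrite /corner_angle /vang /vcos (isometry_dot _ _ _ iso) !d.
have side_f : ccw (fun i => f (v i)) \/ ccw (rev (fun i => f (v i))).
  apply: same_side_ccw => k i j ik ik1 jk jk1; rewrite isometry_orient //.
  by apply: mulr_gt0; exact: cv.
have shift w c' F : \sum_k F (corner_angle (fun i => w (c' + i)) k) = \sum_k F (corner_angle w k) :> R.
  rewrite [RHS](reindex_inj (addrI c')) /=.
  by apply: eq_bigr => k _; rewrite corner_shift.
have angF F : \sum_k F (corner_angle (fun i => f (v i)) k) = \sum_k F (corner_angle v k) :> R.
  by apply: eq_bigr => k _; rewrite ang.
have angR F : \sum_k F (corner_angle (rev (fun i => f (v i))) k) = \sum_k F (corner_angle v k) :> R.
  rewrite -angF [RHS](reindex_inj oppr_inj) /=.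
  by apply: eq_bigr => k _; rewrite corner_angle_rev.
case: side_f => cf; case: hc => hc.
- exists (fun i => f (v (- c + i))); split; last by move=> F; rewrite (shift (fun i => f (v i))).
  by split; [exact: (ccw_shift (- c) cf)|left => i; rewrite hc addrA subrr add0r].
- exists (fun i => f (v (c + i))); split; last by move=> F; rewrite (shift (fun i => f (v i))).
  by split; [exact: (ccw_shift c cf)|right => i; rewrite hc opprD addrA subrr add0r].
- exists (fun i => rev (fun i => f (v i)) (c + i)); split; last by move=> F; rewrite shift.
  split; [exact: (ccw_shift c cf)|right => i; rewrite /rev hc opprD addrA subrr add0r //].
- exists (fun i => rev (fun i => f (v i)) (- c + i)); split; last by move=> F; rewrite shift.
  split; [exact: (ccw_shift (- c) cf)|left => i].
  by rewrite /rev hc opprK addrA subrr add0r.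
Qed.

Lemma congruent_perimeter p q : congruent p q -> perimeter q = perimeter p.
Proof.
move=> [f iso [m hm]]; rewrite !perimeterE.
have fp : plength (fun i => f (p i)) = plength p by apply: eq_bigr => k _; rewrite iso.
rewrite -fp -(plength_shift q m); case: hm => hm.
  by apply: eq_bigr => k _; rewrite !hm.
rewrite -plength_rev; apply: eq_bigr => k _.
by rewrite /rev !hm.
Qed.

End Congruence.

(** * Sums over representatives of classes with at most two elements *)

Section Transversal.
Variables (R : realType) (I : finType).

Lemma sum_le_transversal (e : rel I) (F : I -> R) : equivalence_rel e ->
  (forall x, 0 <= F x) -> (forall x y, e x y -> F x = F y) ->
  (forall r, (#|[pred y | e r y]| <= 2)%N) ->
  \sum_x F x <= 2 * \sum_(r in transversal (equivalence_partition e finset.setT) finset.setT) F r.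
Proof.
move=> eqe F0 Fe c2; set P := equivalence_partition e _; set X := transversal P _.
have eqT : {in finset.setT & &, equivalence_rel e} by move=> x y z _ _ _; exact: eqe.
have partP : finset.partition P finset.setT by exact: equivalence_partitionP.
have trX := transversalP partP.
have rep x : exists2 r, r \in X & e r x.
  have xP : finset.pblock P x \in P by apply: finset.pblock_mem; rewrite (finset.cover_partition partP).
  exists (transversal_repr x X (finset.pblock P x)); first exact: repr_mem_transversal trX _ _ xP.
  have := repr_mem_pblock trX x xP.
  rewrite pblock_equivalence_partition // ?finset.in_setT // => h.
  by have [r1 r2] := eqe x (transversal_repr x X (finset.pblock P x)) x; rewrite -(r2 h) r1.
apply: (@le_trans _ _ (\sum_x \sum_(r in X | e r x) F x)).
  apply: ler_sum => x _; have [r rX rx] := rep x.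
  by rewrite (bigD1 r) /= ?rX // lerDl; apply: sumr_ge0.
rewrite (exchange_big_dep (fun r => r \in X)) /=; last by move=> x r _ /andP[].
rewrite mulr_sumr; apply: ler_sum => r rX.
rewrite (eq_bigr (fun _ => F r)); last by move=> x /andP[_ /Fe].
have -> : \sum_(x | (r \in X) && e r x) F r = F r * #|[pred x | (r \in X) && e r x]|%:R.
  by rewrite sumr_const mulr_natr.
rewrite [2 * _]mulrC ler_wpM2l // (ler_nat _ _ 2); apply: leq_trans (c2 r).
by apply: subset_leq_card; apply/fintype.subsetP => y; rewrite !inE => /andP[].
Qed.

End Transversal.

(** * Each edge of the tiling borders at most two tiles *)

Section Edges.
Variable R : realType.
Implicit Types (p q : pentagon R) (A B C D a b d x y z : plane R).

Lemma translateE d (X : set (plane R)) x : translate d X x <-> X (x - d).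
Proof. by split=> [[y Xy <-]|h]; [rewrite addrK|exists (x - d); rewrite ?subrK]. Qed.

Lemma translate_segment d A B : translate d (segment A B) = segment (A + d) (B + d).
Proof.
apply/seteqP; split => x.
  by move=> [_ [t ti ->] <-]; exists t => //; apply: pairE => /=; ring.
move=> [t ti ->]; exists (A.1 + t * (B - A).1, A.2 + t * (B - A).2); first by exists t.
by apply: pairE => /=; ring.
Qed.

(** An end of a segment is an extreme point: [A] is a mixture of [C] and [D], so its parameter 0
    along [A B] is a mixture of their nonnegative parameters. *)
Lemma segment_extreme A B C D : segment A B = segment C D -> A = C \/ A = D.
Proof.
move=> e.
have [s /andP[s0 s1] eA] : segment C D A by rewrite -e; exact: segment_endl.
have [t1 /andP[t10 t11] eC] : segment A B C by rewrite e; exact: segment_endl.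
have [t2 /andP[t20 t21] eD] : segment A B D by rewrite e; exact: segment_endr.
have [AB|AB] := eqVneq B A.
  by left; rewrite eC AB; apply: pairE; rewrite /= subrr mulr0 addr0.
have key : (1 - s) * t1 + s * t2 = 0.
  have e1 : ((1 - s) * t1 + s * t2) * (B - A).1 = 0.
    by have := congr1 fst eA; rewrite eC eD /= => h; lra.
  have e2 : ((1 - s) * t1 + s * t2) * (B - A).2 = 0.
    by have := congr1 snd eA; rewrite eC eD /= => h; lra.
  apply/eqP; apply: contraNT AB => k0; rewrite -subr_eq0; apply/eqP; apply: pairE.
    by apply: (mulfI k0); rewrite e1 mulr0.
  by apply: (mulfI k0); rewrite e2 mulr0.
have k1 : 0 <= (1 - s) * t1 by rewrite mulr_ge0 // subr_ge0.
have k2 : 0 <= s * t2 by rewrite mulr_ge0.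
have /eqP : (1 - s) * t1 = 0 by lra.
rewrite mulf_eq0 => /orP[/eqP h|/eqP h]; last first.
  by left; rewrite eC h; apply: pairE; rewrite /= mul0r addr0.
have : s * t2 = 0 by lra.
have -> : s = 1 by lra.
by rewrite mul1r => h2; right; rewrite eD h2; apply: pairE; rewrite /= mul0r addr0.
Qed.

Lemma segmentC A B : segment A B = segment B A.
Proof. by apply/seteqP; split => x; exact: segment_sym. Qed.

Lemma segment_ends A B C D : segment A B = segment C D -> (A = C /\ B = D) \/ (A = D /\ B = C).
Proof.
move=> e; have e' := segmentC B A; rewrite e in e'.
have h1 := segment_extreme e; have h2 := segment_extreme e'.
have h3 := segment_extreme (esym e).
have h4 : D = A \/ D = B by apply: (@segment_extreme D C A B); rewrite segmentC e.
case: h1 => h1; case: h2 => h2; subst; [|by left|by right|].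
- by left; split => //; case: h4.
- by left; split => //; case: h3.
Qed.

Lemma side_translate p q k l d : side p k = translate d (side q l) ->
  [/\ side_length p k = side_length q l, midpoint p k = midpoint q l + d &
      q (l + 1) - q l = p (k + 1) - p k \/ q (l + 1) - q l = - (p (k + 1) - p k)].
Proof.
rewrite /side translate_segment => /segment_ends h.
case: h => -[e1 e2]; rewrite /side_length /midpoint e1 e2.
  split; last by left; rewrite opprD addrACA subrr addr0.
    by rewrite /edist opprD addrACA subrr addr0.
  by apply: pairE; rewrite /ray /=; ring.
split; last by right; rewrite opprB opprD addrACA subrr addr0.
  by rewrite edistC /edist opprD addrACA subrr addr0.
by apply: pairE; rewrite /ray /=; field.
Qed.

Lemma side_inj p k l : side p k = side p l -> k = l.
Proof.
move=> e; apply/eqP; apply: contraT; rewrite eq_sym => kl.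
by have := @midpoint_other R p k l kl; rewrite -e => /(_ (midpoint_side p k)).
Qed.

Lemma lattice0 a b : lattice a b 0.
Proof. by exists 0, 0; rewrite !mulr0z addr0. Qed.

Lemma latticeN a b d : lattice a b d -> lattice a b (- d).
Proof. by move=> [m [n ->]]; exists (- m), (- n); rewrite !mulrNz opprD. Qed.

Lemma latticeD a b x y : lattice a b x -> lattice a b y -> lattice a b (x + y).
Proof.
by move=> [m [n ->]] [m' [n' ->]]; exists (m + m'), (n + n'); rewrite !mulrzDr addrACA.
Qed.

Lemma latticeB a b x y : lattice a b x -> lattice a b y -> lattice a b (x - y).
Proof. by move=> hx hy; apply: latticeD => //; exact: latticeN. Qed.

Variables (a b : plane R) (N : nat) (T : 'I_N -> pentagon R).
Hypothesis tiling : torus_tiling a b T.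

Lemma same_edge_equiv : equivalence_rel (same_edge a b T).
Proof.
have refl e : same_edge a b T e e.
  apply/asboolP; exists 0; first exact: lattice0.
  by rewrite {2}/side translate_segment !addr0.
have sym e f : same_edge a b T e f -> same_edge a b T f e.
  move=> /asboolP[d ld h]; apply/asboolP; exists (- d); first exact: latticeN.
  by rewrite h /side !translate_segment !addrK.
have trans e f g : same_edge a b T e f -> same_edge a b T f g -> same_edge a b T e g.
  move=> /asboolP[d ld h] /asboolP[d' ld' h']; apply/asboolP; exists (d' + d); first exact: latticeD.
  by rewrite h h' /side !translate_segment !addrA.
move=> e f g; split; first exact: refl.
by move=> ef; apply/idP/idP; [apply: trans; exact: sym|exact: trans].
Qed.

Lemma inside_common i j di dj z : lattice a b di -> lattice a b dj ->
  inside (T i) (z - di) -> inside (T j) (z - dj) -> i = j /\ di = dj.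
Proof.
move=> hi hj zi zj; have [_ _ disj] := tiling.
have [||e d0] := @disj i j (dj - di) (z - di) _ zi.
- exact: latticeB.
- by apply/translateE; rewrite opprB addrA subrK.
- by split => //; apply/eqP; rewrite eq_sym -subr_eq0 d0.
Qed.

(** Just off the midpoint of the edge, on one side or the other, each tile along it has inside
    points. Of three tile sides two would claim the same half-line; their tiles then share an inside
    point, so tile and translation agree, and hence the sides. *)
Lemma same_edge_card e : (#|[pred f | same_edge a b T e f]| <= 2)%N.
Proof.
rewrite leqNgt; apply/negP => /card_gt2P[e1 [e2 [e3 [[]]]]]; rewrite !inE => h1 h2 h3 [n12 n23 n31].
set u := T e.1 (e.2 + 1) - T e.1 e.2; set M := midpoint (T e.1) e.2.
pose n : plane R := (- u.2, u.1).
have un : crs u n != 0.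
  have -> : crs u n = dot u u by rewrite /crs /dot /n /=; ring.
  by rewrite dot_eq0 vertexS_neq.
have local (f : 'I_N * 'I_5) : (exists2 d, lattice a b d & side (T e.1) e.2 = translate d (side (T f.1) f.2)) -> exists d, [/\ lattice a b d, side (T e.1) e.2 = translate d (side (T f.1) f.2) &
    (\forall t \near (0 : R)^'+, inside (T f.1) (ray M n t - d)) \/
    (\forall t \near (0 : R)^'+, inside (T f.1) (ray M n (- t) - d))].
  move=> [d ld h]; exists d; split => //.
  have [_ mid dir] := side_translate h.
  have c0 : crs (T f.1 (f.2 + 1) - T f.1 f.2) n != 0.
    case: dir => ->; first exact: un.
    have -> : crs (- (T e.1 (e.2 + 1) - T e.1 e.2)) n = - crs u n by rewrite /crs /=; ring.
    by rewrite oppr_eq0.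
  have re t : ray (midpoint (T f.1) f.2) n t = ray M n t - d.
    by rewrite /M mid; apply: pairE; rewrite /ray /=; ring.
  have [ins|ins] := side_inside c0; [left|right]; apply: filterS ins => t; by rewrite re.
have [d1 [l1 s1 i1]] := local _ h1; have [d2 [l2 s2 i2]] := local _ h2.
have [d3 [l3 s3 i3]] := local _ h3.
have clash f g d d' (r : R -> R) : f != g -> lattice a b d -> lattice a b d' ->
    side (T e.1) e.2 = translate d (side (T f.1) f.2) ->
    side (T e.1) e.2 = translate d' (side (T g.1) g.2) ->
    (\forall t \near (0 : R)^'+, inside (T f.1) (ray M n (r t) - d)) ->
    (\forall t \near (0 : R)^'+, inside (T g.1) (ray M n (r t) - d')) -> False.
  move=> fg ld ld' sf sg If Ig.
  have [t [tf tg]] : exists t : R, inside (T f.1) (ray M n (r t) - d) /\ inside (T g.1) (ray M n (r t) - d').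
    apply: (@filter_ex _ (0 : R)^'+); near=> t; split; near: t; [exact: If|exact: Ig].
  have [ei ed] := inside_common ld ld' tf tg.
  move: sf; rewrite sg ei ed /side !translate_segment => es.
  have es' : side (T g.1) f.2 = side (T g.1) g.2.
    have := congr1 (translate (- d')) es.
    by rewrite !translate_segment !addrK /side => ->.
  move: fg; rewrite (surjective_pairing f) (surjective_pairing g) ei (side_inj es') eqxx //.
case: i1 => i1; case: i2 => i2; case: i3 => i3.
- exact: clash _ _ _ _ (fun t => t) n12 l1 l2 s1 s2 i1 i2.
- exact: clash _ _ _ _ (fun t => t) n12 l1 l2 s1 s2 i1 i2.
- exact: clash _ _ _ _ (fun t => t) n31 l3 l1 s3 s1 i3 i1.
- exact: clash _ _ _ _ (fun t => - t) n23 l2 l3 s2 s3 i2 i3.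
- exact: clash _ _ _ _ (fun t => t) n23 l2 l3 s2 s3 i2 i3.
- exact: clash _ _ _ _ (fun t => - t) n31 l3 l1 s3 s1 i3 i1.
- exact: clash _ _ _ _ (fun t => - t) n12 l1 l2 s1 s2 i1 i2.
- exact: clash _ _ _ _ (fun t => - t) n12 l1 l2 s1 s2 i1 i2.
Unshelve. all: by end_near. Qed.

Lemma sum_perimeter_le :
  \sum_i perimeter (T i) <= 2 * \sum_(e in edges a b T) side_length (T e.1) e.2.
Proof.
have -> : \sum_i perimeter (T i) = \sum_e side_length (T e.1) e.2.
  by rewrite /perimeter pair_big.
apply: sum_le_transversal.
- exact: same_edge_equiv.
- by move=> e; exact: edist_ge0.
- by move=> e f /asboolP[d _ /side_translate[]].
- exact: same_edge_card.
Qed.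

End Edges.

(** * Corners around a vertex of the tiling *)

Section VertexStar.
Variable R : realType.
Implicit Types (p : pentagon R) (x y z d : plane R) (v : 'I_5 -> plane R).

Lemma orient_ray (A B x z : plane R) (t : R) : orient A B (ray x z t) = orient A B x + t * crs (B - A) z.
Proof. by rewrite /orient /ray /crs /=; ring. Qed.

Lemma owedge_opoly v k z : ccw v -> owedge (v (k + 1) - v k) (v (k - 1) - v k) z ->
  \forall t \near (0 : R)^'+, opoly v (ray (v k) z t).
Proof.
move=> cv [h1 h2].
have : forall m, \forall t \near (0 : R)^'+, 0 < orient (v m) (v (m + 1)) (ray (v k) z t).
  move=> m; have [->|mk] := eqVneq m k.
    near=> t; have t0 : 0 < t by [].
    by rewrite orient_ray orient1 add0r mulr_gt0.
  have [->|mk1] := eqVneq m (k - 1).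
    near=> t; have t0 : 0 < t by [].
    rewrite subrK orient_ray orient2 add0r mulr_gt0 //.
    have -> : crs (v k - v (k - 1)) z = crs z (v (k - 1) - v k) by rewrite /crs /=; ring.
    by [].
  have pos : 0 < orient (v m) (v (m + 1)) (v k).
    apply: cv; first by rewrite eq_sym.
    by apply: contra mk1 => /eqP->; rewrite addrK.
  exact: near_right (near_ray z (near_gt (@continuous_orient R (v m) (v (m + 1))) pos)).
move=> h; exact: filter_forall h.
Unshelve. all: by end_near. Qed.

Lemma cwedge_cpoly v k z (t : R) : 0 < t -> cpoly v (ray (v k) z t) ->
  cwedge (v (k + 1) - v k) (v (k - 1) - v k) z.
Proof.
move=> t0 h; split.
  by have := h k; rewrite orient_ray orient1 add0r pmulr_rge0.
have := h (k - 1); rewrite subrK orient_ray orient2 add0r pmulr_rge0 //.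
have -> : crs (v k - v (k - 1)) z = crs z (v (k - 1) - v k) by rewrite /crs /=; ring.
by [].
Qed.

(** Off the outline, a short piece of the ray avoids the outline and stays in the component of [x],
    which is unbounded when [x] is outside. *)
Lemma region_ray p x z : ~ region p x -> \forall t \near (0 : R)^'+, ~ region p (ray x z t).
Proof.
move=> nr; have nout : ~ outline p x by move=> h; apply: nr; left.
have /nbhs_ballP[e e0 he] := near_ray z (near_not_outline nout).
near=> t.
have t0 : 0 < t by [].
have te : t < e by near: t; exact: nbhs_right_lt.
have free s : 0 <= s <= t -> ~ outline p (ray x z s).
  move=> /andP[s0 s1]; apply: he; rewrite /ball /= sub0r normrN ger0_norm //.
  exact: le_lt_trans s1 te.
case=> [|[_ bt]]; first by apply: free; rewrite lexx ltW.
apply: nr; right; split => //.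
suff <- : connected_component (~` outline p) (ray x z t) = connected_component (~` outline p) x by [].
apply: same_connected_component; rewrite /connected_component.
exists (ray x z @` `[0, t]%classic); first split.
- by exists t; rewrite //= in_itv /= lexx ltW.
- by move=> _ [s /= + <-]; rewrite in_itv; exact: free.
- by apply: connected_ray; exact: interval_is_interval.
- by exists 0; rewrite ?ray0 //= in_itv /= lexx ltW.
Unshelve. all: by end_near. Qed.

Lemma region_norm p y (B : R) : (forall k, `|(p k).1| <= B /\ `|(p k).2| <= B) -> region p y ->
  `|y.1| <= B /\ `|y.2| <= B.
Proof.
move=> hB ry.
have sep n : ~ (forall k, 0 < dot n (p k - y)) by move=> h; exact: (region_separated h ry).
have b k : [/\ - B <= (p k).1, (p k).1 <= B, - B <= (p k).2 & (p k).2 <= B].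
  by have [] := hB k; rewrite !ler_norml => /andP[? ?] /andP[? ?].
rewrite !ler_norml; split; apply/andP; split; rewrite leNgt; apply/negP => h.
- by apply: (sep (1, 0)) => k; have [b1 b2 b3 b4] := b k; rewrite /dot /=; lra.
- by apply: (sep (- 1, 0)) => k; have [b1 b2 b3 b4] := b k; rewrite /dot /=; lra.
- by apply: (sep (0, 1)) => k; have [b1 b2 b3 b4] := b k; rewrite /dot /=; lra.
- by apply: (sep (0, - 1)) => k; have [b1 b2 b3 b4] := b k; rewrite /dot /=; lra.
Qed.

Variables (a b : plane R) (N : nat) (T : 'I_N -> pentagon R).
Hypothesis tiling : torus_tiling a b T.

(** Cramer's rule for the lattice coordinates, so that bounded lattice vectors have bounded
    coordinates. *)
Let coef d (m n : int) : d = a *~ m + b *~ n ->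
  crs d b = m%:~R * crs a b /\ crs a d = n%:~R * crs a b.
Proof.
have c (u : plane R) (i : int) : u *~ i = (i%:~R * u.1, i%:~R * u.2).
  have cn (k : nat) : u *+ k = (k%:R * u.1, k%:R * u.2).
    elim: k => [|k IH]; first by apply: pairE; rewrite /= mulr0n mul0r.
    by rewrite mulrS IH; apply: pairE; rewrite /= -addn1 natrD; ring.
  case: i => k; first exact: cn.
  rewrite NegzE mulrNz -pmulrn cn; apply: pairE; rewrite /= mulrNz -pmulrn; ring.
by move=> ->; rewrite !c /crs /=; split; ring.
Qed.

Let coef_bounded (B : R) : 0 <= B -> exists K : nat, forall m n : int,
  let d := a *~ m + b *~ n in `|d.1| <= B -> `|d.2| <= B -> (`|m| <= K)%N /\ (`|n| <= K)%N.
Proof.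
move=> B0; have [ind _ _] := tiling.
have c0 : 0 < `|crs a b| by rewrite normr_gt0.
pose L := B * (`|a.1| + `|a.2| + `|b.1| + `|b.2|) / `|crs a b|.
exists (Num.bound L) => m n d h1 h2.
have [e1 e2] := @coef d m n erefl.
have L0 : 0 <= L by rewrite divr_ge0 // mulr_ge0 // !addr_ge0.
have fin (i : int) (s : R) : i%:~R * crs a b = s ->
    `|s| <= B * (`|a.1| + `|a.2| + `|b.1| + `|b.2|) -> (`|i| <= Num.bound L)%N.
  move=> es hs; rewrite -(ler_nat R) natr_absz intr_norm.
  apply: ltW; apply: le_lt_trans (archi_boundP L0).
  by rewrite /L ler_pdivlMr // -normrM es.
have a1 := normr_ge0 a.1; have a2 := normr_ge0 a.2.
have b1 := normr_ge0 b.1; have b2 := normr_ge0 b.2.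
have t (f g k l : R) : `|f * g - k * l| <= `|f| * `|g| + `|k| * `|l|.
  by rewrite -!normrM; apply: ler_normB.
split.
  apply: fin (esym e1) _; rewrite /crs; apply: le_trans (t _ _ _ _) _.
  have g1 := ler_wpM2r b2 h1; have g2 := ler_wpM2r b1 h2.
  have := mulr_ge0 B0 a1; have := mulr_ge0 B0 a2; lra.
apply: fin (esym e2) _; rewrite /crs; apply: le_trans (t _ _ _ _) _.
have g1 := ler_wpM2l a1 h2; have g2 := ler_wpM2l a2 h1.
have := mulr_ge0 B0 b1; have := mulr_ge0 B0 b2; lra.
Qed.

(* Only finitely many translated tiles come near x, so one of them contains
   points of the ray arbitrarily close to x. *)
Lemma tile_along_ray x z : exists i d, lattice a b d /\
  ~ (\forall t \near (0 : R)^'+, ~ region (T i) (ray x z t - d)).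
Proof.
apply: contrapT => H.
have far i d : lattice a b d -> \forall t \near (0 : R)^'+, ~ region (T i) (ray x z t - d).
  by move=> ld; apply: contrapT => h; apply: H; exists i, d.
pose B0 := \sum_i \sum_k (`|(T i k).1| + `|(T i k).2|).
have tB i k : `|(T i k).1| <= B0 /\ `|(T i k).2| <= B0.
  have s0 j : 0 <= \sum_k (`|(T j k).1| + `|(T j k).2|).
    by apply: sumr_ge0 => l _; rewrite addr_ge0.
  have le : `|(T i k).1| + `|(T i k).2| <= B0.
    rewrite /B0 (bigD1 i) //= (bigD1 k) //= -addrA lerDl addr_ge0 ?sumr_ge0 // => l _.
  by split; apply: le_trans le; rewrite ?lerDl ?lerDr.
have B00 : 0 <= B0 by apply: sumr_ge0 => i _; apply: sumr_ge0 => k _; rewrite addr_ge0.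
pose B := B0 + (`|x.1| + `|z.1|) + (`|x.2| + `|z.2|).
have BB : 0 <= B by rewrite /B !addr_ge0.
have [K hK] := coef_bounded BB.
(* Enumerates the integers from [- K] to [K] by a finite type, so that finitely many neighbourhoods
   can be intersected. *)
pose dd (i : 'I_(K + K).+1) : int := (i : nat)%:Z - K%:Z.
have ddK (m : int) : (`|m| <= K)%N -> exists i, m = dd i.
  move=> mK; have mk : (`|(m + K%:Z)%R| < (K + K).+1)%N by lia.
  by exists (Ordinal mk); rewrite /dd /=; lia.
have near_free : \forall t \near (0 : R)^'+, forall c : 'I_N * ('I_(K + K).+1 * 'I_(K + K).+1),
    ~ region (T c.1) (ray x z t - (a *~ dd c.2.1 + b *~ dd c.2.2)).
  by apply: filter_forall => c; apply: far; exists (dd c.2.1), (dd c.2.2).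
have [t [t0 t1 ht]] : exists t : R, [/\ 0 < t, t < 1 & forall c : 'I_N * ('I_(K + K).+1 * 'I_(K + K).+1),
    ~ region (T c.1) (ray x z t - (a *~ dd c.2.1 + b *~ dd c.2.2))].
  apply: (@filter_ex _ (0 : R)^'+); near=> t; split.
  - by [].
  - by near: t; apply: nbhs_right_lt; exact: ltr01.
  - by near: t; exact: near_free.
have [_ cover _] := tiling.
have [i [d [ld /translateE r]]] := cover (ray x z t).
have [m [n ed]] := ld.
have [r1 r2] := region_norm (tB i) r.
have nb (f g h : R) : `|f + t * g - h| <= B0 -> `|h| <= B0 + (`|f| + `|g|).
  move=> hh; have -> : h = (f + t * g) - (f + t * g - h) by ring.
  apply: le_trans (ler_normB _ _) _; rewrite addrC lerD //.
  apply: le_trans (ler_normD _ _) _; rewrite lerD // normrM (ger0_norm (ltW t0)).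
  by rewrite ler_piMl // ltW.
have d1 : `|d.1| <= B.
  by apply: le_trans (nb _ _ _ r1) _; rewrite /B lerDl addr_ge0.
have d2 : `|d.2| <= B.
  apply: le_trans (nb _ _ _ r2) _; rewrite /B -addrA lerD2l lerDr addr_ge0 //.
rewrite ed in d1 d2; have [/ddK[im em] /ddK[jn en]] := hK m n d1 d2.
by apply: (ht (i, (im, jn))); rewrite /= -em -en -ed.
Unshelve. all: by end_near. Qed.

Hypothesis matching : edge_to_edge a b T.

Lemma vertex_endpoint p k l : side p l (p k) -> p k = p l \/ p k = p (l + 1).
Proof.
move=> h; have [->|kl] := eqVneq k l; first by left.
have [_ simple] := vertex_simple p.
have [[e1 e2]|[-> _]] := simple k l (p k) kl (segment_endl _ _) h; [by left|by right].
Qed.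

(** In the second alternative of [edge_to_edge] the vertex lies on a common side. Simplicity makes
    it an end of that side in its own tile, and equal segments have equal ends. *)
Lemma vertex_meets i k j d : lattice a b d -> region (T j) (T i k - d) ->
  exists l, T i k = T j l + d.
Proof.
move=> ld rj; have [[ij d0]|ne] := pselect (i = j /\ d = 0).
  by exists k; rewrite -ij d0 addr0.
have ri : region (T i) (T i k) by left; exists k => //; exact: segment_endl.
have rj' : translate d (region (T j)) (T i k) by apply/translateE.
have [[m [l [_ e]]]|[m [l [h e]]]] := matching ld ne ri rj'; first by exists l.
move: e; rewrite /side translate_segment => /segment_ends e.
have [->|->] := vertex_endpoint h; case: e => -[e1 e2].
- by exists l.
- by exists (l + 1).
- by exists (l + 1).
- by exists l.
Qed.

(** [good] stands for the tiles congruent to the efficient pentagon; [V] relists their corners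
    counterclockwise. *)
Variables (good : pred 'I_N) (V : 'I_N -> 'I_5 -> plane R).
Hypothesis good_traces : forall i, good i -> traces (T i) (V i).
Hypothesis bad_vertices : forall i, ~~ good i -> forall k, V i k = T i k.

Let V_vertex i k : exists l, V i k = T i l.
Proof.
case gi : (good i); last by exists k; rewrite bad_vertices ?gi.
by have [h _] := traces_vertex (good_traces gi).
Qed.

Let vertex_V i l : exists k, T i l = V i k.
Proof.
case gi : (good i); last by exists l; rewrite bad_vertices ?gi.
by have [_ h] := traces_vertex (good_traces gi).
Qed.

Let V_inj i : good i -> injective (V i).
Proof.
move=> /good_traces[_ [e|e]] k l; rewrite !e => /vertex_inj //.
exact: oppr_inj.
Qed.

Let corner (c : 'I_N * 'I_5) : plane R := V c.1 c.2.

Definition same_vertex : rel ('I_N * 'I_5) :=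
  fun c c' => `[< exists2 d, lattice a b d & corner c = corner c' + d >].

Let same_vertex_equiv : equivalence_rel same_vertex.
Proof.
have refl c : same_vertex c c by apply/asboolP; exists 0; rewrite ?addr0 //; exact: lattice0.
have sym c e : same_vertex c e -> same_vertex e c.
  move=> /asboolP[d ld h]; apply/asboolP; exists (- d); first exact: latticeN.
  by rewrite h addrK.
have trans c e f : same_vertex c e -> same_vertex e f -> same_vertex c f.
  move=> /asboolP[d ld h] /asboolP[d' ld' h']; apply/asboolP; exists (d' + d); first exact: latticeD.
  by rewrite h h' addrA.
move=> c e f; split; first exact: refl.
by move=> ce; apply/idP/idP; [apply: trans; exact: sym|exact: trans].
Qed.

Let star c : {set 'I_N * 'I_5} := [set e | same_vertex c e & good e.1].

Let u (c : 'I_N * 'I_5) := V c.1 (c.2 + 1) - V c.1 c.2.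
Let w (c : 'I_N * 'I_5) := V c.1 (c.2 - 1) - V c.1 c.2.

(** Two corners at one vertex whose open wedges share a direction have a common inside point on that
    ray close to the vertex, so they coincide. *)
Let star_packing c : \sum_(e in star c) vang (u e) (w e) <= 2 * pi.
Proof.
rewrite -big_enum; apply: wedge_packing; first exact: enum_uniq.
  by move=> e; rewrite mem_enum inE => /andP[_ /good_traces[cv _]]; exact: ccw_corner.
move=> e f z; rewrite !mem_enum !inE => /andP[/asboolP[d ld hd] ge] /andP[/asboolP[d' ld' hd'] gf] ef ze zf.
have near_in h dh : good h.1 -> corner c = corner h + dh -> owedge (u h) (w h) z ->
    \forall t \near (0 : R)^'+, inside (T h.1) (ray (corner c) z t - dh).
  move=> gh eh zh; have th := good_traces gh.
  apply: filterS (owedge_opoly th.1 zh) => t /(opoly_inside th).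
  congr inside; apply: pairE; rewrite eh /corner /ray /=; ring.
have [t [te tf]] : exists t : R, inside (T e.1) (ray (corner c) z t - d) /\
    inside (T f.1) (ray (corner c) z t - d').
  apply: (@filter_ex _ (0 : R)^'+); near=> t.
  by split; near: t; apply: near_in.
have [e1 ed] := inside_common tiling ld ld' te tf.
move: hd; rewrite hd' ed => /addIr; rewrite /corner -e1 => /(V_inj ge) e2.
by move: ef; rewrite (surjective_pairing e) (surjective_pairing f) e1 e2 eqxx.
Unshelve. all: by end_near. Qed.

(** In every direction some tile has points of the ray arbitrarily close to the vertex. By
    [region_ray] it contains the vertex, by [vertex_meets] it has a corner there, and its convexity
    puts the direction in the closed wedge of that corner. *)
Let star_covering c : (forall e, same_vertex c e -> good e.1) ->
  2 * pi <= \sum_(e in star c) vang (u e) (w e).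
Proof.
move=> all_good; rewrite -big_enum; apply: wedge_covering.
  by move=> e; rewrite mem_enum inE => /andP[_ /good_traces[cv _]]; exact: ccw_corner.
move=> phi; set z := unit_vector phi.
have [i [d [ld H]]] := tile_along_ray (corner c) z.
have [l el] := V_vertex c.1 c.2.
have ri : region (T i) (corner c - d).
  apply: contrapT => nr; apply: H; apply: filterS (region_ray z nr) => t.
  by congr (~ region _ _); apply: pairE; rewrite /ray /=; ring.
have [m em] : exists m, corner c = T i m + d.
  by move: ri; rewrite /corner el; exact: vertex_meets.
have [k ek] := vertex_V i m.
have ce : same_vertex c (i, k) by apply/asboolP; exists d; rewrite // em ek.
have gi : good i := all_good _ ce.
exists (i, k); first by rewrite mem_enum inE ce.
apply: contrapT => nw; apply: H; near=> t; have t0 : 0 < t by [].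
move=> /(region_cpoly (good_traces gi)) h; apply: nw.
apply: (cwedge_cpoly t0); move: h; congr cpoly.
by rewrite em ek; apply: pairE; rewrite /ray /=; ring.
Unshelve. all: by end_near. Qed.

Let star_excess c : - (3 * excess_floor R) * #|[set e | same_vertex c e & ~~ good e.1]|%:R <=
  \sum_(e in star c) corner_excess (corner_angle (V e.1) e.2).
Proof.
apply: (@vertex_excess R _ (star c) (fun e => vang (u e) (w e))).
- by move=> e; rewrite inE => /andP[_ /good_traces[cv _]]; exact: corner_itv.
- exact: star_packing.
- move=> /eqP; rewrite cards_eq0 => /eqP e0; apply: star_covering => e se.
  apply/negPn/negP => ng; have : e \in [set e | same_vertex c e & ~~ good e.1] by rewrite inE se.
  by rewrite e0 inE.
Qed.

(** Sums [vertex_excess] over the vertices of the torus; a non-convex tile is charged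
    [3 * excess_floor] at each of its five corners. *)
Lemma total_excess : - (15 * excess_floor R) * #|[pred i | ~~ good i]|%:R <=
  \sum_(i | good i) \sum_k corner_excess (corner_angle (V i) k).
Proof.
(* The total of [G] is grouped in two ways: by vertex classes, where each group is nonnegative, and
   by tiles. *)
pose G (e : 'I_N * 'I_5) : R :=
  if good e.1 then corner_excess (corner_angle (V e.1) e.2) else 3 * excess_floor R.
have G0 : 0 <= \sum_e G e.
  have partP : finset.partition (equivalence_partition same_vertex finset.setT) finset.setT.
    by apply: equivalence_partitionP => x y z _ _ _; exact: same_vertex_equiv.
  have -> : \sum_e G e = \sum_(e in finset.setT) G e by apply: eq_bigl => e; rewrite inE.
  rewrite (set_partition_big _ partP) /=; apply: sumr_ge0 => A /imsetP[c _ ->].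
  rewrite (bigID (fun e => good e.1)) /=.
  have -> : \sum_(e in [set y in finset.setT | same_vertex c y] | good e.1) G e =
      \sum_(e in star c) corner_excess (corner_angle (V e.1) e.2).
    rewrite (eq_bigl (fun e => e \in star c)); last by move=> e; rewrite !inE.
    by apply: eq_bigr => e; rewrite inE /G => /andP[_ ->].
  have -> : \sum_(e in [set y in finset.setT | same_vertex c y] | ~~ good e.1) G e =
      3 * excess_floor R * #|[set e | same_vertex c e & ~~ good e.1]|%:R.
    rewrite (eq_bigl (fun e => e \in [set e | same_vertex c e & ~~ good e.1])); last by move=> e; rewrite !inE.
    rewrite (eq_bigr (fun _ => 3 * excess_floor R)); last first.
      by move=> e; rewrite inE /G => /andP[_ /negbTE->].
    by rewrite sumr_const mulr_natr.
  by have := star_excess c; lra.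
have : \sum_e G e = \sum_(i | good i) \sum_k corner_excess (corner_angle (V i) k) +
   15 * excess_floor R * #|[pred i | ~~ good i]|%:R.
  rewrite -(pair_bigA _ (fun i k => G (i, k))) /= (bigID good) /=; congr (_ + _).
    by apply: eq_bigr => i gi; apply: eq_bigr => k _; rewrite /G gi.
  rewrite (eq_bigr (fun _ => 15 * excess_floor R)); last first.
    by move=> i /negbTE gi; rewrite sum5 /G gi; ring.
  by rewrite sumr_const mulr_natr.
by move=> e; rewrite e in G0; lra.
Qed.

End VertexStar.

(** * The hypotheses on the tiling are contradictory *)

Theorem proposition4p4 (R : realType) (a b : R * R) (N : nat)
    (T : 'I_N -> pentagon R) (E Q P : pentagon R)
    (hT : torus_tiling a b T) (hedge : edge_to_edge a b T)
    (hE : efficient E) (hQ : type2 Q) (areaQ : area Q = 1%E)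
    (hdi : dihedral T E Q)
    (hP : prismatic P) (areaP : area P = 1%E)
    (hper : perimeter_per_tile a b T <= perimeter P / 2) :
  (count_congruent T E)%:R / (count_congruent T Q)%:R > (3477%:R / 100%:R : R).
Proof.
exfalso; have [_ cong [iE hiE] [iQ hiQ]] := hdi.
pose good i := `[< congruent E (T i) >].
have [vE trE] := efficient_traces hE.
have [pE0 pE2] := efficient_perimeter_le hE.
have pQ4 := type2_perimeter hQ areaQ.
have pge0 (p : pentagon R) : 0 <= perimeter p.
  by apply: sumr_ge0 => k _; exact: edist_ge0.
(* A tile congruent to both prototiles would have a perimeter whose fourth power is at most 256 and
   at least 432. *)
have badQ : ~~ good iQ.
  apply/negP => /asboolP /congruent_perimeter e.
  move: pQ4; rewrite -(congruent_perimeter hiQ) e leNgt => /negP; apply.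
  have q2 : Num.sqrt 3 <= 2 :> R.
    have q0 := sqrtr_ge0 (3 : R); have qq : Num.sqrt 3 ^+ 2 = 3 :> R by rewrite sqr_sqrtr //; lra.
    by move: (Num.sqrt 3) q0 qq => q q0 qq; nra.
  have s0 := sqr_ge0 (perimeter E).
  have s1 : perimeter E ^+ 2 <= 16 by apply: le_trans pE2 _; lra.
  by have := ler_pM s0 s0 s1 s1; rewrite -exprD; lra.
have goodE : good iE by apply/asboolP.
have /choice[V hV] : forall i, exists v : 'I_5 -> plane R,
    (good i -> traces (T i) v /\ forall F : R -> R,
       \sum_k F (corner_angle v k) = \sum_k F (corner_angle vE k)) /\
    (~~ good i -> forall k, v k = T i k).
  move=> i; have [gi|gi] := boolP (good i); last by exists (T i).
  by have [w hw] := congruent_traces (asboolW gi) trE; exists w.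
have tot := total_excess hT hedge (fun i gi => ((hV i).1 gi).1) (fun i bi => (hV i).2 bi).
set x := #|[pred i | good i]|; set y := #|[pred i | ~~ good i]| in tot.
have xyN : (x + y)%N = N.
  by rewrite -[RHS]card_ord -(cardC [pred i | good i]); congr (_ + _)%N; apply: eq_card.
have x0 : (0 : R) < x%:R by rewrite ltr0n; apply/card_gt0P; exists iE.
have y0 : (0 : R) < y%:R by rewrite ltr0n; apply/card_gt0P; exists iQ.
set C := \sum_k hcot (corner_angle vE k).
have csum (q : pred 'I_N) (c : R) : \sum_(i | q i) c = #|[pred i | q i]|%:R * c.
  by rewrite sumr_const mulr_natl.
have exc : \sum_(i | good i) \sum_k corner_excess (corner_angle (V i) k) =
    x%:R * (C - (2 + Num.sqrt 3)).
  rewrite (eq_bigr (fun _ => C - (2 + Num.sqrt 3))); last first.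
    by move=> i gi; rewrite ((hV i).1 gi).2 corner_excess_sum //; exact: trE.1.
  exact: csum.
have per : \sum_i perimeter (T i) = x%:R * perimeter E + y%:R * perimeter Q.
  rewrite (bigID good) /=; congr (_ + _).
    rewrite (eq_bigr (fun _ => perimeter E)); first exact: csum.
    by move=> i /asboolP /congruent_perimeter.
  rewrite (eq_bigr (fun _ => perimeter Q)); first exact: csum.
  by move=> i /asboolPn gi; case: (cong i) => // /congruent_perimeter.
have budget : x%:R * perimeter E + y%:R * perimeter Q <= (x%:R + y%:R) * perimeter P.
  rewrite -per; apply: le_trans (sum_perimeter_le hT) _.
  have NE : N%:R = x%:R + y%:R :> R by rewrite -xyN natrD.
  move: hper; rewrite /perimeter_per_tile ler_pdivrMr ?NE ?addr_gt0 //; lra.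
rewrite exc in tot.
apply: (perimeter_budget x0 y0 pE0 (pge0 P) (prismatic_perimeter hP areaP) pE2
  (pge0 Q) pQ4 (perimeter_ge_hcot trE hE.1) tot budget).
Qed.
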